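(* Fix a nonempty $I\subseteq[d]$ and write $k=|I|$. (i) If $f\in BV(S)$ is a probability density and $\varphi\in L^\infty(S)$, then $$|\mathbb E_f[\varphi]|\le\frac1{2k}\,\Lambda_{\mathrm{sl}}^I(\mathcal P_I\varphi)\,\mathrm{TV}_I(f;S)+\|\mathcal R_I\varphi\|_{L^\infty(S)}.$$ (ii) If $f\in C^k(\overline S)$ is a probability density and $\varphi\in L^\infty(S)$, then $$|\mathbb E_f[\varphi]|\le 2^{-k}\,\Lambda_{\mathrm{mix}}^I(\mathcal P_I\varphi)\int_S|\partial_If(\omega)|\,d\omega+\|\mathcal R_I\varphi\|_{L^\infty(S)}.$$ If $\mathcal R_I\varphi=0$, equivalently if $\varphi$ is centered on $I$, these become the exact-centered bounds $|\mathbb E_f[\varphi]|\le\frac1{2k}\Lambda_{\mathrm{sl}}^I(\varphi)\mathrm{TV}_I(f;S)$ and $|\mathbb E_f[\varphi]|\le 2^{-k}\Lambda_{\mathrm{mix}}^I(\varphi)\int_S|\partial_If|\,d\omega$, respectively. For $I=[d]$, the second estimate is the smooth defect-adjusted Vitali bound, i.e. $$|\mathbb E_f[\varphi]|\le 2^{-d}\,\|\mathcal P_{[d]}\varphi\|_{L^1(S)}\,V(f;S)+\|\mathcal R_{[d]}\varphi\|_{L^\infty(S)}.$$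
   Context: Let $d\ge 1$, $[d]=\{1,\dots,d\}$, and let $S=\prod_{i=1}^d[a_i,b_i]\subset\mathbb R^d$ be a box with $a_i<b_i$. For $I\subseteq[d]$ write $\omega_I=(\omega_i)_{i\in I}$, $\omega_{-I}=(\omega_j)_{j\notin I}$, $S_I=\prod_{i\in I}[a_i,b_i]$, $S_{-I}=\prod_{j\notin I}[a_j,b_j]$ (a singleton if $I=[d]$), and $-i$ for $-\{i\}$. A probability density on $S$ is a nonnegative integrable function with integral $1$; $\mathbb E_f[\varphi]=\int_S\varphi f\,d\omega$. Projectors: $(\Pi_i\varphi)(\omega)=\frac1{b_i-a_i}\int_{a_i}^{b_i}\varphi(\omega_{-i},t)\,dt$ ($t$ inserted in coordinate $i$); these operators commute. $\mathcal P_I=\prod_{i\in I}(\mathrm{Id}-\Pi_i)$, $\mathcal R_I=\mathrm{Id}-\mathcal P_I$. $\varphi$ is centered on $I$ if $\Pi_i\varphi=0$ a.e. for all $i\in I$. Envelopes: $$\Lambda_{\mathrm{sl}}^I(\varphi)=\max_{i\in I}\operatorname*{ess\,sup}_{\omega_{-i}\in S_{-i}}\int_{a_i}^{b_i}|\varphi(\omega_{-i},t)|\,dt,\qquad \Lambda_{\mathrm{mix}}^I(\varphi)=\operatorname*{ess\,sup}_{\omega_{-I}\in S_{-I}}\int_{S_I}|\varphi(\omega_{-I},t_I)|\,dt_I,$$ with $\Lambda_{\mathrm{mix}}^{[d]}(\varphi)=\|\varphi\|_{L^1(S)}$. Variation: for $f\in BV(S)$, $D_if$ is the $i$th distributional derivative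 measure on the interior of $S$, $|D_if|(S)$ its total variation mass on the interior, and $\mathrm{TV}_I(f;S)=\sum_{i\in I}|D_if|(S)$. For $I=\{i_1<\cdots<i_k\}$, $\partial_If=\partial_{i_1}\cdots\partial_{i_k}f$. $C^k(\overline S)$ denotes functions $C^k$ up to the boundary of $S$. Vitali variation: $V(f;S)=\sup_{\mathcal Q}\sum_{S_j\in\mathcal Q}|\sigma(f,S_j)|$ over finite families $\mathcal Q$ of axis-parallel closed boxes $S_j=\prod_\ell[a^j_\ell,b^j_\ell]$ with pairwise disjoint interiors and union $S$, where $\sigma(f,S_j)=\sum_{\nu\in\{0,1\}^d}(-1)^{\nu_1+\cdots+\nu_d}f(b^j+\nu\odot(a^j-b^j))$. For $f\in C^d(\overline S)$ one has $V(f;S)=\int_S|\partial_1\cdots\partial_df|\,d\omega$. *)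

(* Defs.v *)
From HB Require Import structures.
From mathcomp Require Import all_boot all_order all_algebra.
From mathcomp Require Import all_classical all_reals all_analysis.
From mathcomp Require Import ess_sup_inf.

Set Implicit Arguments.
Unset Strict Implicit.
Unset Printing Implicit Defensive.

Import Order.TTheory GRing.Theory Num.Theory.
Import numFieldNormedType.Exports.

Local Open Scope classical_set_scope.
Local Open Scope ring_scope.

(* R^n is 'rV[R]_n, which carries the library's norm and topology. Its
   sigma-algebra is the product one, generated by the coordinates (as the
   library does for tuples); it is the Borel sigma-algebra. *)

Definition rV_display : measure_display.
Proof. exact: default_measure_display. Qed.

Definition rV_coord (R : realType) (n : nat) (i : 'I_n) (x : 'rV[R]_n) : R :=
  x 0 i.

HB.instance Definition _ (R : realType) (n : nat) :=
  @isMeasurable.Build rV_display 'rV[R]_n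
    (g_sigma_preimage (@rV_coord R n))
    (@sigma_algebra0 _ _ _) (fun A => @sigma_algebraC _ _ A)
    (@sigma_algebra_bigcup _ _ _).

Lemma measurable_rV_coord (R : realType) (n : nat) (i : 'I_n) :
  measurable_fun [set: 'rV[R]_n] (@rV_coord R n i).
Proof.
move=> _ Y mY; rewrite setTI; apply: sub_sigma_algebra => /=.
rewrite -bigcup_seq/=; exists i => /=; first by rewrite mem_index_enum.
by exists Y => //; rewrite setTI.
Qed.

Lemma measurable_fun_rV (R : realType) (n : nat) (d : measure_display)
    (T : measurableType d) (f : T -> 'rV[R]_n) :
  (forall i, measurable_fun [set: T] (fun x => f x 0 i)) ->
  measurable_fun [set: T] f.
Proof.
move=> mf _ A; rewrite setTI => mA.
pose G : set (set 'rV[R]_n) := [set B | measurable (f @^-1` B)].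
suff : g_sigma_preimage (@rV_coord R n) `<=` G by apply.
apply: smallest_sub.
  split; rewrite /G /=.
  - by rewrite preimage_set0.
  - by move=> B mB; rewrite setTD preimage_setC; exact: measurableC.
  - by move=> F mF; rewrite preimage_bigcup; exact: bigcup_measurable.
move=> B; rewrite -bigcup_seq/= => -[i _ [C mC <-]].
by rewrite /G /= setTI -[X in measurable X]setTI; exact: mf.
Qed.

(* n-dimensional Lebesgue measure: the n-fold product of the library's
   Lebesgue measure on R. *)

Definition rV_rcons (R : realType) (n : nat) (p : 'rV[R]_n * R) : 'rV[R]_n.+1 :=
  \row_i (if unlift ord_max i is Some j then p.1 0 j else p.2).

Lemma measurable_rV_rcons (R : realType) (n : nat) :
  measurable_fun [set: 'rV[R]_n * R] (@rV_rcons R n).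
Proof.
apply: measurable_fun_rV => i; under eq_fun do rewrite mxE.
case: (unlift ord_max i) => [j|]; last exact: measurable_snd.
exact: (measurableT_comp (@measurable_rV_coord R n j) measurable_fst).
Qed.

Definition measure_rcons (R : realType) (n : nat)
    (mu : {measure set 'rV[R]_n -> \bar R}) :
    {measure set 'rV[R]_n.+1 -> \bar R} :=
  measure_function_pushforward__canonical__measure_function_Measure
    (mu \x lebesgue_measure)%E (@measurable_rV_rcons R n).

Fixpoint leb (R : realType) (n : nat) : {measure set 'rV[R]_n -> \bar R} :=
  match n with
  | 0 => \d_(0 : 'rV[R]_0)
  | m.+1 => measure_rcons (leb R m)
  end.

Definition box (R : realType) (n : nat) (a b : 'rV[R]_n) : set 'rV[R]_n :=
  [set x | forall i, a 0 i <= x 0 i <= b 0 i].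

Lemma measurable_box (R : realType) (n : nat) (a b : 'rV[R]_n) :
  measurable (box a b).
Proof.
have -> : box a b =
    \big[setI/setT]_(i < n) (@rV_coord R n i @^-1` `[a 0 i, b 0 i]).
  apply/seteqP; split=> x.
    move=> abx; rewrite -bigcap_seq/= => i _.
    by rewrite /= in_itv/=; exact: abx.
  rewrite -bigcap_seq/= => abx i.
  by have := abx i (mem_index_enum i); rewrite /= in_itv.
apply: bigsetI_measurable => i _; rewrite -[X in measurable X]setTI.
exact: measurable_rV_coord.
Qed.

Definition lebS (R : realType) (n : nat) (a b : 'rV[R]_n) :
    {measure set 'rV[R]_n -> \bar R} :=
  mrestr (leb R n) (measurable_box a b).

Definition Linfty (R : realType) (n : nat) (a b : 'rV[R]_n)
    (phi : 'rV[R]_n -> R) : Prop :=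
  measurable_fun (box a b) phi /\
  ('N[lebS a b]_+oo[EFin \o phi] < +oo)%E.

Definition pdensity (R : realType) (n : nat) (a b : 'rV[R]_n)
    (f : 'rV[R]_n -> R) : Prop :=
  [/\ (leb R n).-integrable (box a b) (EFin \o f),
      {ae leb R n, forall x, box a b x -> 0 <= f x}
    & (\int[leb R n]_(x in box a b) (f x)%:E = 1)%E].

Definition expect (R : realType) (n : nat) (a b : 'rV[R]_n)
    (f phi : 'rV[R]_n -> R) : \bar R :=
  (\int[leb R n]_(x in box a b) (phi x * f x)%:E)%E.

(* Coordinates indexed by I : the tuple omega_I is a row vector of length #|I|,
   its k-th entry being the coordinate of index enum_val k. *)

Definition coords (R : realType) (d : nat) (I : {set 'I_d}) (x : 'rV[R]_d) :
    'rV[R]_#|I| :=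
  \row_k x 0 (enum_val k).

Definition embed (R : realType) (d : nat) (I : {set 'I_d}) (t : 'rV[R]_#|I|) :
    'rV[R]_d :=
  \sum_(k < #|I|) t 0 k *: delta_mx 0 (enum_val k).

(* The point omega with omega_{-I} = s and omega_I = t. *)
Definition glue_coords (R : realType) (d : nat) (I : {set 'I_d})
    (s : 'rV[R]_#|(~: I)%SET|) (t : 'rV[R]_#|I|) : 'rV[R]_d :=
  embed s + embed t.

Definition upd (R : realType) (d : nat) (x : 'rV[R]_d) (i : 'I_d) (t : R) :
    'rV[R]_d :=
  \row_j (if j == i then t else x 0 j).

Definition avg (R : realType) (d : nat) (a b : 'rV[R]_d) (i : 'I_d)
    (phi : 'rV[R]_d -> R) : 'rV[R]_d -> R :=
  fun x => (b 0 i - a 0 i)^-1 *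
    \int[lebesgue_measure]_(t in `[a 0 i, b 0 i]) phi (upd x i t).

Definition calP (R : realType) (d : nat) (a b : 'rV[R]_d) (I : {set 'I_d})
    (phi : 'rV[R]_d -> R) : 'rV[R]_d -> R :=
  foldr (fun i g => g \- avg a b i g) phi (enum I).

Definition calR (R : realType) (d : nat) (a b : 'rV[R]_d) (I : {set 'I_d})
    (phi : 'rV[R]_d -> R) : 'rV[R]_d -> R :=
  phi \- calP a b I phi.

Definition centered (R : realType) (d : nat) (a b : 'rV[R]_d) (I : {set 'I_d})
    (phi : 'rV[R]_d -> R) : Prop :=
  forall i, i \in I -> ae_eq (leb R d) (box a b) (avg a b i phi) (cst 0).

Definition Lambda_sl (R : realType) (d : nat) (a b : 'rV[R]_d) (I : {set 'I_d})
    (phi : 'rV[R]_d -> R) : \bar R :=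
  \big[maxe/-oo%E]_(i in I)
    ess_sup (lebS (coords (~: [set i])%SET a) (coords (~: [set i])%SET b))
      (fun s => \int[lebesgue_measure]_(t in `[a 0%R i, b 0%R i])
                  `|phi (upd (embed s) i t)|%:E)%E.

Definition Lambda_mix (R : realType) (d : nat) (a b : 'rV[R]_d)
    (I : {set 'I_d}) (phi : 'rV[R]_d -> R) : \bar R :=
  ess_sup (lebS (coords (~: I)%SET a) (coords (~: I)%SET b))
    (fun s => \int[leb R #|I|]_(t in box (coords I a) (coords I b))
                `|phi (glue_coords s t)|%:E)%E.

Definition partial (R : realType) (d : nat) (i : 'I_d) (f : 'rV[R]_d -> R) :
    'rV[R]_d -> R :=
  fun x => 'D_(delta_mx 0 i) f x.

Definition partials (R : realType) (d : nat) (s : seq 'I_d)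
    (f : 'rV[R]_d -> R) : 'rV[R]_d -> R :=
  foldr (@partial R d) f s.

(* C^k up to the boundary: f is continuous on S and, when k > 0, its first
   partial derivatives exist in the interior of S and extend to S as functions
   that are C^(k-1) up to the boundary. *)
Fixpoint Ck (R : realType) (d : nat) (a b : 'rV[R]_d) (k : nat)
    (f : 'rV[R]_d -> R) : Prop :=
  {within box a b, continuous f} /\
  match k with
  | 0 => True
  | m.+1 => forall i : 'I_d, exists g : 'rV[R]_d -> R, Ck a b m g /\
      forall x, (box a b)° x -> is_derive x (delta_mx 0 i) f (g x)
  end.

Definition test_function (R : realType) (d : nat) (U : set 'rV[R]_d)
    (psi : 'rV[R]_d -> R) : Prop :=
  [/\ forall s : seq 'I_d, continuous (partials s psi),
      forall (s : seq 'I_d) (i : 'I_d) x,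
        derivable (partials s psi) x (delta_mx 0 i),
      compact (closure [set x | psi x != 0])
    & closure [set x | psi x != 0] `<=` U].

(* A finite signed measure is a charge; its total variation measure and the
   integrals against it are taken through a Hahn decomposition (the result
   does not depend on which one). *)

Lemma hahn_exists (dT : measure_display) (T : measurableType dT)
    (R : realType) (nu : {charge set T -> \bar R}) :
  exists PN : set T * set T, hahn_decomposition nu PN.1 PN.2.
Proof. by have [P [N PN]] := Hahn_decomposition nu; exists (P, N). Qed.

Definition hahn (dT : measure_display) (T : measurableType dT)
    (R : realType) (nu : {charge set T -> \bar R}) :=
  projT2 (cid (hahn_exists nu)).

Definition charge_tv (dT : measure_display) (T : measurableType dT)
    (R : realType) (nu : {charge set T -> \bar R}) : set T -> \bar R :=
  charge_variation (hahn nu).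

Definition charge_integral (dT : measure_display) (T : measurableType dT)
    (R : realType) (nu : {charge set T -> \bar R}) (D : set T)
    (g : T -> \bar R) : \bar R :=
  (\int[jordan_pos (hahn nu)]_(x in D) g x
   - \int[jordan_neg (hahn nu)]_(x in D) g x)%E.

(* nu is the i-th distributional derivative of f on the interior of S. *)
Definition is_Dmeasure (R : realType) (d : nat) (a b : 'rV[R]_d)
    (f : 'rV[R]_d -> R) (i : 'I_d) (nu : {charge set 'rV[R]_d -> \bar R}) :
    Prop :=
  forall psi, test_function (box a b)° psi ->
    (\int[leb R d]_(x in (box a b)°) (f x * partial i psi x)%:E
     = - charge_integral nu (box a b)° (EFin \o psi))%E.

Definition BV (R : realType) (d : nat) (a b : 'rV[R]_d) (f : 'rV[R]_d -> R) :
    Prop :=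
  (leb R d).-integrable (box a b) (EFin \o f) /\
  forall i, exists nu, is_Dmeasure a b f i nu.

(* D_i f, defined as 0 when f has no i-th derivative measure; two derivative
   measures agree on the interior of S, where alone D_i f is evaluated. *)
Definition Dmeasure (R : realType) (d : nat) (a b : 'rV[R]_d)
    (f : 'rV[R]_d -> R) (i : 'I_d) : {charge set 'rV[R]_d -> \bar R} :=
  if pselect (exists nu, is_Dmeasure a b f i nu) is left e
  then projT1 (cid e) else czero.

Definition TV (R : realType) (d : nat) (a b : 'rV[R]_d) (I : {set 'I_d})
    (f : 'rV[R]_d -> R) : \bar R :=
  (\sum_(i in I) charge_tv (Dmeasure a b f i) (box a b)°)%E.

(* The L^1 norm of the mixed derivative over S, taken on the interior: the
   boundary of S is a null set, and derivatives there would depend on the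
   irrelevant values of f off S. *)
Definition mixed_variation (R : realType) (d : nat) (a b : 'rV[R]_d)
    (I : {set 'I_d}) (f : 'rV[R]_d -> R) : \bar R :=
  (\int[leb R d]_(x in (box a b)°) `|partials (enum I) f x|%:E)%E.

Definition increment (R : realType) (d : nat) (f : 'rV[R]_d -> R)
    (q : 'rV[R]_d * 'rV[R]_d) : R :=
  \sum_(v : {ffun 'I_d -> bool})
    (-1) ^+ (\sum_i v i)%N *
    f (\row_i (q.2 0 i + (v i)%:R * (q.1 0 i - q.2 0 i))).

Definition box_partition (R : realType) (d : nat) (a b : 'rV[R]_d) (m : nat)
    (q : 'I_m -> 'rV[R]_d * 'rV[R]_d) : Prop :=
  [/\ forall j i, (q j).1 0 i < (q j).2 0 i,
      trivIset setT (fun j => (box (q j).1 (q j).2)°)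
    & \bigcup_j box (q j).1 (q j).2 = box a b].

Definition vitali (R : realType) (d : nat) (a b : 'rV[R]_d)
    (f : 'rV[R]_d -> R) : \bar R :=
  ereal_sup [set v | exists (m : nat) (q : 'I_m -> 'rV[R]_d * 'rV[R]_d),
    box_partition a b q /\ v = (\sum_j `|increment f (q j)|)%:E].

(* Main.v *)
Require Import Defs.
From HB Require Import structures.
From mathcomp Require Import all_boot all_order all_algebra.
From mathcomp Require Import all_classical all_reals all_analysis.
From mathcomp Require Import measurable_realfun ess_sup_inf.
From mathcomp Require Import ring lra.
Set Implicit Arguments.
Unset Strict Implicit.
Unset Printing Implicit Defensive.

Import Order.TTheory GRing.Theory Num.Theory.
Import numFieldNormedType.Exports.

Local Open Scope classical_set_scope.
Local Open Scope ring_scope.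

(** Up to a null set, phi is bounded and measurable on the whole space. Then
    g = P_I phi has zero average along every line in a direction i of I, and
    the remainder R_I phi contributes at most its essential supremum, because
    f is a probability density ([expect_le_centered]). Everything reduces to
    the integral of f g for a function g that is centered at every point.

    Such a g is orthogonal to every function that ignores a coordinate of I
    ([box_Rint_centered]). So f may be corrected, for each i in I in turn, by
    subtracting the mean of its values on the two faces orthogonal to the
    i-th axis. For f of class C^k, the fundamental theorem of calculus in
    each direction bounds the corrected f at x by 2^-k times the integral of
    |d_I f| over the slice through x in the directions of I. This bound does
    not depend on x_I, and Tonelli's theorem lets the integral of |g| over
    the slice be estimated by the mixed envelope ([centered_mixed_bound]).
    For I = [d], the corrected f at x is 2^-d times a signed sum of the
    increments of f over the 2^d cells of the box cut at x, hence at most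
    2^-d times the Vitali variation ([centered_vitali_bound]).

    When f is only of bounded variation, integration by parts replaces g by
    an antiderivative and f by D_i f. The antiderivative G of g in the direction i vanishes at both ends of
    each line since g is centered, and it is at most half of the integral of
    |g| over the line, because G(x) is the integral of g with the weight
    1_(t <= x_i) - 1/2 ([antideriv_centered]). So the integral of f g, which
    is minus that of G against D_i f, is at most half of the slice envelope
    times |D_i f|(S) ([centered_slice_bound]), and the average over i in I
    is the claim ([centered_TV_bound]).

    Here G is not a test function: it is not smooth in the other coordinates.
    The formula of integration by parts is therefore established for all
    pairs made of the deviation of a bounded measurable function h from its
    average in direction i and of the antiderivative of that deviation. Both
    depend linearly on h and are compatible with bounded pointwise limits, so
    by the functional monotone class theorem the indicators of lower
    orthants suffice ([weak_pair_ops]). For these, the antiderivative is a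
    product of indicators and of a tent function of x_i, the limit of smooth
    products of compact support ([weak_pair_orthant]). *)

(** * Lebesgue measure on rectangles and the splitting of coordinates *)

Definition rect (R : realType) (n : nat) (A : 'I_n -> set R) : set 'rV[R]_n :=
  [set x | forall i, A i (x 0 i)].

Lemma measurable_rect (R : realType) (n : nat) (A : 'I_n -> set R) :
  (forall i, measurable (A i)) -> measurable (rect A).
Proof.
move=> mA; have -> : rect A =
    \big[setI/setT]_(i < n) (@rV_coord R n i @^-1` A i).
  apply/seteqP; split=> x.
    by move=> Ax; rewrite -bigcap_seq/= => i _; exact: Ax.
  rewrite -bigcap_seq/= => Ax i.
  exact: (Ax i (mem_index_enum i)).
apply: bigsetI_measurable => i _; rewrite -[X in measurable X]setTI.
exact: measurable_rV_coord.
Qed.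

Lemma measurable_coord (R : realType) (n : nat) (i : 'I_n) :
  measurable_fun [set: 'rV[R]_n] (fun x => x 0 i).
Proof. exact: (@measurable_rV_coord R n i). Qed.

Lemma leb_rect (R : realType) (n : nat) (A : 'I_n -> set R) :
  (forall i, measurable (A i)) ->
  (leb R n (rect A) = \prod_i lebesgue_measure (A i))%E.
Proof.
elim: n A => [|n IH] A mA.
  rewrite big_ord0 /= diracE mem_set// => i; by case: i.
rewrite big_ord_recr/= /pushforward.
have -> : @rV_rcons R n @^-1` rect A =
    rect (fun i => A (lift ord_max i)) `*` A ord_max.
  apply/seteqP; split=> -[x t]/=.
    move=> H; split.
      by move=> i /=; have := H (lift ord_max i); rewrite mxE liftK.
    by have := H ord_max; rewrite mxE unlift_none.
  move=> [H1 H2] i; rewrite mxE; case: unliftP => [j ->|->]; last exact: H2.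
  exact: H1.
rewrite [LHS]product_measure1E; [|by apply: measurable_rect => i; exact: mA|exact: mA].
rewrite IH//; congr (_ * _)%E.
by apply: eq_bigr => i _; congr (lebesgue_measure (A _)); apply/val_inj; rewrite /= /bump leqNgt ltn_ord.
Qed.

(** Together with the stability of rectangles under intersection, this makes the
    values on rectangles determine a measure. *)
Lemma measurable_rV_rectE (R : realType) (n : nat) :
  @measurable _ 'rV[R]_n =
  <<s [set rect A | A in [set A : 'I_n -> set R | forall i, measurable (A i)]] >>.
Proof.
apply/seteqP; split.
- apply: smallest_sub; first exact: smallest_sigma_algebra.
  move=> B; rewrite -bigcup_seq => -[i _ [C mC <-]].
  apply: sub_sigma_algebra => /=.
  exists (fun j => if j == i then C else setT).
    by move=> j; case: ifP.
  rewrite setTI; apply/seteqP; split=> x /=.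
    by move=> /(_ i); rewrite eqxx.
  by move=> Cx j; case: eqP => // ->.
- apply: smallest_sub; first exact: sigma_algebra_measurable.
  by move=> _ [A mA <-]; exact: measurable_rect.
Qed.

Definition cube (R : realType) (n k : nat) : set 'rV[R]_n :=
  rect (fun _ => `[(- k%:R), k%:R]%classic).

Lemma bigcup_cube (R : realType) (n : nat) :
  \bigcup_k @cube R n k = setT.
Proof.
apply/seteqP; split=> // x _.
have [k Hk] : exists k : nat, forall i, `|x 0 i| <= k%:R.
  exists (\max_i Num.truncn `|x 0%R i|).+1 => i.
  apply: le_trans (ltW (truncnS_gt _)) _.
  by rewrite ler_nat ltnS (leq_bigmax i).
by exists k => // i /=; rewrite in_itv/= -ler_norml.
Qed.

Lemma prode_fin_num (R : realType) (I : finType) (F : I -> \bar R) :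
  (forall i, F i \is a fin_num) -> (\prod_i F i)%E \is a fin_num.
Proof. by move=> h; apply: (big_ind (fun x => x \is a fin_num)) => // x y ? ?; rewrite fin_numM. Qed.

Lemma leb_cube_lty (R : realType) (n : nat) (k : nat) :
  (leb R n (@cube R n k) < +oo)%E.
Proof.
rewrite /cube leb_rect; last by move=> i; exact: measurable_itv.
by rewrite -ge0_fin_numE ?prode_ge0//; apply: prode_fin_num => i;
  rewrite lebesgue_measure_itv/=; case: ifP.
Qed.

(** Rectangles form a pi-system that generates the measurable sets, and the
    cubes exhaust the space with finite measure. *)
Lemma leb_unique (R : realType) (n : nat) (mu : {measure set 'rV[R]_n -> \bar R}) :
  (forall A : 'I_n -> set R, (forall i, measurable (A i)) ->
    (mu (rect A) = \prod_i lebesgue_measure (A i))%E) ->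
  forall B, measurable B -> leb R n B = mu B.
Proof.
move=> H B mB.
apply: (measure_unique
  [set rect A | A in [set A : 'I_n -> set R | forall i, measurable (A i)]]
  (@cube R n)) => //.
- exact: measurable_rV_rectE.
- move=> _ _ [A mA <-] [C mC <-]; exists (fun i => A i `&` C i).
    by move=> i; apply: measurableI.
  apply/seteqP; split=> x /=; first by move=> h; split=> i; have [] := h i.
  by move=> [h1 h2] i; split; [exact: h1|exact: h2].
- by move=> i; exists (fun _ => `[(- i%:R), i%:R]%classic) => // j; exact: measurable_itv.
- exact: bigcup_cube.
- by move=> _ [A mA <-]; rewrite H// leb_rect.
- by move=> k; exact: leb_cube_lty.
Qed.

Lemma leb_sigma_finite (R : realType) (n : nat) : sigma_finite setT (leb R n).
Proof.
exists (@cube R n); first by rewrite bigcup_cube.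
move=> k; split; last exact: leb_cube_lty.
by apply: measurable_rect => i; exact: measurable_itv.
Qed.

(** Lebesgue measure again, as the carrier of the sigma-finite structure that
    the Tonelli theorem asks for. *)
Definition lebsf (R : realType) (n : nat) : set 'rV[R]_n -> \bar R := leb R n.

HB.instance Definition _ (R : realType) (n : nat) :=
  Measure.copy (@lebsf R n) (leb R n).
HB.instance Definition _ (R : realType) (n : nat) :=
  Measure_isSigmaFinite.Build _ _ _ (@lebsf R n) (leb_sigma_finite R n).

Section split.
Variables (R : realType) (m n : nat) (dT : measure_display)
  (T : measurableType dT) (mu : {sigma_finite_measure set T -> \bar R}).
Variable e : 'rV[R]_m * T -> 'rV[R]_n.
Hypothesis me : measurable_fun [set: 'rV[R]_m * T] e.
Hypothesis erect : forall A : 'I_n -> set R, (forall i, measurable (A i)) ->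
  ((leb R m \x mu) (e @^-1` rect A) = \prod_i lebesgue_measure (A i))%E.

(** Any way [e] of assembling a point of R^n from a point of R^m and another
    parameter that has the right measure on rectangles transports a product
    measure to Lebesgue measure, so that Tonelli's theorem applies. Both the
    splitting into two blocks of coordinates and the isolation of one coordinate
    are of this kind. *)
Lemma leb_splitE (F : 'rV[R]_n -> \bar R) : measurable_fun [set: 'rV[R]_n] F ->
  (forall x, 0 <= F x)%E ->
  (\int[leb R n]_x F x = \int[leb R m]_s \int[mu]_t F (e (s, t)))%E.
Proof.
move=> mF F0.
pose mu' := measure_function_pushforward__canonical__measure_function_Measure
    (leb R m \x mu)%E me.
have E : forall B, measurable B -> leb R n B = mu' B by exact: leb_unique.
transitivity (\int[mu']_x F x)%E.
  by apply: eq_measure_integral => B mB _; exact: E.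
rewrite ge0_integral_pushforward// preimage_setT.
have := @fubini_tonelli1 _ _ _ _ R (@lebsf R m) mu (F \o e).
apply; first exact: measurableT_comp.
by move=> x; exact: F0.
Qed.

End split.

Lemma embedE (R : realType) (d : nat) (I : {set 'I_d}) (t : 'rV[R]_#|I|) k :
  embed t 0 (enum_val k) = t 0 k.
Proof.
rewrite /embed summxE (bigD1 k)//= !mxE !eqxx mulr1 big1 ?addr0// => j jk.
by rewrite !mxE !eqxx/= (inj_eq enum_val_inj) eq_sym (negbTE jk) mulr0.
Qed.

Lemma embed_notin (R : realType) (d : nat) (I : {set 'I_d}) (t : 'rV[R]_#|I|) j :
  j \notin I -> embed t 0 j = 0.
Proof.
move=> jI; rewrite /embed summxE big1// => k _; rewrite !mxE eqxx/=.
case: eqP => [E|_]; last by rewrite mulr0.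
by move: jI; rewrite E enum_valP.
Qed.

Lemma embed_cases (R : realType) (d : nat) (I : {set 'I_d}) (t : 'rV[R]_#|I|) j :
  embed t 0 j = if [pick k | enum_val k == j] is Some k then t 0 k else 0.
Proof.
case: pickP => [k /eqP <-|h]; first by rewrite embedE.
apply/embed_notin/negP => jI.
by have := h (enum_rank_in jI j); rewrite enum_rankK_in// eqxx.
Qed.

Lemma measurable_embed (R : realType) (d : nat) (I : {set 'I_d}) :
  measurable_fun [set: 'rV[R]_#|I|] (@embed R d I).
Proof.
apply: measurable_fun_rV => j.
under eq_fun do rewrite embed_cases.
case: pickP => [k _|_]; last exact: measurable_cst.
exact: measurable_coord.
Qed.

Lemma measurable_upd2 (R : realType) (d : nat) (i : 'I_d) :
  measurable_fun [set: 'rV[R]_d * R] (fun p => upd p.1 i p.2).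
Proof.
apply: measurable_fun_rV => j; under eq_fun do rewrite mxE.
case: (j == i); first exact: measurable_snd.
exact: (measurableT_comp (measurable_coord j) measurable_fst).
Qed.

Lemma measurable_upd (R : realType) (d : nat) (x : 'rV[R]_d) (i : 'I_d) :
  measurable_fun [set: R] (upd x i).
Proof.
apply: measurable_fun_rV => j; under eq_fun do rewrite mxE.
by case: (j == i); [exact: measurable_id|exact: measurable_cst].
Qed.

Lemma measurable_glue (R : realType) (d : nat) (I : {set 'I_d}) :
  measurable_fun [set: 'rV[R]_#|(~: I)%SET| * 'rV[R]_#|I|] (fun p => @glue_coords R d I p.1 p.2).
Proof.
apply: measurable_fun_rV => j; rewrite /glue_coords.
under eq_fun do rewrite mxE.
apply: measurable_funD.
  apply: (measurableT_comp (measurable_coord j)).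
  exact: (measurableT_comp (@measurable_embed R d _)  measurable_fst).
apply: (measurableT_comp (measurable_coord j)).
exact: (measurableT_comp (@measurable_embed R d _) measurable_snd).
Qed.

Lemma glueE_in (R : realType) (d : nat) (I : {set 'I_d}) s t k :
  @glue_coords R d I s t 0 (enum_val k) = t 0 k.
Proof.
rewrite mxE embedE embed_notin ?add0r// inE negbK; exact: enum_valP.
Qed.

Lemma glueE_notin (R : realType) (d : nat) (I : {set 'I_d}) s t k :
  @glue_coords R d I s t 0 (enum_val k) = s 0 k.
Proof.
rewrite mxE embedE embed_notin ?addr0//.
by have := enum_valP k; rewrite inE.
Qed.

Lemma prode_setC (R : realType) (d : nat) (I : {set 'I_d}) (F : 'I_d -> \bar R) :
  ((\prod_(k < #|(~: I)%SET|) F (enum_val k)) * (\prod_(k < #|I|) F (enum_val k))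
   = \prod_i F i)%E.
Proof.
rewrite -!(big_enum_val F) [RHS](bigID (fun i => i \in I))/= muleC; congr (_ * _)%E.
by apply: eq_bigl => i; rewrite inE.
Qed.

Lemma int_glue (R : realType) (d : nat) (I : {set 'I_d}) (F : 'rV[R]_d -> \bar R) :
  measurable_fun [set: 'rV[R]_d] F -> (forall x, 0 <= F x)%E ->
  (\int[leb R d]_x F x =
   \int[leb R #|(~: I)%SET|]_s \int[leb R #|I|]_t F (glue_coords s t))%E.
Proof.
move=> mF F0.
apply: (@leb_splitE R _ d _ _ (@lebsf R #|I|) (fun p => @glue_coords R d I p.1 p.2)) => //.
  exact: measurable_glue.
move=> A mA.
have -> : (fun p => @glue_coords R d I p.1 p.2) @^-1` rect A =
  rect (fun k => A (enum_val k)) `*` rect (fun k => A (enum_val k)).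
  apply/seteqP; split=> -[s t]/=.
    move=> h; split=> k; first by have := h (enum_val k); rewrite glueE_notin.
    by have := h (enum_val k); rewrite glueE_in.
  move=> [h1 h2] i; case: (boolP (i \in I)) => iI.
    have := h2 (enum_rank_in iI i); rewrite /= enum_rankK_in// => h.
    by rewrite -[i in X in A i X](enum_rankK_in iI iI) glueE_in.
  have iC : i \in (~: I)%SET by rewrite inE.
  have := h1 (enum_rank_in iC i); rewrite /= enum_rankK_in// => h.
  by rewrite -[i in X in A i X](enum_rankK_in iC iC) glueE_notin.
rewrite product_measure1E; [|by apply: measurable_rect..].
rewrite [X in (_ * X)%E](_ : _ = leb R #|I| (rect (fun k => A (enum_val k))))//.
by rewrite !leb_rect//; exact: (prode_setC I (fun i => lebesgue_measure (A i))).
Qed.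

Lemma int_upd (R : realType) (d : nat) (i : 'I_d) (F : 'rV[R]_d -> \bar R) :
  measurable_fun [set: 'rV[R]_d] F -> (forall x, 0 <= F x)%E ->
  (\int[leb R d]_x F x =
   \int[leb R #|(~: [set i])%SET|]_s \int[lebesgue_measure]_t F (upd (embed s) i t))%E.
Proof.
move=> mF F0.
apply: (@leb_splitE R _ d _ _ lebesgue_measure (fun p => upd (embed p.1) i p.2)) => //.
  have mp : measurable_fun [set: 'rV[R]_#|(~: [set i])%SET| * R]
      (fun p => (@embed R d _ p.1, p.2)).
    apply/measurable_fun_pair => /=; last exact: measurable_snd.
    exact: (measurableT_comp (@measurable_embed R d _) measurable_fst).
  exact: (measurableT_comp (@measurable_upd2 R d i) mp).
move=> A mA.
have -> : (fun p : 'rV[R]_#|(~: [set i])%SET| * R => upd (embed p.1) i p.2) @^-1` rect A =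
  rect (fun k => A (enum_val k)) `*` A i.
  apply/seteqP; split=> -[s t]/=.
    move=> h; split => [k|]; last by have := h i; rewrite mxE eqxx.
    have := h (enum_val k); rewrite mxE embedE.
    by have := enum_valP k; rewrite !inE => /negbTE ->.
  move=> [h1 h2] j; rewrite mxE; case: eqP => [->//|/eqP ji].
  have jC : j \in (~: [set i])%SET by rewrite !inE.
  have := h1 (enum_rank_in jC j); rewrite /= enum_rankK_in// => h.
  by rewrite -[j in X in A j X](enum_rankK_in jC jC) embedE.
rewrite product_measure1E; [|by apply: measurable_rect|exact: mA].
rewrite leb_rect// -(prode_setC [set i]%SET (fun i => lebesgue_measure (A i))); congr (_ * _)%E.
by rewrite -(big_enum_val (fun i => lebesgue_measure (A i))) big_set1.
Qed.

(** * Bounded measurable functions and integrals along a side *)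

Section tonelli_on.
Context d1 d2 (T1 : measurableType d1) (T2 : measurableType d2) (R : realType).
Variables (m1 : {sigma_finite_measure set T1 -> \bar R})
  (m2 : {sigma_finite_measure set T2 -> \bar R}).
Variables (A : set T1) (B : set T2) (mA : measurable A) (mB : measurable B).
Variable f : T1 * T2 -> \bar R.
Hypothesis mf : measurable_fun [set: T1 * T2] f.
Hypothesis f0 : forall z, (0 <= f z)%E.

Lemma measurable_int_section :
  measurable_fun [set: T1] (fun x => \int[m2]_(y in B) f (x, y))%E.
Proof.
have -> : (fun x => \int[m2]_(y in B) f (x, y))%E =
    (fun x => \int[m2]_y (f \_ (setT `*` B)) (x, y))%E.
  apply/funext => x; rewrite integral_mkcond; apply: eq_integral => y _.
  by rewrite /patch in_setX in_setT.
apply: measurable_fun_fubini_tonelli_F.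
  by apply/(measurable_restrictT _ _).1; [exact: measurableX|exact: measurable_funTS].
by move=> z; rewrite patchE; case: ifP.
Qed.

Lemma tonelli_on :
  (\int[m1]_(x in A) \int[m2]_(y in B) f (x, y) =
   \int[m2]_(y in B) \int[m1]_(x in A) f (x, y))%E.
Proof.
pose g := f \_ (A `*` B).
have mg : measurable_fun [set: T1 * T2] g.
  by apply/(measurable_restrictT _ _).1; [exact: measurableX|exact: measurable_funTS].
have g0 z : (0 <= g z)%E by rewrite /g patchE; case: ifP.
transitivity (\int[m1]_x \int[m2]_y g (x, y))%E.
  rewrite integral_mkcond; apply: eq_integral => x _; rewrite patchE.
  case: ifPn => xA.
    rewrite integral_mkcond; apply: eq_integral => y _.
    by rewrite /g !patchE in_setX xA.
  by rewrite integral0_eq// => y _; rewrite /g patchE in_setX (negbTE xA).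
rewrite fubini_tonelli//.
rewrite [RHS]integral_mkcond; apply: eq_integral => y _; rewrite patchE.
case: ifPn => yB.
  rewrite [RHS]integral_mkcond; apply: eq_integral => x _.
  by rewrite /g !patchE in_setX yB andbT.
by rewrite integral0_eq// => x _; rewrite /g patchE in_setX (negbTE yB) andbF.
Qed.

End tonelli_on.

Lemma measurable_Rint_section (d1 d2 : measure_display) (T1 : measurableType d1)
    (T2 : measurableType d2) (R : realType) (m2 : {sigma_finite_measure set T2 -> \bar R})
    (B : set T2) (g : T1 * T2 -> R) :
  measurable B -> measurable_fun [set: T1 * T2] g ->
  measurable_fun [set: T1] (fun x => \int[m2]_(y in B) g (x, y)).
Proof.
move=> mB /measurable_EFinP mg.
apply: (measurableT_comp (@fine_measurable R setT measurableT)).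
under eq_fun do rewrite integralE.
apply: emeasurable_funB.
- have H := measurable_int_section m2 mB (measurable_funepos mg) (funepos_ge0 _).
  by apply: (eq_rect _ (measurable_fun setT) H); apply/funext => x;
    apply: eq_integral => y _; rewrite !funeposE.
- have H := measurable_int_section m2 mB (measurable_funeneg mg) (funeneg_ge0 _).
  by apply: (eq_rect _ (measurable_fun setT) H); apply/funext => x;
    apply: eq_integral => y _; rewrite !funenegE.
Qed.

(** Boundedness and measurability hold on the whole space, rather than almost
    everywhere on the box, so that averages along lines commute, and those of
    centered functions vanish, at every point: no exceptional set has to be
    carried along. *)
Definition bmeas (R : realType) (dT : measure_display) (T : measurableType dT)
    (g : T -> R) : Prop :=
  measurable_fun [set: T] g /\ exists M, forall x, `|g x| <= M.

Section bmeas.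
Context (R : realType) (dT : measure_display) (T : measurableType dT).
Implicit Types g h : T -> R.

Lemma bmeas_cst (c : R) : bmeas (fun _ : T => c).
Proof. by split; [exact: measurable_cst|exists `|c|]. Qed.

Lemma bmeasD g h : bmeas g -> bmeas h -> bmeas (fun x => g x + h x).
Proof.
move=> [mg [M gM]] [mh [N hN]]; split; first exact: measurable_funD.
by exists (M + N) => x; rewrite (le_trans (ler_normD _ _))// lerD.
Qed.

Lemma bmeasB g h : bmeas g -> bmeas h -> bmeas (fun x => g x - h x).
Proof.
move=> [mg [M gM]] [mh [N hN]]; split; first exact: measurable_funB.
by exists (M + N) => x; rewrite (le_trans (ler_normB _ _))// lerD.
Qed.

Lemma bmeasM g h : bmeas g -> bmeas h -> bmeas (fun x => g x * h x).
Proof.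
move=> [mg [M gM]] [mh [N hN]]; split; first exact: measurable_funM.
by exists (M * N) => x; rewrite normrM ler_pM.
Qed.

Lemma bmeas_abs g : bmeas g -> bmeas (fun x => `|g x|).
Proof.
move=> [mg [M gM]]; split; last by exists M => x; rewrite normr_id.
exact: measurableT_comp.
Qed.

Lemma bmeas_indic (A : set T) : measurable A -> bmeas (\1_A : T -> R).
Proof.
move=> mA; split; first exact: measurable_indic.
by exists 1 => x; rewrite indicE; case: (x \in A); rewrite ?normr1 ?normr0.
Qed.

Lemma bmeas_comp (dU : measure_display) (U : measurableType dU) (e : U -> T) g :
  measurable_fun [set: U] e -> bmeas g -> bmeas (fun u => g (e u)).
Proof.
move=> me [mg [M gM]]; split; last by exists M.
exact: (measurableT_comp mg me).
Qed.

Lemma bmeas_integrable (mu : {measure set T -> \bar R}) (D : set T) g :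
  measurable D -> (mu D < +oo)%E -> bmeas g -> mu.-integrable D (EFin \o g).
Proof.
move=> mD Doo [mg [M gM]]; apply: measurable_bounded_integrable => //.
  exact: measurable_funTS.
exists M; split; first exact: num_real.
by move=> N MN x _; rewrite /= (le_trans (gM x))// ltW.
Qed.

Lemma bmeas_mul_integrable (mu : {measure set T -> \bar R}) (D : set T) g h :
  measurable D -> bmeas g -> mu.-integrable D (EFin \o h) ->
  mu.-integrable D (EFin \o (fun x => g x * h x)).
Proof.
move=> mD [mg [M gM]] hi; apply: (integrableMr mD (measurable_funTS mg) _ hi).
exists M; split; first exact: num_real.
by move=> N MN x _; exact: le_trans (gM x) (ltW MN).
Qed.

Lemma bmeas_EFin g : bmeas g -> measurable_fun [set: T] (fun x => (g x)%:E).
Proof. by move=> [mg _]; exact/measurable_EFinP. Qed.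

End bmeas.

Section sections.
Variables (R : realType) (d : nat) (a b : 'rV[R]_d).
Hypothesis ab : forall i, a 0 i < b 0 i.

Definition side i : set R := `[a 0 i, b 0 i]%classic.

Lemma sideE i t : side i t = (a 0 i <= t <= b 0 i) :> Prop.
Proof. by rewrite /side /= in_itv. Qed.

Lemma measurable_side i : measurable (side i).
Proof. exact: measurable_itv. Qed.

Lemma side_gt0 i : 0 < b 0 i - a 0 i. Proof. by rewrite subr_gt0. Qed.

Lemma leb_side i : lebesgue_measure (side i) = (b 0 i - a 0 i)%:E.
Proof. by rewrite /side lebesgue_measure_itv/= lte_fin ab. Qed.

Lemma leb_side_lty i : (lebesgue_measure (side i) < +oo)%E.
Proof. by rewrite leb_side ltry. Qed.

Lemma boxE : box a b = rect side.
Proof. by apply/seteqP; split=> x h i; have := h i; rewrite /side/= in_itv. Qed.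

Lemma upd_upd (x : 'rV[R]_d) i s t : upd (upd x i s) i t = upd x i t.
Proof. by apply/rowP => j; rewrite !mxE; case: ifP => // ->. Qed.

Lemma upd_updC (x : 'rV[R]_d) i j s t : i != j ->
  upd (upd x i s) j t = upd (upd x j t) i s.
Proof.
move=> ij; apply/rowP => k; rewrite !mxE; case: (eqVneq k j) => [->|//].
by rewrite eq_sym (negbTE ij).
Qed.

Lemma upd_id (x : 'rV[R]_d) i : upd x i (x 0 i) = x.
Proof. by apply/rowP => j; rewrite mxE; case: eqP => // ->. Qed.

Lemma upd_box x i t : box a b x -> side i t -> box a b (upd x i t).
Proof.
move=> bx st j; rewrite mxE; case: eqP => [->|_]; last exact: bx.
by move: st; rewrite /side/= in_itv.
Qed.

(** The slice of the box over s is a whole side or empty, which turns integrals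
    over the box into iterated ones. *)
Lemma box_embed_upd i s t :
  (box a b (upd (embed s) i t)) <->
  (box (coords (~: [set i])%SET a) (coords (~: [set i])%SET b) s /\ side i t).
Proof.
split.
- move=> h; split.
    move=> k; have := h (enum_val k); rewrite !mxE embedE.
    by have := enum_valP k; rewrite !inE => /negbTE ->.
  by have := h i; rewrite mxE eqxx /side/= in_itv.
- move=> [h1 h2] j; rewrite mxE; case: eqP => [->|/eqP ji].
    by move: h2; rewrite /side/= in_itv.
  have jC : j \in (~: [set i])%SET by rewrite !inE.
  have := h1 (enum_rank_in jC j); rewrite !mxE !enum_rankK_in// => h.
  by rewrite -[j in embed s 0 j](enum_rankK_in jC jC) embedE.
Qed.

Lemma box_glue (I : {set 'I_d}) s t :
  box a b (glue_coords s t) <->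
  (box (coords (~: I)%SET a) (coords (~: I)%SET b) s /\
   box (coords I a) (coords I b) t).
Proof.
split.
- move=> h; split=> k.
    by have := h (enum_val k); rewrite glueE_notin !mxE.
  by have := h (enum_val k); rewrite glueE_in !mxE.
- move=> [h1 h2] i; case: (boolP (i \in I)) => iI.
    have h := h2 (enum_rank_in iI i); rewrite !mxE !enum_rankK_in// in h.
    by move: h; rewrite -(glueE_in s t) enum_rankK_in.
  have iC : i \in (~: I)%SET by rewrite inE.
  have h := h1 (enum_rank_in iC i); rewrite !mxE !enum_rankK_in// in h.
  by move: h; rewrite -(glueE_notin s t) enum_rankK_in.
Qed.

Lemma int_box_slices (dS dT : measure_display) (T1 : measurableType dS)
    (T2 : measurableType dT) (m1 : {measure set T1 -> \bar R}) (m2 : {measure set T2 -> \bar R})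
    (A : set T1) (B : set T2) (e : T1 -> T2 -> 'rV[R]_d) :
  (forall F : 'rV[R]_d -> \bar R, measurable_fun [set: 'rV[R]_d] F -> (forall x, 0 <= F x)%E ->
    (\int[leb R d]_x F x = \int[m1]_s \int[m2]_t F (e s t))%E) ->
  (forall s t, box a b (e s t) <-> A s /\ B t) ->
  forall F : 'rV[R]_d -> \bar R, measurable_fun [set: 'rV[R]_d] F -> (forall x, 0 <= F x)%E ->
  (\int[leb R d]_(x in box a b) F x = \int[m1]_(s in A) \int[m2]_(t in B) F (e s t))%E.
Proof.
move=> split_leb eAB F mF F0; rewrite [LHS]integral_mkcond.
apply: etrans (split_leb _ _ _) _.
- apply/(measurable_restrictT _ _).1; [exact: measurable_box|exact: measurable_funTS].
- by move=> x; rewrite patchE; case: ifP.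
- rewrite [RHS]integral_mkcond; apply: eq_integral => s _.
  rewrite patchE; case: ifPn => sA.
    rewrite [RHS]integral_mkcond; apply: eq_integral => t _; rewrite !patchE.
    suff -> : (e s t \in box a b) = (t \in B) by [].
    apply/idP/idP; rewrite !inE; first by move=> /eAB[].
    by move=> ?; apply/eAB; split=> //; exact: set_mem.
  rewrite integral0_eq// => t _; rewrite patchE; case: ifPn => //.
  by rewrite inE => /eAB[/mem_set]; rewrite (negbTE sA).
Qed.

Lemma int_box_upd i (F : 'rV[R]_d -> \bar R) :
  measurable_fun [set: 'rV[R]_d] F -> (forall x, 0 <= F x)%E ->
  (\int[leb R d]_(x in box a b) F x =
   \int[leb R #|(~: [set i])%SET|]_(s in
       box (coords (~: [set i])%SET a) (coords (~: [set i])%SET b))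
     \int[lebesgue_measure]_(t in side i) F (upd (embed s) i t))%E.
Proof. exact: (int_box_slices (@int_upd R d i) (@box_embed_upd i)). Qed.

Lemma int_box_glue (I : {set 'I_d}) (F : 'rV[R]_d -> \bar R) :
  measurable_fun [set: 'rV[R]_d] F -> (forall x, 0 <= F x)%E ->
  (\int[leb R d]_(x in box a b) F x =
   \int[leb R #|(~: I)%SET|]_(s in
       box (coords (~: I)%SET a) (coords (~: I)%SET b))
     \int[leb R #|I|]_(t in box (coords I a) (coords I b)) F (glue_coords s t))%E.
Proof. exact: (int_box_slices (@int_glue R d I) (@box_glue I)). Qed.

Lemma leb_box : leb R d (box a b) = (\prod_i (b 0 i - a 0 i))%:E.
Proof.
rewrite boxE leb_rect; last exact: measurable_side.
rewrite (eq_bigr (fun i => (b 0 i - a 0 i)%:E)); last by move=> i _; exact: leb_side.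
by elim/big_rec2: _ => // i x y _ ->; rewrite EFinM.
Qed.

Lemma leb_box_lty : (leb R d (box a b) < +oo)%E.
Proof. by rewrite leb_box ltry. Qed.

Definition side_int i (F : 'rV[R]_d -> \bar R) (x : 'rV[R]_d) : \bar R :=
  (\int[lebesgue_measure]_(t in side i) F (upd x i t))%E.

Lemma side_int_ge0 i F x : (forall x, 0 <= F x)%E -> (0 <= side_int i F x)%E.
Proof. by move=> F0; exact: integral_ge0. Qed.

Lemma measurable_side_int i F : measurable_fun [set: 'rV[R]_d] F ->
  (forall x, 0 <= F x)%E -> measurable_fun [set: 'rV[R]_d] (side_int i F).
Proof.
move=> mF F0.
apply: (@measurable_int_section _ _ _ _ R lebesgue_measure (side i) _
  (fun p => F (upd p.1 i p.2))) => //.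
exact: measurable_side.
exact: (measurableT_comp mF (@measurable_upd2 R d i)).
Qed.

Lemma side_int_upd i F x t : side_int i F (upd x i t) = side_int i F x.
Proof. by apply: eq_integral => s _; rewrite upd_upd. Qed.

Lemma side_intC i j F x : measurable_fun [set: 'rV[R]_d] F ->
  (forall x, 0 <= F x)%E -> side_int i (side_int j F) x = side_int j (side_int i F) x.
Proof.
move=> mF F0; have [->//|ij] := eqVneq i j.
rewrite /side_int.
have mp : measurable_fun [set: R * R] (fun p => (upd x i p.1, p.2)).
  apply/measurable_fun_pair => /=; last exact: measurable_snd.
  exact: (measurableT_comp (measurable_upd x i) measurable_fst).
have mFu := measurableT_comp mF (measurableT_comp (@measurable_upd2 R d j) mp).
apply: etrans (@tonelli_on _ _ _ _ R lebesgue_measure lebesgue_measure (side i) (side j)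
  (measurable_side i) (measurable_side j) (fun p => F (upd (upd x i p.1) j p.2)) mFu _) _.
  by move=> p; exact: F0.
apply: eq_integral => t _; apply: eq_integral => s _ /=.
by rewrite upd_updC.
Qed.

Lemma side_int_indep i F x c : (forall t, F (upd x i t) = c) ->
  side_int i F x = (c * (b 0 i - a 0 i)%:E)%E.
Proof.
move=> Fc; rewrite /side_int (eq_integral (cst c)); last by move=> t _; rewrite Fc.
by rewrite integral_cst; [congr (_ * _)%E; exact: leb_side|exact: measurable_side].
Qed.

(** The inner integral does not depend on the i-th coordinate, which therefore
    integrates to the length of the side. *)
Lemma int_side_int i F : measurable_fun [set: 'rV[R]_d] F ->
  (forall x, 0 <= F x)%E ->
  (\int[leb R d]_(x in box a b) side_int i F x =
   (b 0 i - a 0 i)%:E * \int[leb R d]_(x in box a b) F x)%E.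
Proof.
move=> mF F0; rewrite !(int_box_upd i)//; last 2 first.
  exact: measurable_side_int.
  by move=> x; exact: side_int_ge0.
rewrite -ge0_integralZl//.
- apply: eq_integral => s _.
  transitivity (side_int i (side_int i F) (embed s)); first by [].
  rewrite (@side_int_indep _ _ _ (side_int i F (embed s))); last by move=> t; rewrite side_int_upd.
  by rewrite muleC.
- exact: measurable_box.
- apply: measurable_funTS.
  exact: (measurableT_comp (measurable_side_int i mF F0) (@measurable_embed R d _)).
- by move=> s _; apply: side_int_ge0.
- by rewrite lee_fin ltW// side_gt0.
Qed.

End sections.

(** * Averages along the sides *)

Section avg.
Variables (R : realType) (d : nat) (a b : 'rV[R]_d).
Hypothesis ab : forall i, a 0 i < b 0 i.
Implicit Types (g h : 'rV[R]_d -> R).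
Notation side := (side a b).
Notation side_int := (side_int a b).

Definition side_Rint i g (x : 'rV[R]_d) : R :=
  \int[lebesgue_measure]_(t in side i) g (upd x i t).

Lemma avgE i g x : avg a b i g x = (b 0 i - a 0 i)^-1 * side_Rint i g x.
Proof. by []. Qed.

Lemma measurable_side_Rint i g : measurable_fun [set: 'rV[R]_d] g ->
  measurable_fun [set: 'rV[R]_d] (side_Rint i g).
Proof.
move=> mg; apply: (@measurable_Rint_section _ _ _ _ R lebesgue_measure (side i)
  (fun p => g (upd p.1 i p.2))); first exact: measurable_side.
exact: (measurableT_comp mg (@measurable_upd2 R d i)).
Qed.

Lemma measurable_avg i g : measurable_fun [set: 'rV[R]_d] g ->
  measurable_fun [set: 'rV[R]_d] (avg a b i g).
Proof.
by move=> mg; apply: measurable_funM => //; exact: measurable_side_Rint.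
Qed.

Lemma section_integrable i g x : bmeas g ->
  lebesgue_measure.-integrable (side i) (EFin \o (fun t => g (upd x i t))).
Proof.
move=> bg; apply: bmeas_integrable; first exact: measurable_side.
  exact: leb_side_lty.
by apply: bmeas_comp bg; exact: measurable_upd.
Qed.

Lemma side_int_side_Rint i g x : bmeas g -> side_int i (EFin \o g) x = (side_Rint i g x)%:E.
Proof.
move=> bg; rewrite /side_Rint /Rintegral fineK//.
by apply: integrable_fin_num; [exact: measurable_side|exact: section_integrable].
Qed.

Lemma side_RintD i g h x : bmeas g -> bmeas h ->
  side_Rint i (fun x => g x + h x) x = side_Rint i g x + side_Rint i h x.
Proof.
by move=> bg bh; rewrite /side_Rint RintegralD//;
  [exact: measurable_side|exact: section_integrable..].
Qed.

Lemma side_RintB i g h x : bmeas g -> bmeas h ->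
  side_Rint i (fun x => g x - h x) x = side_Rint i g x - side_Rint i h x.
Proof.
by move=> bg bh; rewrite /side_Rint RintegralB//;
  [exact: measurable_side|exact: section_integrable..].
Qed.

Lemma side_RintM i g h x : bmeas g -> (forall t, h (upd x i t) = h x) ->
  side_Rint i (fun x => h x * g x) x = h x * side_Rint i g x.
Proof.
move=> bg hx; rewrite /side_Rint -RintegralZl;
  [|exact: measurable_side|exact: section_integrable].
by apply: eq_Rintegral => t _; rewrite hx.
Qed.

Lemma side_Rint_indep i h x : (forall t, h (upd x i t) = h x) ->
  side_Rint i h x = h x * (b 0 i - a 0 i).
Proof.
move=> hx; rewrite /side_Rint (@eq_Rintegral _ _ _ _ _ (cst (h x)));
  last by move=> t _; rewrite hx.
rewrite Rintegral_cst; last exact: measurable_side.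
by rewrite [X in fine X]leb_side.
Qed.

Lemma side_Rint_upd i g x t : side_Rint i g (upd x i t) = side_Rint i g x.
Proof. by apply: eq_Rintegral => s _; rewrite upd_upd. Qed.

Lemma side_integral_bound i (h : R -> R) M :
  lebesgue_measure.-integrable (side i) (EFin \o h) -> (forall t, `|h t| <= M) ->
  `|\int[lebesgue_measure]_(t in side i) h t| <= M * (b 0 i - a 0 i).
Proof.
move=> bh hM; have ms := measurable_side a b i; have fs := leb_side_lty ab i.
have H1 : `|\int[lebesgue_measure]_(t in side i) h t| <=
    \int[lebesgue_measure]_(t in side i) `|h t|.
  apply: le_normr_Rintegral; first exact: ms.
  exact: bh.
have H2 : \int[lebesgue_measure]_(t in side i) `|h t| <=
    \int[lebesgue_measure]_(t in side i) (fun=> M) t.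
  apply: le_Rintegral => //.
    by have := integrable_abse bh; apply: eq_integrable.
  by have := section_integrable i (0 : 'rV[R]_d) (bmeas_cst 'rV[R]_d M).
apply: (le_trans H1); apply: (le_trans H2).
by rewrite Rintegral_cst// [X in fine X](leb_side ab).
Qed.

Lemma side_Rint_bound i g M x : bmeas g -> (forall x, `|g x| <= M) ->
  `|side_Rint i g x| <= M * (b 0 i - a 0 i).
Proof.
by move=> bg gM; apply: side_integral_bound => [|t]; [exact: section_integrable|exact: gM].
Qed.

Lemma bmeas_side_Rint i g : bmeas g -> bmeas (side_Rint i g).
Proof.
move=> bg; have [mg [M gM]] := bg; split; first exact: measurable_side_Rint.
by exists (M * (b 0 i - a 0 i)) => x; exact: side_Rint_bound.
Qed.

Lemma bmeas_avg i g : bmeas g -> bmeas (avg a b i g).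
Proof.
by move=> bg; apply: bmeasM; [exact: bmeas_cst|exact: bmeas_side_Rint].
Qed.

Local Opaque side_Rint.

(** Tonelli's theorem for nonnegative functions, to which a bounded function is
    reduced by adding a constant. *)
Lemma side_RintC i j g x : bmeas g -> side_Rint i (side_Rint j g) x = side_Rint j (side_Rint i g) x.
Proof.
move=> bg.
have pos h : bmeas h -> (forall x, 0 <= h x) ->
    side_Rint i (side_Rint j h) x = side_Rint j (side_Rint i h) x.
  move=> bh h0; apply: EFin_inj.
  have E k : EFin \o side_Rint k h = side_int k (EFin \o h).
    by apply/funext => y; rewrite side_int_side_Rint.
  apply: etrans (esym (side_int_side_Rint i x (bmeas_side_Rint j bh))) _.
  apply: etrans (side_int_side_Rint j x (bmeas_side_Rint i bh)).
  by rewrite (E i) (E j); apply: side_intC => //; exact: bmeas_EFin.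
have [_ [M gM]] := bg.
(* Tonelli's theorem is applied to g + M, which is nonnegative. *)
have bgM : bmeas (fun x => g x + M) by apply: bmeasD => //; exact: bmeas_cst.
have gM0 y : 0 <= g y + M.
  by rewrite -lerBlDr sub0r; have /ler_normlP[] := gM y; rewrite lerNl.
have := pos _ bgM gM0.
have E k : side_Rint k (fun x => g x + M) = fun x => side_Rint k g x + M * (b 0 k - a 0 k).
  apply/funext => y; rewrite side_RintD//; last exact: bmeas_cst.
  by rewrite (@side_Rint_indep k (fun=> M)).
rewrite !E !side_RintD; [|by [exact: bmeas_side_Rint|exact: bmeas_cst]..].
have c k l : side_Rint k (fun=> M * (b 0 l - a 0 l)) x =
    M * (b 0 l - a 0 l) * (b 0 k - a 0 k) by exact: (@side_Rint_indep k (fun=> _) x).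
by rewrite (c i j) (c j i) mulrAC => /addIr.
Qed.

Lemma avgC i j g x : bmeas g -> avg a b i (avg a b j g) x = avg a b j (avg a b i g) x.
Proof.
move=> bg.
have E k l : avg a b k (avg a b l g) x =
    (b 0 k - a 0 k)^-1 * ((b 0 l - a 0 l)^-1 * side_Rint k (side_Rint l g) x).
  rewrite avgE; congr (_ * _).
  exact: (@side_RintM k (side_Rint l g) (fun=> (b 0 l - a 0 l)^-1) x (bmeas_side_Rint l bg)).
by rewrite (E i j) (E j i) (side_RintC i j x bg) mulrCA.
Qed.

Lemma avg_upd i g x t : avg a b i g (upd x i t) = avg a b i g x.
Proof. by rewrite !avgE side_Rint_upd. Qed.

Lemma avg_indep i h x : (forall t, h (upd x i t) = h x) -> avg a b i h x = h x.
Proof.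
move=> hx; rewrite avgE side_Rint_indep// mulrCA mulVf ?mulr1//.
by rewrite gt_eqF// side_gt0.
Qed.

Lemma avg_idem i g x : avg a b i (avg a b i g) x = avg a b i g x.
Proof. by apply: avg_indep => t; exact: avg_upd. Qed.

Lemma avgB i g h x : bmeas g -> bmeas h ->
  avg a b i (fun x => g x - h x) x = avg a b i g x - avg a b i h x.
Proof. by move=> bg bh; rewrite !avgE side_RintB// mulrBr. Qed.

Definition calPs (s : seq 'I_d) g := foldr (fun i g => g \- avg a b i g) g s.

Lemma bmeas_calPs s g : bmeas g -> bmeas (calPs s g).
Proof.
by move=> bg; elim: s => //= i s IH; apply: bmeasB => //; exact: bmeas_avg.
Qed.

Lemma measurable_calPs s g : measurable_fun [set: 'rV[R]_d] g ->
  measurable_fun [set: 'rV[R]_d] (calPs s g).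
Proof.
by move=> mg; elim: s => //= i s IH; apply: measurable_funB => //; exact: measurable_avg.
Qed.

(** Removing the average in direction j keeps the averages in the other
    directions equal to 0, since averages commute, and makes the one in
    direction j vanish, since they are idempotent. *)
Lemma avg_calPs s g i x : bmeas g -> i \in s -> avg a b i (calPs s g) x = 0.
Proof.
move=> bg; elim: s x => //= j s IH x; rewrite inE => ijs.
have bP := bmeas_calPs s bg.
rewrite avgB//; last exact: bmeas_avg.
have [->|ij] := eqVneq i j; first by rewrite avg_idem subrr.
have is_ : i \in s by move: ijs; rewrite (negbTE ij).
rewrite IH// avgC// avg_indep; last by move=> t; rewrite !IH.
by rewrite IH// subrr.
Qed.

Definition box_Rint g : R := \int[leb R d]_(x in box a b) g x.

Lemma bmeas_box_integrable g : bmeas g -> (leb R d).-integrable (box a b) (EFin \o g).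
Proof. by apply: bmeas_integrable; [exact: measurable_box|exact: leb_box_lty]. Qed.

Lemma EFin_box_Rint g : bmeas g -> (box_Rint g)%:E = (\int[leb R d]_(x in box a b) (g x)%:E)%E.
Proof.
move=> bg; rewrite /box_Rint /Rintegral fineK//.
by apply: integrable_fin_num; [exact: measurable_box|exact: bmeas_box_integrable].
Qed.

Lemma box_RintD g h : bmeas g -> bmeas h -> box_Rint (fun x => g x + h x) = box_Rint g + box_Rint h.
Proof.
by move=> bg bh; rewrite /box_Rint RintegralD//;
  [exact: measurable_box|exact: bmeas_box_integrable..].
Qed.

Lemma box_RintB g h : bmeas g -> bmeas h -> box_Rint (fun x => g x - h x) = box_Rint g - box_Rint h.
Proof.
by move=> bg bh; rewrite /box_Rint RintegralB//;
  [exact: measurable_box|exact: bmeas_box_integrable..].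
Qed.

Lemma box_RintZ c g : bmeas g -> box_Rint (fun x => c * g x) = c * box_Rint g.
Proof.
by move=> bg; rewrite /box_Rint RintegralZl//;
  [exact: measurable_box|exact: bmeas_box_integrable..].
Qed.

Lemma box_Rint_avg i g : bmeas g -> box_Rint (avg a b i g) = box_Rint g.
Proof.
move=> bg.
have pos h : bmeas h -> (forall x, 0 <= h x) -> box_Rint (avg a b i h) = box_Rint h.
  move=> bh h0.
  have E : box_Rint (side_Rint i h) = (b 0 i - a 0 i) * box_Rint h.
    apply: EFin_inj; rewrite EFin_box_Rint; last exact: bmeas_side_Rint.
    rewrite EFinM EFin_box_Rint// -int_side_int//; last exact: bmeas_EFin.
    by apply: eq_integral => x _; rewrite side_int_side_Rint.
  rewrite (@box_RintZ _ (side_Rint i h)); last exact: bmeas_side_Rint.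
  by rewrite E mulrA mulVf ?mul1r// gt_eqF// side_gt0.
have [_ [M gM]] := bg.
have bc : bmeas (fun _ : 'rV[R]_d => M) by exact: bmeas_cst.
have bgM : bmeas (fun x => g x + M) by exact: bmeasD.
have gM0 y : 0 <= g y + M.
  by rewrite -lerBlDr sub0r; have /ler_normlP[] := gM y; rewrite lerNl.
have := pos _ bgM gM0.
have -> : avg a b i (fun x => g x + M) = fun x => avg a b i g x + M.
  apply/funext => y; rewrite !avgE side_RintD// mulrDr; congr (_ + _).
  exact: (@avg_indep i (fun=> M)).
rewrite !box_RintD//; last exact: bmeas_avg.
exact: addIr.
Qed.

(** The average in direction i of the product is 0 at every point, because the
    factor h is constant along the lines in that direction. *)
Lemma box_Rint_centered i g h : bmeas g -> bmeas h ->
  (forall x, avg a b i g x = 0) -> (forall x t, h (upd x i t) = h x) ->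
  box_Rint (fun x => g x * h x) = 0.
Proof.
move=> bg bh gi hi; rewrite -(box_Rint_avg i); last exact: bmeasM.
have -> : avg a b i (fun x => g x * h x) = cst 0.
  apply/funext => x; rewrite avgE.
  under [X in side_Rint i X]eq_fun do rewrite mulrC.
  by rewrite side_RintM// mulrCA -avgE gi mulr0.
by rewrite /box_Rint Rintegral_cst ?mul0r//; exact: measurable_box.
Qed.

End avg.

(** * Null sets, slices and essentially bounded functions *)

(** This is how the essential suprema in the envelopes are read as bounds on
    almost every slice of the box. *)
Lemma ae_lebS (R : realType) (d : nat) (a b : 'rV[R]_d) (P : 'rV[R]_d -> Prop) :
  {ae lebS a b, forall x, P x} <-> {ae leb R d, forall x, box a b x -> P x}.
Proof.
split=> -[N [mN N0 subN]].
  exists (N `&` box a b); split => //.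
  - by apply: measurableI => //; exact: measurable_box.
  - move=> x /= /not_implyP[bx nP]; split => //; exact: subN.
exists (N `|` ~` box a b); split.
- apply: measurableU => //; apply: measurableC; exact: measurable_box.
- change (leb R d ((N `|` ~` box a b) `&` box a b) = 0%E).
  rewrite setIUl setICl setU0.
  apply/eqP; rewrite -measure_le0 -N0 le_measure// ?inE//.
  by apply: measurableI => //; exact: measurable_box.
- move=> x /= nP; have [bx|] := pselect (box a b x); last by right.
  by left; apply: subN => /= /(_ bx).
Qed.

(** A null set has null sections, almost everywhere: the integral of the
    measures of the sections is 0. *)
Lemma ae_section (R : realType) (n : nat) (d1 d2 : measure_display)
    (T1 : measurableType d1) (T2 : measurableType d2)
    (m1 : {measure set T1 -> \bar R}) (m2 : {measure set T2 -> \bar R})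
    (A : set T1) (B : set T2) (e : T1 -> T2 -> 'rV[R]_n) (N : set 'rV[R]_n) :
  measurable A -> measurable B -> measurable N ->
  (forall x, measurable_fun [set: T2] (e x)) ->
  measurable_fun [set: T1] (fun x => \int[m2]_(y in B) (\1_N (e x y))%:E)%E ->
  (\int[m1]_(x in A) \int[m2]_(y in B) (\1_N (e x y))%:E = 0)%E ->
  {ae m1, forall x, A x -> {ae m2, forall y, B y -> ~ N (e x y)}}.
Proof.
move=> mA mB mN me mK K0.
have K0' : (\int[m1]_(x in A) `| \int[m2]_(y in B) (\1_N (e x y))%:E | = 0)%E.
  rewrite -[RHS]K0; apply: eq_integral => x _; rewrite gee0_abs//.
  by apply: integral_ge0 => y _; rewrite lee_fin.
have := (@ae_eq_integral_abs _ _ _ m1 A mA _ (measurable_funTS mK)).1 K0'.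
apply: filterS => x /[apply] /= Kx0.
have mN1 : measurable_fun B (fun y => (\1_N (e x y))%:E : \bar R).
  apply: measurable_funTS; apply/measurable_EFinP.
  by apply: (measurableT_comp _ (me x)); exact: measurable_indic.
have Kx0' : (\int[m2]_(y in B) `| (\1_N (e x y))%:E | = 0)%E.
  by rewrite -[RHS]Kx0; apply: eq_integral => y _; rewrite gee0_abs// lee_fin.
have := (@ae_eq_integral_abs _ _ _ m2 B mB _ mN1).1 Kx0'.
apply: filterS => y /[apply] /= [[]] /eqP; rewrite indicE.
by case: (boolP (_ \in _)); rewrite ?oner_eq0// => /negP + _ Ny; rewrite inE.
Qed.

Section ae.
Variables (R : realType) (d : nat) (a b : 'rV[R]_d).
Hypothesis ab : forall i, a 0 i < b 0 i.
Notation side := (side a b).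
Implicit Type P : 'rV[R]_d -> Prop.

Lemma measurable_EFin_indic (N : set 'rV[R]_d) : measurable N ->
  measurable_fun [set: 'rV[R]_d] (fun x => (\1_N x)%:E : \bar R).
Proof. by move=> mN; apply/measurable_EFinP; exact: measurable_indic. Qed.

Lemma int_null (N : set 'rV[R]_d) : measurable N -> leb R d N = 0%E ->
  (\int[leb R d]_(x in box a b) (\1_N x)%:E = 0)%E.
Proof.
move=> mN N0; rewrite integral_indic//; last exact: measurable_box.
apply/eqP; rewrite -measure_le0 -[leRHS]N0 le_measure// ?inE//.
by apply: measurableI => //; exact: measurable_box.
Qed.

Lemma ae_upd i P : {ae leb R d, forall x, box a b x -> P x} ->
  {ae leb R d, forall x, box a b x ->
    {ae lebesgue_measure, forall t, side i t -> P (upd x i t)}}.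
Proof.
move=> [N [mN N0 subN]].
have m1 := measurable_EFin_indic mN.
have p1 x : (0 <= (\1_N x)%:E :> \bar R)%E by rewrite lee_fin.
have := @ae_section R d _ _ _ _ (leb R d) lebesgue_measure (box a b) (side i)
  (fun x t => upd x i t) N (measurable_box a b) (measurable_side a b i) mN
  (fun x => measurable_upd x i).
move=> /(_ (measurable_side_int a b i m1 p1)).
have -> : (\int[leb R d]_(x in box a b) \int[lebesgue_measure]_(y in side i)
    (\1_N (upd x i y))%:E = 0)%E.
  by have := int_side_int ab i m1 p1; rewrite int_null// mule0.
move=> /(_ erefl).
apply: filterS2 (aeW (leb R d) (fun=> I)) => x _ H bx.
apply: filterS (H bx) => t Ht st; apply: contrapT => nP.
by apply: (Ht st); apply: subN => /= /(_ (upd_box bx st)).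
Qed.

Lemma ae_upd_split i P : {ae leb R d, forall x, box a b x -> P x} ->
  {ae leb R #|(~: [set i])%SET|, forall s,
    box (coords (~: [set i])%SET a) (coords (~: [set i])%SET b) s ->
    {ae lebesgue_measure, forall t, side i t -> P (upd (embed s) i t)}}.
Proof.
move=> [N [mN N0 subN]].
have m1 := measurable_EFin_indic mN.
have p1 x : (0 <= (\1_N x)%:E :> \bar R)%E by rewrite lee_fin.
have := @ae_section R d _ _ _ _ (leb R _) lebesgue_measure
  (box (coords (~: [set i])%SET a) (coords (~: [set i])%SET b)) (side i)
  (fun s t => upd (embed s) i t) N (measurable_box _ _) (measurable_side a b i) mN
  (fun x => measurable_upd _ i).
move=> /(_ (measurableT_comp (measurable_side_int a b i m1 p1) (@measurable_embed R d _))).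
rewrite -(int_box_upd a b i m1 p1) int_null// => /(_ erefl).
apply: filterS2 (aeW (leb R _) (fun=> I)) => s _ H bs.
apply: filterS (H bs) => t Ht st; apply: contrapT => nP.
by apply: (Ht st); apply: subN => /= /(_ ((box_embed_upd a b s t).2 (conj bs st))).
Qed.

Lemma measurable_glue_int (J : {set 'I_d}) (F : 'rV[R]_d -> \bar R) :
  measurable_fun [set: 'rV[R]_d] F -> (forall x, 0 <= F x)%E ->
  measurable_fun [set: 'rV[R]_#|(~: J)%SET|] (fun s =>
    \int[leb R #|J|]_(t in box (coords J a) (coords J b)) F (glue_coords s t))%E.
Proof.
move=> mF F0.
apply: (@measurable_int_section _ _ _ _ R (@lebsf R #|J|)
  (box (coords J a) (coords J b)) _ (fun p => F (glue_coords p.1 p.2))) => //.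
  exact: measurable_box.
exact: (measurableT_comp mF (@measurable_glue R d J)).
Qed.

Lemma measurable_glue1 (J : {set 'I_d}) (s : 'rV[R]_#|(~: J)%SET|) :
  measurable_fun [set: 'rV[R]_#|J|] (glue_coords s).
Proof.
exact: (measurableT_comp (@measurable_glue R d J) (measurable_pair1 s)).
Qed.

Lemma ae_glue (J : {set 'I_d}) P : {ae leb R d, forall x, box a b x -> P x} ->
  {ae leb R #|(~: J)%SET|, forall s,
    box (coords (~: J)%SET a) (coords (~: J)%SET b) s ->
    {ae leb R #|J|, forall t, box (coords J a) (coords J b) t -> P (glue_coords s t)}}.
Proof.
move=> [N [mN N0 subN]].
have m1 := measurable_EFin_indic mN.
have p1 x : (0 <= (\1_N x)%:E :> \bar R)%E by rewrite lee_fin.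
have := @ae_section R d _ _ _ _ (leb R _) (leb R #|J|)
  (box (coords (~: J)%SET a) (coords (~: J)%SET b)) (box (coords J a) (coords J b))
  (fun s t => glue_coords s t) N (measurable_box _ _) (measurable_box _ _) mN
  (@measurable_glue1 J).
move=> /(_ (@measurable_glue_int J _ m1 p1)).
rewrite -(int_box_glue a b J m1 p1) int_null// => /(_ erefl).
apply: filterS2 (aeW (leb R _) (fun=> I)) => s _ H bs.
apply: filterS (H bs) => t Ht st; apply: contrapT => nP.
by apply: (Ht st); apply: subN => /= /(_ ((box_glue a b s t).2 (conj bs st))).
Qed.

Lemma ae_eq_avg i g h : measurable_fun [set: 'rV[R]_d] g ->
  measurable_fun [set: 'rV[R]_d] h ->
  ae_eq (leb R d) (box a b) g h ->
  ae_eq (leb R d) (box a b) (avg a b i g) (avg a b i h).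
Proof.
move=> mg mh /(ae_upd i).
apply: filterS2 (aeW (leb R d) (fun=> I)) => x _ H bx.
rewrite /avg; congr (_ * fine _).
have me (k : 'rV[R]_d -> R) : measurable_fun [set: 'rV[R]_d] k ->
    measurable_fun (side i) (fun t => (k (upd x i t))%:E).
  move=> mk; apply: measurable_funTS; apply/measurable_EFinP.
  exact: (measurableT_comp mk (measurable_upd x i)).
apply: ae_eq_integral; [exact: measurable_side|exact: me|exact: me|].
have [N [mN N0 subN]] := H bx; exists N; split => //; apply: subset_trans subN => t /=.
by apply: contra_not => Ht st; rewrite Ht.
Qed.

Lemma ae_eq_calPs s g h : measurable_fun [set: 'rV[R]_d] g ->
  measurable_fun [set: 'rV[R]_d] h ->
  ae_eq (leb R d) (box a b) g h ->
  ae_eq (leb R d) (box a b) (calPs a b s g) (calPs a b s h).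
Proof.
move=> mg mh gh; elim: s => //= i s IH.
have IH' := ae_eq_avg i (measurable_calPs a b s mg) (measurable_calPs a b s mh) IH.
move: IH IH'; apply: filterS2 => x H1 H2 bx.
by rewrite /= H1// H2.
Qed.

Lemma avg_eq_box i g h : {in box a b, g =1 h} ->
  {in box a b, avg a b i g =1 avg a b i h}.
Proof.
move=> gh x /set_mem bx; rewrite /avg; congr (_ * _).
by apply: eq_Rintegral => t /set_mem st; apply: gh; apply/mem_set/upd_box.
Qed.

Lemma calPs_eq_box s g h : {in box a b, g =1 h} ->
  {in box a b, calPs a b s g =1 calPs a b s h}.
Proof.
move=> gh; elim: s => //= i s IH x bx.
by rewrite /= IH// (avg_eq_box i IH).
Qed.

Lemma lebS_gt0 : (0 < lebS a b setT)%E.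
Proof.
change (0 < leb R d (setT `&` box a b))%E; rewrite setTI leb_box// lte_fin; apply: prodr_gt0 => i _.
exact: side_gt0.
Qed.

Lemma Linfty_ae phi : Linfty a b phi ->
  exists M, {ae leb R d, forall x, box a b x -> `|phi x| <= M}.
Proof.
move=> [mphi]; rewrite unlock lebS_gt0 => H.
have [M HM] : exists M : R, (ess_sup (lebS a b) (abse \o (EFin \o phi)) <= M%:E)%E.
  move: H; case: (ess_sup _ _) => [r _|//|_]; first by exists r.
  by exists 0%R; exact: leNye.
exists M; apply/ae_lebS; move/ess_supP: HM.
by apply: filterS => x /=; rewrite lee_fin.
Qed.

(** The statement covers all the partial products of the projectors at once,
    because averaging preserves equality almost everywhere on the box. The empty
    list gives the equality of the functions themselves. *)
Lemma Linfty_bmeas phi : Linfty a b phi ->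
  exists2 psi, bmeas psi &
    forall s, ae_eq (leb R d) (box a b) (calPs a b s phi) (calPs a b s psi).
Proof.
move=> Lphi; have [M HM] := Linfty_ae Lphi; have [mphi _] := Lphi.
pose phi0 := phi \_ (box a b).
have mphi0 : measurable_fun [set: 'rV[R]_d] phi0.
  by apply/(measurable_restrictT _ _).1 => //; exact: measurable_box.
have e0 : {in box a b, phi =1 phi0} by move=> x bx; rewrite /phi0 patchE bx.
pose B := [set x | `|phi0 x| <= M].
have mB : measurable B.
  have mabs : measurable_fun [set: 'rV[R]_d] (fun x => `|phi0 x|).
    exact: (measurableT_comp (@normr_measurable R setT) mphi0).
  have -> : B = setT `&` (fun x => `|phi0 x|) @^-1` `]-oo, M]%classic.
    by rewrite setTI; apply/seteqP; split=> x; rewrite /= in_itv.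
  exact: mabs.
exists (fun x => phi0 x * \1_B x).
  split; first by apply: measurable_funM => //; exact: measurable_indic.
  exists `|M| => x; rewrite indicE; case: (boolP (x \in B)) => [/set_mem Bx|_].
    by rewrite mulr1; apply: (le_trans Bx); exact: ler_norm.
  by rewrite mulr0 normr0.
move=> s.
have : ae_eq (leb R d) (box a b) (calPs a b s phi0) (calPs a b s (fun x => phi0 x * \1_B x)).
  apply: ae_eq_calPs => //; first by apply: measurable_funM => //; exact: measurable_indic.
  apply: filterS HM => x H bx; rewrite indicE mem_set ?mulr1//.
  by rewrite /B /= -e0 ?inE//; exact: H.
apply: filterS => x H bx.
by rewrite (calPs_eq_box s e0) ?inE//; exact: H.
Qed.

End ae.

(** * Corrections by the values on the faces *)

Lemma rV_ballE (R : realType) (d : nat) (x y : 'rV[R]_d) (e : R) : 0 < e ->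
  (forall i, `|x 0 i - y 0 i| < e) -> ball x e y.
Proof. by move=> e0 h; split=> // j i; rewrite ord1; exact: h. Qed.

Lemma interior_box (R : realType) (d : nat) (l u : 'rV[R]_d) :
  (box l u)° = [set x | forall i, l 0 i < x 0 i < u 0 i].
Proof.
apply/seteqP; split=> x.
- move=> /nbhs_ballP[e /= e0 H] i.
  have B t : `|x 0 i - t| < e -> l 0 i <= t <= u 0 i.
    move=> te; have := H (upd x i t) _ i; rewrite mxE eqxx; apply.
    apply: rV_ballE => // j; rewrite mxE; case: eqP => [->//|_].
    by rewrite subrr normr0.
  have /andP[l1 _] := B (x 0 i - e / 2) ltac:(rewrite opprB addrC subrK gtr0_norm; lra).
  have /andP[_ u1] := B (x 0 i + e / 2) ltac:(rewrite opprD addNKr normrN gtr0_norm; lra).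
  by apply/andP; split; lra.
- move=> H; rewrite /interior /=.
  suff : nbhs x [set y : 'rV[R]_d | forall i, l 0 i < y 0 i < u 0 i].
    by apply: filterS => y Hy i; have /andP[? ?] := Hy i; rewrite !ltW.
  apply: (@filter_forall _ _ (fun i => [set y : 'rV[R]_d | l 0 i < y 0 i < u 0 i]) (nbhs x) _) => i.
  have : nbhs (x 0 i) [set z : R | l 0 i < z < u 0 i].
    have /open_nbhs_nbhs : open_nbhs (x 0 i) `]l 0 i, u 0 i[%classic.
      by split; [exact: interval_open|rewrite /= in_itv; exact: H].
    by apply: filterS => z; rewrite /= in_itv.
  exact: (@coord_continuous _ 1 d 0 i x).
Qed.

Lemma interior_boxE (R : realType) (d : nat) (l u : 'rV[R]_d) :
  (box l u)° = rect (fun i => `]l 0 i, u 0 i[%classic).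
Proof.
by rewrite interior_box; apply/seteqP; split=> x h i; have := h i; rewrite /= in_itv.
Qed.

Lemma measurable_interior_box (R : realType) (d : nat) (l u : 'rV[R]_d) :
  measurable ((box l u)°).
Proof. by rewrite interior_boxE; apply: measurable_rect => i; exact: measurable_itv. Qed.

Section Q.
Variables (R : realType) (d : nat) (a b : 'rV[R]_d).
Hypothesis ab : forall i, a 0 i < b 0 i.
Implicit Types (g f h : 'rV[R]_d -> R).
Notation side := (side a b).

(** The box and its interior have the same volume. *)
Lemma ae_interior : {ae leb R d, forall x, box a b x -> (box a b)° x}.
Proof.
exists (box a b `\` (box a b)°); split.
- by apply: measurableD; [exact: measurable_box|exact: measurable_interior_box].
- have sub : (box a b)° `<=` box a b by exact: interior_subset.
  rewrite measureD; [|exact: measurable_box|exact: measurable_interior_box|exact: leb_box_lty].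
  rewrite setIidr//.
  have E : leb R d (box a b)° = (\prod_i (b 0 i - a 0 i))%:E.
    rewrite interior_boxE leb_rect; last by move=> i; exact: measurable_itv.
    rewrite (eq_bigr (fun i => (b 0 i - a 0 i)%:E)); last first.
      by move=> i _; rewrite lebesgue_measure_itv/= lte_fin ab.
    by elim/big_rec2: _ => // i x y _ ->; rewrite EFinM.
  change (leb R d (box a b) - leb R d (box a b)° = 0)%E.
  by rewrite E (leb_box ab) subee.
- by move=> x /= /not_implyP[bx nx].
Qed.

(** The subtracted term, the mean of the values on the two opposite faces,
    ignores the i-th coordinate: a function centered in direction i does not see
    it. The remainder is at most half of the variation of f along the line. *)
Definition face_dev i f : 'rV[R]_d -> R :=
  fun x => f x - 2^-1 * (f (upd x i (a 0 i)) + f (upd x i (b 0 i))).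

Definition face_devs (s : seq 'I_d) f := foldr face_dev f s.

Lemma measurable_upd_l i (t : R) : measurable_fun [set: 'rV[R]_d] (fun x => upd x i t).
Proof.
exact: (measurableT_comp (@measurable_upd2 R d i) (measurable_pair2 t)).
Qed.

Lemma bmeas_upd i t f : bmeas f -> bmeas (fun x => f (upd x i t)).
Proof. by move=> bf; apply: bmeas_comp bf; exact: measurable_upd_l. Qed.

Lemma bmeas_face_devs s f : bmeas f -> bmeas (face_devs s f).
Proof.
move=> bf; elim: s => //= i s IH; apply: bmeasB => //; apply: bmeasM.
  exact: bmeas_cst.
by apply: bmeasD; exact: bmeas_upd.
Qed.

Lemma box_Rint_face_devs s g f : bmeas g -> bmeas f ->
  (forall i, i \in s -> forall x, avg a b i g x = 0) ->
  box_Rint a b (fun x => g x * f x) = box_Rint a b (fun x => g x * face_devs s f x).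
Proof.
move=> bg bf; elim: s => //= i s IH gs.
rewrite IH => [|j js]; last by apply: gs; rewrite inE js orbT.
set h := face_devs s f; have bh : bmeas h by exact: bmeas_face_devs.
pose h' x := 2^-1 * (h (upd x i (a 0 i)) + h (upd x i (b 0 i))).
have bh' : bmeas h'.
  by apply: bmeasM; [exact: bmeas_cst|apply: bmeasD; exact: bmeas_upd].
have -> : (fun x => g x * face_dev i h x) = (fun x => g x * h x - g x * h' x).
  by apply/funext => x; rewrite /face_dev mulrBr.
rewrite box_RintB//; [|exact: bmeasM..].
rewrite (box_Rint_centered ab bg bh' (gs i _)) ?subr0 ?inE ?eqxx// => x t.
by rewrite /h' !upd_upd.
Qed.

Lemma le_box_Rint_face_devs s g f : bmeas g -> bmeas f ->
  (forall i, i \in s -> forall x, avg a b i g x = 0) ->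
  (`| box_Rint a b (fun x => g x * f x) |%:E <=
   \int[leb R d]_(x in box a b) (`|g x|%:E * `|face_devs s f x|%:E))%E.
Proof.
move=> bg bf gs; rewrite (box_Rint_face_devs bg bf gs).
have bQ := bmeas_face_devs s bf.
have bgQ : bmeas (fun x => g x * face_devs s f x) by exact: bmeasM.
rewrite EFin_normr_Rintegral; [|exact: measurable_box|exact: bmeas_box_integrable].
apply: le_trans; first apply: le_abse_integral.
- exact: measurable_box.
- by apply: measurable_funTS; exact: bmeas_EFin.
- by under eq_integral do rewrite /= normrM EFinM.
Qed.

End Q.

(** * The Vitali variation *)

Section vitali.
Variables (R : realType) (d : nat) (a b : 'rV[R]_d).
Hypothesis ab : forall i, a 0 i < b 0 i.
Implicit Types (g f h : 'rV[R]_d -> R).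

Let K : finType := (bool * bool)%type.
Let k0 : K := (false, false).

(** A pair k encodes a choice of evaluation in one coordinate: (false, _) keeps
    the coordinate, (true, false) and (true, true) send it to the lower and to
    the upper face. *)
Definition face (k : K) (i : 'I_d) (t : R) : R :=
  if k.1 then (if k.2 then b 0 i else a 0 i) else t.

Definition corner (tau : {ffun 'I_d -> K}) (x : 'rV[R]_d) : 'rV[R]_d :=
  \row_j face (tau j) j (x 0 j).

Definition set_coord (tau : {ffun 'I_d -> K}) i k : {ffun 'I_d -> K} :=
  [ffun j => if j == i then k else tau j].

Definition supported_on (s : seq 'I_d) (tau : {ffun 'I_d -> K}) : bool :=
  [forall j, (j \in s) || (tau j == k0)].

Lemma set_coord_supported_on s i k (tau : {ffun 'I_d -> K}) : i \notin s ->
  [&& supported_on (i :: s) (set_coord tau i k), set_coord tau i k i == k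
    & set_coord (set_coord tau i k) i k0 == tau] = supported_on s tau.
Proof.
move=> is_; apply/idP/idP.
- move=> /and3P[/forallP H1 _ /eqP H3]; apply/forallP => j.
  have := H1 j; rewrite inE !ffunE; case: (eqVneq j i) => [ji _|//].
  by rewrite -H3 ffunE ji eqxx eqxx orbT.
- move=> /forallP H; apply/and3P; split.
  + apply/forallP => j; rewrite inE ffunE; case: (eqVneq j i) => //= _; exact: H.
  + by rewrite ffunE eqxx.
  + apply/eqP/ffunP => j; rewrite !ffunE; case: (eqVneq j i) => [->|//].
    by have := H i; rewrite (negbTE is_)/= => /eqP.
Qed.

(** The mean over the second component of k writes the kept value twice, with
    weight one half: the same shape as for the two faces, which makes the d-fold
    expansion a plain sum over all choices. *)
Lemma face_dev_sum i h x : face_dev a b i h x =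
  2^-1 * \sum_(k : K) (-1) ^+ k.1 * h (upd x i (face k i (x 0 i))).
Proof.
rewrite -(pair_big predT predT (fun p q : bool => (-1) ^+ p * h (upd x i (face (p, q) i (x 0 i)))))/=.
rewrite !big_bool /face /= !expr1 !expr0 upd_id /face_dev; lra.
Qed.

Lemma face_devs_sum s f x : uniq s -> face_devs a b s f x =
  2 ^- size s * \sum_(tau | supported_on s tau)
    (-1) ^+ (\sum_j (tau j).1)%N * f (corner tau x).
Proof.
elim: s x => [|i s IH] x /=.
  move=> _; rewrite expr0 invr1 mul1r (big_pred1 [ffun _ => k0]).
    rewrite big1 ?expr0 ?mul1r; last by move=> j _; rewrite ffunE.
    by congr f; apply/rowP => j; rewrite mxE ffunE.
  move=> tau; apply/forallP/eqP => [H|-> j]; last by rewrite ffunE eqxx orbT.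
  by apply/ffunP => j; rewrite ffunE; have := H j; rewrite in_nil => /eqP.
move=> /andP[is_ us]; rewrite face_dev_sum.
rewrite (partition_big (fun tau : {ffun 'I_d -> K} => tau i) predT)//=.
under [in LHS]eq_bigr do rewrite IH// mulrCA.
rewrite -mulr_sumr mulrA [in RHS]exprS invfM; congr (_ * _).
apply: eq_bigr => k _.
rewrite [in RHS](reindex_onto (fun tau => set_coord tau i k) (fun tau => set_coord tau i k0))/=; last first.
  move=> tau /andP[_ /eqP ti]; apply/ffunP => j; rewrite !ffunE.
  by case: (eqVneq j i) => // ->.
under [in RHS]eq_bigl do rewrite -andbA set_coord_supported_on//.
rewrite mulr_sumr; apply: eq_bigr => tau /forallP H.
have ti : tau i = k0 by have := H i; rewrite (negbTE is_) => /eqP.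
rewrite mulrA -exprD; congr (_ ^+ _ * f _).
  rewrite (bigD1 i)//= [in RHS](bigD1 i)//= ffunE eqxx ti/= add0n; congr addn.
  by apply: eq_bigr => j /negbTE ji; rewrite ffunE ji.
apply/rowP => j; rewrite !mxE ffunE; case: (eqVneq j i) => [->|//].
by rewrite ti /face.
Qed.

(** Cutting the box at x by the d coordinate hyperplanes leaves one cell per v:
    in direction j, the part above x_j when v j holds, the part below otherwise. *)
Definition cell (x : 'rV[R]_d) (v : {ffun 'I_d -> bool}) : 'rV[R]_d * 'rV[R]_d :=
  (\row_j (if v j then x 0 j else a 0 j), \row_j (if v j then b 0 j else x 0 j)).

(** The vertices of the cell at v are the points obtained from x by sending some
    coordinates to the faces chosen by v. *)
Lemma increment_cell f x v : `| increment f (cell x v) | =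
  `| \sum_(w : {ffun 'I_d -> bool})
      (-1) ^+ (\sum_j w j)%N * f (corner [ffun j => (w j, v j)] x) |.
Proof.
(* Reindexing w by its sum with v modulo 2 turns the choice of a vertex of the
   cell into that of the coordinates sent to the faces; the signs change by a
   common factor. *)
pose xorv (w : {ffun 'I_d -> bool}) : {ffun 'I_d -> bool} := [ffun j => w j (+) v j].
have xorvK : involutive xorv by move=> w; apply/ffunP => j; rewrite !ffunE addbK.
rewrite /increment (reindex xorv); last by exists xorv => w _; exact: xorvK.
have E : forall (A B : {ffun 'I_d -> bool} -> R) (c : R), `|c| = 1 ->
    (forall w, A w = c * B w) -> `|\sum_w A w| = `|\sum_w B w|.
  by move=> A B c c1 AB; rewrite (eq_bigr (fun w => c * B w))// -mulr_sumr normrM c1 mul1r.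
apply: (E _ _ ((-1) ^+ (\sum_j v j)%N)); first by rewrite normrX normrN1 expr1n.
move=> w; rewrite mulrA; congr (_ * f _).
  rewrite -exprD -!prodrXr -big_split/=.
  rewrite -[RHS]prodrXr; apply: eq_bigr => j _.
  by rewrite ffunE; case: (w j); case: (v j); rewrite /= ?expr0 ?expr1 ?expr2 ?mulrNN ?mulr1.
apply/rowP => j; rewrite !mxE !ffunE /face /=.
by case: (w j); case: (v j) => /=; rewrite ?mul0r ?mul1r ?addr0// addrC subrK.
Qed.

(** Grouping the terms of the expansion by the choice of faces gives, up to
    sign, the increments over the cells of the box cut at x. *)
Lemma le_face_devs_increment f x : `|face_devs a b (enum 'I_d) f x| <=
  2 ^- d * \sum_(v : {ffun 'I_d -> bool}) `| increment f (cell x v) |.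
Proof.
rewrite face_devs_sum ?enum_uniq// size_enum_ord normrM ger0_norm; last first.
  by rewrite invr_ge0 exprn_ge0.
rewrite ler_wpM2l ?invr_ge0 ?exprn_ge0//.
under [leRHS]eq_bigr do rewrite increment_cell.
pose G (tau : {ffun 'I_d -> K}) := (-1) ^+ (\sum_j (tau j).1)%N * f (corner tau x) : R.
have -> : \sum_(tau | supported_on (enum 'I_d) tau) G tau =
    \sum_(v : {ffun 'I_d -> bool}) \sum_(w : {ffun 'I_d -> bool})
      (-1) ^+ (\sum_j w j)%N * f (corner [ffun j => (w j, v j)] x).
  rewrite pair_bigA/=.
  pose F (p : {ffun 'I_d -> bool} * {ffun 'I_d -> bool}) : {ffun 'I_d -> K} :=
    [ffun j => (p.2 j, p.1 j)].
  pose F' (tau : {ffun 'I_d -> K}) : {ffun 'I_d -> bool} * {ffun 'I_d -> bool} :=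
    ([ffun j => (tau j).2], [ffun j => (tau j).1]).
  rewrite (reindex F); last first.
    exists F' => [[v w] _|tau _]; first by congr (_, _); apply/ffunP => j; rewrite !ffunE.
    by apply/ffunP => j; rewrite !ffunE; case: (tau j).
  apply: eq_big => [p|[v w] _].
    by apply/forallP => j; rewrite mem_enum.
  by rewrite /G; congr (_ ^+ _ * _); apply: eq_bigr => j _; rewrite ffunE.
exact: ler_norm_sum.
Qed.

Lemma cell_partition x : (box a b)° x ->
  box_partition a b (fun j : 'I_#|{: {ffun 'I_d -> bool}}| => cell x (enum_val j)).
Proof.
rewrite interior_box /= => xab; split.
- by move=> j i; rewrite !mxE; case: (enum_val j i); have /andP[] := xab i.
- apply/trivIsetP => j k _ _ jk; rewrite !interior_box; apply/seteqP; split => // y [/= H1 H2].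
  have : enum_val j != enum_val k by rewrite (inj_eq enum_val_inj).
  move=> /eqP; apply; apply/ffunP => i.
  have := H1 i; have := H2 i; rewrite !mxE.
  case: (enum_val j i); case: (enum_val k i) => // /andP[h1 h2] /andP[h3 h4].
    by have := lt_trans h2 h3; rewrite ltxx.
  by have := lt_trans h4 h1; rewrite ltxx.
- apply/seteqP; split => y.
    move=> [j _ /= H] i; have := H i; rewrite !mxE; have /andP[h1 h2] := xab i.
    case: (enum_val j i) => /andP[h3 h4]; apply/andP; split => //.
      exact: le_trans (ltW h1) h3.
    exact: le_trans h4 (ltW h2).
  move=> H; pose v : {ffun 'I_d -> bool} := [ffun i => x 0 i <= y 0 i].
  exists (enum_rank v) => // i; rewrite enum_rankK !mxE ffunE.
  have /andP[h1 h2] := H i.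
  by case: (leP (x 0 i) (y 0 i)) => [->//|/ltW ->]; rewrite h1.
Qed.

Lemma le_face_devs_vitali f x : (box a b)° x ->
  (`|face_devs a b (enum 'I_d) f x|%:E <= (2 ^- d)%:E * vitali a b f)%E.
Proof.
move=> xi; apply: (@le_trans _ _ (2 ^- d * \sum_(v : {ffun 'I_d -> bool})
   `| increment f (cell x v) |)%:E); first by rewrite lee_fin le_face_devs_increment.
rewrite EFinM lee_wpmul2l ?lee_fin ?invr_ge0 ?exprn_ge0//.
apply: ereal_sup_ubound => /=.
exists #|{: {ffun 'I_d -> bool}}|, (fun j => cell x (enum_val j)); split.
  exact: cell_partition.
by congr EFin; rewrite -(big_enum_val (fun v => `|increment f (cell x v)|)).
Qed.

(** The face deviations of f at x are bounded by the variation over the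
    partition of the box into the cells cut at x. *)
Lemma centered_vitali_bound g f : bmeas g -> bmeas f ->
  (forall i x, avg a b i g x = 0) ->
  (`| box_Rint a b (fun x => g x * f x)%R |%:E <=
   (2 ^- d)%:E * (\int[leb R d]_(x in box a b) `|g x|%:E) * vitali a b f)%E.
Proof.
move=> bg bf gc.
apply: (le_trans (le_box_Rint_face_devs ab bg bf (s := enum 'I_d) (fun i _ => gc i))).
set c := ((2 ^- d)%:E * vitali a b f)%E.
have mid : (box a b)° (\row_i ((a 0 i + b 0 i) / 2)).
  by rewrite interior_box /= => i; rewrite mxE; have := ab i => ?; apply/andP; split; lra.
have c0 : (0 <= c)%E by apply: le_trans (le_face_devs_vitali f mid); rewrite lee_fin.
have mg : measurable_fun (box a b) (fun x => `|g x|%:E : \bar R).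
  by apply: measurable_funTS; apply: bmeas_EFin; exact: bmeas_abs.
have mQ : measurable_fun (box a b) (fun x => `|face_devs a b (enum 'I_d) f x|%:E : \bar R).
  by apply: measurable_funTS; apply: bmeas_EFin; apply: bmeas_abs; exact: bmeas_face_devs.
have -> : ((2 ^- d)%:E * (\int[leb R d]_(x in box a b) `|g x|%:E) * vitali a b f =
    \int[leb R d]_(x in box a b) (c * `|g x|%:E))%E.
  by rewrite ge0_integralZl//; [rewrite /c muleAC|exact: measurable_box].
apply: ae_ge0_le_integral => //.
- exact: measurable_box.
- exact: emeasurable_funM.
- by move=> x _; rewrite mule_ge0.
- exact: measurable_funeM.
- move: (ae_interior ab); apply: filterS => x xi bx.
  by rewrite muleC lee_wpmul2r//; apply: le_face_devs_vitali; exact: xi.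
Qed.

End vitali.

(** * Continuous functions on the box and primitives along its sides *)

(** An open set is a countable union of small cubes with rational centres. It is
    what identifies the sigma-algebra generated by the coordinates with the
    Borel one. *)
Lemma open_measurable_rV (R : realType) (d : nat) (U : set 'rV[R]_d) :
  open U -> measurable U.
Proof.
move=> oU.
pose C (p : 'rV[rat]_d * nat) : set 'rV[R]_d :=
  rect (fun i => `]ratr (p.1 0 i) - p.2.+1%:R^-1, ratr (p.1 0 i) + p.2.+1%:R^-1[%classic).
have mC p : measurable (C p) by apply: measurable_rect => i; exact: measurable_itv.
have -> : U = \bigcup_(p in [set: 'rV[rat]_d * nat]) (if `[< C p `<=` U >] then C p else set0).
  apply/seteqP; split=> x.
    move=> Ux; have /nbhs_ballP[e /= e0 eU] : nbhs x U by exact: open_nbhs_nbhs.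
    pose n := Num.truncn (2 / e).
    have n0 : (0 : R) < n.+1%:R^-1 by rewrite invr_gt0 ltr0n.
    have ne : 2 * n.+1%:R^-1 < e.
      rewrite ltr_pdivrMr ?ltr0n// mulrC -ltr_pdivrMr//; exact: truncnS_gt.
    have /choice[q Hq] : forall i, exists r : rat,
        ratr r \in `](x 0 i - n.+1%:R^-1), (x 0 i + n.+1%:R^-1)[.
      by move=> i; apply: rat_in_itvoo; rewrite ltrBlDr -addrA ltrDl addr_gt0.
    have qE i : (\row_i q i) 0 i = q i by rewrite mxE.
    exists (\row_i q i, n) => //; rewrite asboolT => [|y yC].
      move=> i /=; have := Hq i; rewrite !in_itv/= qE -/n.
      move: (ratr (q i)) (n.+1%:R^-1 : R) => r m /andP[h1 h2].
      by apply/andP; split; lra.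
    apply: eU; apply: rV_ballE => // i.
    have := Hq i; have := yC i; rewrite /= !in_itv/= qE.
    move: (ratr (q i)) (n.+1%:R^-1 : R) ne => r m ne /andP[h1 h2] /andP[h3 h4].
    by apply/ltr_normlP; split; lra.
  by move=> [p _]; case: ifPn => // /asboolP; apply.
apply: countable_bigcupT_measurable; first exact: countableP.
by move=> p; case: ifP => // _; exact: measurable0.
Qed.

Lemma continuous_measurable_rV (R : realType) (d : nat) (f : 'rV[R]_d -> R) :
  continuous f -> measurable_fun [set: 'rV[R]_d] f.
Proof.
move=> /continuousP cf; apply: (measurability _ (RGenOpens.measurableE R)).
move=> _ [_ [x [y ->] <-]]; rewrite setTI; apply: open_measurable_rV.
exact/cf/interval_open.
Qed.

Section clamp.
Variables (R : realType) (d : nat) (a b : 'rV[R]_d).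
Hypothesis ab : forall i, a 0 i < b 0 i.
Implicit Types (g f h : 'rV[R]_d -> R).
Notation side := (side a b).

Lemma continuous_rV (T : topologicalType) (e : T -> 'rV[R]_d) :
  (forall i, continuous (fun x => e x 0 i)) -> continuous e.
Proof.
move=> ce x; apply/cvg_ballP => e0 e00.
suff : \forall y \near x, forall i, `|e x 0 i - e y 0 i| < e0.
  by apply: filterS => y; exact: rV_ballE.
apply: (@filter_forall _ _ (fun i => [set y | `|e x 0 i - e y 0 i| < e0]) (nbhs x) _) => i.
have /cvg_ballP/(_ e0 e00) := ce i x.
by [].
Qed.

(** Composing with this retraction onto the box extends a function that is
    continuous on the box to a continuous bounded function on the whole space,
    with the same values on the box. *)
Definition clamp (x : 'rV[R]_d) : 'rV[R]_d :=
  \row_i Num.max (a 0 i) (Num.min (b 0 i) (x 0 i)).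

Lemma clamp_box x : box a b (clamp x).
Proof.
move=> i; rewrite mxE le_max lexx/= ge_max ge_min lexx /= andbT.
exact: ltW.
Qed.

Lemma clamp_id x : box a b x -> clamp x = x.
Proof.
move=> bx; apply/rowP => i; rewrite mxE; have /andP[h1 h2] := bx i.
by rewrite (min_idPr h2) (max_idPr h1).
Qed.

Lemma continuous_clamp : continuous clamp.
Proof.
apply: continuous_rV => i x; under eq_fun do rewrite mxE.
apply: (@continuous_max R _ (fun=> a 0 i) (fun x : 'rV[R]_d => Num.min (b 0 i) (x 0 i))).
  exact: cst_continuous.
apply: (@continuous_min R _ (fun=> b 0 i) (fun x : 'rV[R]_d => x 0 i)).
  exact: cst_continuous.
exact: coord_continuous.
Qed.

Lemma continuous_comp_clamp f : {within box a b, continuous f} ->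
  continuous (f \o clamp).
Proof.
move=> /subspace_continuousP cf x.
have := cf _ (clamp_box x); apply: cvg_trans => U /= HU.
have := @continuous_clamp x _ HU; rewrite /= => H.
have G y : (box a b (clamp y) -> U (f (clamp y))) -> U (f (clamp y)).
  by apply; exact: clamp_box.
exact: filterS G H.
Qed.

Lemma compact_box : compact (box a b).
Proof.
have -> : box a b = [set v : 'rV[R]_d | forall i, `[a 0 i, b 0 i]%classic (v ord0 i)].
  by apply/seteqP; split=> x h i; have := h i; rewrite /= in_itv.
exact: (@rV_compact _ d (fun i => `[a 0 i, b 0 i]%classic) (fun i => @segment_compact R _ _)).
Qed.

Lemma bmeas_clamp f : {within box a b, continuous f} -> bmeas (f \o clamp).
Proof.
move=> cf; split; first by apply: continuous_measurable_rV; exact: continuous_comp_clamp.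
have /compact_bounded[M [_ HM]] := continuous_compact cf compact_box.
exists (M + 1) => x; apply: (HM (M + 1)); first by rewrite ltrDl.
by exists (clamp x) => //; exact: clamp_box.
Qed.

Lemma continuous_upd (x : 'rV[R]_d) i : continuous (upd x i).
Proof.
apply: continuous_rV => j t; under eq_fun do rewrite mxE.
case: (j == i); [exact: (@cvg_id _ (nbhs t))|exact: cst_continuous].
Qed.

Lemma continuous_upd_l i (t : R) : continuous (fun x : 'rV[R]_d => upd x i t).
Proof.
apply: continuous_rV => j x; under eq_fun do rewrite mxE.
case: (j == i); [exact: cst_continuous|exact: coord_continuous].
Qed.

Lemma is_derive_upd f j x t l : is_derive (upd x j t) (delta_mx 0 j) f l ->
  is_derive t 1 (fun t => f (upd x j t)) l.
Proof.
have E : (fun h : R => h^-1 *: (((fun t => f (upd x j t)) \o shift t) (h *: 1) -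
            f (upd x j t))) =
         (fun h : R => h^-1 *: ((f \o shift (upd x j t)) (h *: delta_mx 0 j) -
            f (upd x j t))).
  apply/funext => h; congr (_ *: (f _ - _)).
  apply/rowP => k; rewrite !mxE eqxx/=; case: eqP => _.
    by rewrite mulr1 /GRing.scale/= mulr1.
  by rewrite mulr0 add0r.
by move=> [D <-]; split; [move: D; rewrite /derivable E|rewrite /derive E].
Qed.

Definition primitive_along j f g := forall x, box a b x ->
  f x - f (upd x j (a 0 j)) =
  \int[lebesgue_measure]_(t in `[a 0 j, x 0 j]) g (upd x j t).

End clamp.

Lemma dominated_convergence_Rint (R : realType) (dT : measure_display) (T : measurableType dT)
    (mu : {measure set T -> \bar R}) (D : set T) (h_ : (T -> R)^nat) (h G : T -> R) :
  measurable D -> (forall n, measurable_fun D (h_ n)) -> measurable_fun D h ->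
  mu.-integrable D (EFin \o G) ->
  (forall n x, D x -> `|h_ n x| <= G x) ->
  {ae mu, forall x, D x -> h_ n x @[n --> \oo] --> h x} ->
  \int[mu]_(x in D) h_ n x @[n --> \oo] --> \int[mu]_(x in D) h x.
Proof.
move=> mD mh_ mh iG hG hh.
have [ih _ cv] := @dominated_convergence _ _ _ mu D mD (fun n => EFin \o h_ n)
  (EFin \o h) (EFin \o G)
  (fun n => (measurable_EFinP _ _).2 (mh_ n)) ((measurable_EFinP _ _).2 mh)
  (ltac:(move: hh; apply: filterS => x H Dx; apply: cvg_EFin; [exact: nearW|exact: H]))
  iG (aeW _ (fun x n Dx => hG n x Dx)).
have fin : (\int[mu]_(x in D) (h x)%:E)%E \is a fin_num by exact: integrable_fin_num.
rewrite /Rintegral; apply: fine_cvg; rewrite fineK//; exact: cv.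
Qed.

Lemma bounded_convergence_Rint (R : realType) (dT : measure_display) (T : measurableType dT)
    (mu : {measure set T -> \bar R}) (D : set T) (h_ : (T -> R)^nat) (h : T -> R) M :
  measurable D -> (mu D < +oo)%E ->
  (forall n, measurable_fun D (h_ n)) -> measurable_fun D h ->
  (forall n x, D x -> `|h_ n x| <= M) ->
  {ae mu, forall x, D x -> h_ n x @[n --> \oo] --> h x} ->
  \int[mu]_(x in D) h_ n x @[n --> \oo] --> \int[mu]_(x in D) h x.
Proof.
move=> mD Doo mh_ mh hM hh.
apply: (@dominated_convergence_Rint _ _ _ _ _ _ _ (fun=> M)) => //.
by apply: bmeas_integrable => //; exact: bmeas_cst.
Qed.

Section primitive.
Variables (R : realType) (d : nat) (a b : 'rV[R]_d).
Hypothesis ab : forall i, a 0 i < b 0 i.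
Implicit Types (g f h : 'rV[R]_d -> R).
Notation side := (side a b).
Notation clamp := (clamp a b).
Notation primitive_along := (primitive_along a b).

Lemma interior_upd (x : 'rV[R]_d) j t : (forall i, i != j -> a 0 i < x 0 i < b 0 i) ->
  a 0 j < t < b 0 j -> (box a b)° (upd x j t).
Proof.
move=> xi tj; rewrite interior_box => i /=; rewrite mxE.
by case: (eqVneq i j) => [->|ij]; [exact: tj|exact: xi].
Qed.

Lemma is_derive_clamp f x v l : (box a b)° x -> is_derive x v f l ->
  is_derive x v (f \o clamp) l.
Proof.
move=> xi; apply: near_eq_is_derive.
have : nbhs x (box a b)° by apply: open_nbhs_nbhs; split => //; exact: open_interior.
apply: filterS => y /interior_subset yb.
by rewrite /= clamp_id.
Qed.

(** On a segment that meets only the interior of the box, except for its ends,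
    this is the fundamental theorem of calculus. *)
Lemma primitive_interior j f g :
  {within box a b, continuous f} -> {within box a b, continuous g} ->
  (forall x, (box a b)° x -> is_derive x (delta_mx 0 j) f (g x)) ->
  forall x, box a b x -> (forall i, i != j -> a 0 i < x 0 i < b 0 i) ->
  f (clamp x) - f (clamp (upd x j (a 0 j))) =
  \int[lebesgue_measure]_(t in `[a 0 j, x 0 j]) g (clamp (upd x j t)).
Proof.
move=> cf cg fg x bx xi.
have /andP[] := bx j; rewrite le_eqVlt => /predU1P[E _|ax xb].
  by rewrite -E set_itv1 Rintegral_set1 E upd_id subrr.
pose F t := (f \o clamp) (upd x j t).
pose G t := (g \o clamp) (upd x j t).
have cF : continuous F.
  move=> t; apply: (@continuous_comp _ _ _ (upd x j) (f \o clamp)); first exact: continuous_upd.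
  exact: continuous_comp_clamp.
have cG : continuous G.
  move=> t; apply: (@continuous_comp _ _ _ (upd x j) (g \o clamp)); first exact: continuous_upd.
  exact: continuous_comp_clamp.
have dF t : t \in `]a 0 j, x 0 j[ -> is_derive t 1 F (G t).
  rewrite in_itv /= => /andP[t1 t2].
  have ui : (box a b)° (upd x j t).
    by apply: interior_upd => //; rewrite t1 (lt_le_trans t2).
  apply: is_derive_upd; rewrite /G /= (clamp_id (interior_subset ui)).
  by apply: is_derive_clamp => //; exact: fg.
have := @continuous_FTC2 R G F (a 0 j) (x 0 j) ax.
move=> /(_ (continuous_subspaceT cG)) H.
rewrite /Rintegral (H _ _)/=.
- by rewrite /F /= upd_id.
- split.
  + by move=> t /dF [].
  + apply: cvg_at_right_filter; exact: cF.
  + apply: cvg_at_left_filter; exact: cF.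
- by move=> t /dF [_ <-]; rewrite derive1E.
Qed.

(** Derivatives are known in the interior only; on the lines inside the boundary
    faces the formula is obtained as a limit, both sides being continuous. *)
Lemma primitive_of_derive j f g :
  {within box a b, continuous f} -> {within box a b, continuous g} ->
  (forall x, (box a b)° x -> is_derive x (delta_mx 0 j) f (g x)) ->
  primitive_along j (f \o clamp) (g \o clamp).
Proof.
move=> cf cg fg x bx.
(* The line is moved towards the centre of the box in all coordinates but j, by
   a fraction e that tends to 0. *)
pose c i := (a 0 i + b 0 i) / 2.
pose p (e : R) : 'rV[R]_d := \row_i (if i == j then x 0 i else x 0 i + e * (c i - x 0 i)).
have cp : continuous p.
  apply: continuous_rV => i e; under eq_fun do rewrite mxE.
  case: (i == j); first exact: cst_continuous.
  apply: cvgD; first exact: cvg_cst.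
  by apply: cvgM; [exact: cvg_id|exact: cvg_cst].
have p0 : p 0 = x by apply/rowP => i; rewrite mxE mul0r addr0 if_same.
have pj e : p e 0 j = x 0 j by rewrite mxE eqxx.
have pin n i : i != j -> a 0 i < p (harmonic n) 0 i < b 0 i.
  move=> /negbTE ij; rewrite mxE ij.
  have e0 : (0 : R) < harmonic n by rewrite /harmonic invr_gt0 ltr0n.
  have e1 : harmonic n <= 1 :> R by rewrite /harmonic invf_le1 ?ltr0n// ler1n.
  have := bx i => /andP[h1 h2]; have := ab i; rewrite /c.
  move: (harmonic n) (x 0 i) (a 0 i) (b 0 i) e0 e1 h1 h2 => e y u v e0 e1 h1 h2 uv.
  apply/andP; split; nra.
have pbox n : box a b (p (harmonic n)).
  move=> i; case: (eqVneq i j) => [->|ij]; first by rewrite pj; exact: bx.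
  by have /andP[? ?] := pin n i ij; rewrite !ltW.
have E n := primitive_interior cf cg fg (pbox n) (pin n).
have ch (h : 'rV[R]_d -> R) : continuous h -> h (p (harmonic n)) @[n --> \oo] --> h x.
  move=> hc; rewrite -[in X in _ --> X]p0.
  have hp : {for 0, continuous (h \o p)}.
    by apply: (@continuous_comp _ _ _ p h); [exact: cp|exact: hc].
  exact: (cvg_comp _ _ (@cvg_harmonic R) hp).
have cfc := continuous_comp_clamp ab cf.
have cgc := continuous_comp_clamp ab cg.
have L : (f (clamp (p (harmonic n))) - f (clamp (upd (p (harmonic n)) j (a 0 j))))
    @[n --> \oo] --> f (clamp x) - f (clamp (upd x j (a 0 j))).
  apply: cvgB; first exact: (ch (f \o clamp)).
  apply: (ch (fun y => (f \o clamp) (upd y j (a 0 j)))) => y.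
  by apply: (@continuous_comp _ _ _ (fun y => upd y j _) (f \o clamp)); [exact: continuous_upd_l|exact: cfc].
have [mg [M gM]] := bmeas_clamp ab cg.
have Rr : \int[lebesgue_measure]_(t in `[a 0 j, x 0 j]) g (clamp (upd (p (harmonic n)) j t))
    @[n --> \oo] --> \int[lebesgue_measure]_(t in `[a 0 j, x 0 j]) g (clamp (upd x j t)).
  apply: (bounded_convergence_Rint (M := M)).
  - exact: measurable_itv.
  - by rewrite /= lebesgue_measure_itv/=; case: ifP => _; rewrite ltry.
  - by move=> n; apply: measurable_funTS; exact: (measurableT_comp mg (measurable_upd _ j)).
  - by apply: measurable_funTS; exact: (measurableT_comp mg (measurable_upd _ j)).
  - by move=> n t _; exact: gM.
  - apply: aeW => t _; apply: (ch (fun y => (g \o clamp) (upd y j t))) => y.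
    by apply: (@continuous_comp _ _ _ (fun y => upd y j _) (g \o clamp)); [exact: continuous_upd_l|exact: cgc].
apply: (cvg_unique _ L); first exact: Rhausdorff.
have EE : (fun n => f (clamp (p (harmonic n))) - f (clamp (upd (p (harmonic n)) j (a 0 j)))) =
    (fun n => \int[lebesgue_measure]_(t in `[a 0 j, x 0 j]) g (clamp (upd (p (harmonic n)) j t))).
  by apply/funext => n; rewrite E pj.
by rewrite EE; exact: Rr.
Qed.

Lemma primitive_integrable i g x y : bmeas g -> box a b x ->
  lebesgue_measure.-integrable `[a 0 i, x 0 i] (EFin \o (fun t => g (upd y i t))).
Proof.
move=> bg bx; apply: bmeas_integrable; first exact: measurable_itv.
  by rewrite /= lebesgue_measure_itv/=; case: ifP => _; rewrite ltry.
by apply: bmeas_comp bg; exact: measurable_upd.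
Qed.

(** The correction in direction i commutes with integration along another
    direction j. *)
Lemma primitive_face_dev i j f g : i != j -> bmeas g -> primitive_along j f g ->
  primitive_along j (face_dev a b i f) (face_dev a b i g).
Proof.
move=> ij bg fg x bx; rewrite /face_dev.
have sa : side i (a 0 i) by rewrite /side/= in_itv/= lexx ltW.
have sb : side i (b 0 i) by rewrite /side/= in_itv/= lexx ltW.
have Fa := fg _ (upd_box bx sa); have Fb := fg _ (upd_box bx sb).
have Fx := fg _ bx.
have xj t : (upd x i t) 0 j = x 0 j by rewrite mxE eq_sym (negbTE ij).
rewrite !xj in Fa Fb.
have bgi c : bmeas (fun y => g (upd y i c)) by exact: bmeas_upd.
rewrite RintegralB; last 3 first.
- exact: measurable_itv.
- exact: primitive_integrable.
- apply: (@primitive_integrable j (fun y => 2^-1 * (g (upd y i (a 0 i)) + g (upd y i (b 0 i)))) x x) => //.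
  by apply: bmeasM; [exact: bmeas_cst|exact: bmeasD].
rewrite RintegralZl; last 2 first.
- exact: measurable_itv.
- by apply: (@primitive_integrable j (fun y => (g (upd y i (a 0 i)) + g (upd y i (b 0 i)))) x x) => //; exact: bmeasD.
rewrite RintegralD; last 3 first.
- exact: measurable_itv.
- exact: (@primitive_integrable j (fun y => g (upd y i (a 0 i))) x x (bgi _) bx).
- exact: (@primitive_integrable j (fun y => g (upd y i (b 0 i))) x x (bgi _) bx).
have E c : \int[lebesgue_measure]_(t in `[a 0 j, x 0 j]) g (upd (upd x j t) i c) =
   \int[lebesgue_measure]_(t in `[a 0 j, x 0 j]) g (upd (upd x i c) j t).
  by apply: eq_Rintegral => t _; rewrite upd_updC // eq_sym.
rewrite !E -Fx -Fa -Fb !(upd_updC x _ _ ij).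
lra.
Qed.

(** With A and C the integrals of g over the parts of the line below and above
    x, the face deviation of f is (A - C) / 2. *)
Lemma le_face_dev j f g x : primitive_along j f g -> bmeas g -> box a b x ->
  (`|face_dev a b j f x|%:E <= (2^-1)%:E * side_int a b j (fun y => `|g y|%:E) x)%E.
Proof.
move=> fg bg bx.
have sb : side j (b 0 j) by rewrite /side/= in_itv/= lexx ltW.
have Fb := fg _ (upd_box bx sb); have Fx := fg _ bx.
have upb : (upd x j (b 0 j)) 0 j = b 0 j by rewrite mxE eqxx.
rewrite upb upd_upd in Fb.
have /andP[ax xb] := bx j.
pose A (h : 'rV[R]_d -> R) := \int[lebesgue_measure]_(t in `[a 0 j, x 0 j]) h (upd x j t).
pose C (h : 'rV[R]_d -> R) := \int[lebesgue_measure]_(t in `]x 0 j, b 0 j]) h (upd x j t).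
have ACB h : bmeas h -> side_Rint a b j h x = A h + C h.
  move=> bh; have := @Rintegral_itvB R (fun t => h (upd x j t)) (BLeft (a 0 j)) (BRight (b 0 j)) (x 0 j).
  move=> /(_ (section_integrable ab j x bh)).
  rewrite !bnd_simp => /(_ ax xb) H.
  have {}H : side_Rint a b j h x - A h = C h := H.
  by rewrite -H addrC subrK.
have Eb : \int[lebesgue_measure]_(t in `[a 0 j, b 0 j]) g (upd (upd x j (b 0 j)) j t) = side_Rint a b j g x.
  by apply: eq_Rintegral => t _; rewrite upd_upd.
rewrite Eb ACB// in Fb; rewrite -/(A g) in Fx.
have Q : face_dev a b j f x = 2^-1 * (A g - C g) by rewrite /face_dev; lra.
have ba := bmeas_abs bg.
rewrite (side_int_side_Rint ab j x ba) -EFinM lee_fin Q normrM ger0_norm ?invr_ge0//.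
rewrite ler_wpM2l ?invr_ge0// (ACB _ ba).
apply: (le_trans (ler_normB _ _)); apply: lerD; apply: le_normr_Rintegral.
- exact: measurable_itv.
- exact: primitive_integrable.
- exact: measurable_itv.
- apply: bmeas_integrable; first exact: measurable_itv.
    by rewrite /= lebesgue_measure_itv/=; case: ifP => _; rewrite ltry.
  by apply: bmeas_comp bg; exact: measurable_upd.
Qed.

End primitive.

(** * The mixed derivative *)

Section mixed.
Variables (R : realType) (d : nat) (a b : 'rV[R]_d).
Hypothesis ab : forall i, a 0 i < b 0 i.
Implicit Types (g f h : 'rV[R]_d -> R).
Notation side := (side a b).
Notation clamp := (clamp a b).
Notation primitive_along := (primitive_along a b).
Notation face_devs := (face_devs a b).

Definition side_ints (s : seq 'I_d) (F : 'rV[R]_d -> \bar R) := foldr (side_int a b) F s.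

Lemma side_ints_ge0 s F x : (forall x, 0 <= F x)%E -> (0 <= side_ints s F x)%E.
Proof. by move=> F0; elim: s x => //= i s IH x; exact: side_int_ge0. Qed.

Lemma measurable_side_ints s F : measurable_fun [set: 'rV[R]_d] F ->
  (forall x, 0 <= F x)%E -> measurable_fun [set: 'rV[R]_d] (side_ints s F).
Proof.
move=> mF F0; elim: s => //= i s IH; apply: measurable_side_int => // x.
exact: side_ints_ge0.
Qed.

Lemma side_ints_agree (s : seq 'I_d) F (x y : 'rV[R]_d) : (forall j, j \notin s -> x 0 j = y 0 j) ->
  side_ints s F x = side_ints s F y.
Proof.
elim: s x y => [|i s IH] x y /= xy.
  by congr F; apply/rowP => j; exact: xy.
apply: eq_integral => t _; apply: IH => j js; rewrite !mxE.
by case: (eqVneq j i) => // ji; apply: xy; rewrite inE negb_or ji.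
Qed.

Lemma int_side_ints s F : measurable_fun [set: 'rV[R]_d] F -> (forall x, 0 <= F x)%E ->
  (\int[leb R d]_(x in box a b) side_ints s F x =
   (\prod_(i <- s) (b 0 i - a 0 i))%:E * \int[leb R d]_(x in box a b) F x)%E.
Proof.
move=> mF F0; elim: s => [|i s IH]; first by rewrite big_nil mul1e.
rewrite big_cons EFinM -muleA -IH -int_side_int//; first exact: measurable_side_ints.
by move=> x; exact: side_ints_ge0.
Qed.

Lemma face_devs_eq_box s f h : (forall x, box a b x -> f x = h x) ->
  forall x, box a b x -> face_devs s f x = face_devs s h x.
Proof.
move=> fh; elim: s => //= i s IH x bx; rewrite /face_dev.
have sa : side i (a 0 i) by rewrite sideE lexx ltW.
have sb : side i (b 0 i) by rewrite sideE lexx ltW.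
by rewrite !IH//; exact: upd_box.
Qed.

Lemma primitive_face_devs s j f g : j \notin s -> bmeas g -> primitive_along j f g ->
  primitive_along j (face_devs s f) (face_devs s g).
Proof.
move=> + bg fg; elim: s => //= i s IH; rewrite inE negb_or => /andP[ji js].
apply: primitive_face_dev => //; [by rewrite eq_sym|exact: bmeas_face_devs|exact: IH].
Qed.

Lemma partials_eq_open (U : set 'rV[R]_d) s f h : open U ->
  (forall x, U x -> f x = h x) -> forall x, U x -> partials s f x = partials s h x.
Proof.
move=> oU fh; elim: s => //= i s IH x Ux; rewrite /partial.
apply: near_eq_derive.
have : nbhs x U by exact: open_nbhs_nbhs.
exact: filterS.
Qed.

Lemma Ck_continuous k f : Ck a b k f -> {within box a b, continuous f}.
Proof. by case: k => [|k] []. Qed.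

(** Each derivative, taken by the fundamental theorem of calculus, costs one
    factor 1/2 and one integration along a side. The function G is the
    continuous extension to the box of the mixed derivative, which is defined in
    the interior only. The list is traversed from its end, where the innermost
    derivative stands, so the corrections come in the reverse order. *)
Lemma Ck_face_devs s f : uniq s -> Ck a b (size s) f ->
  exists G, [/\ bmeas G, forall x, (box a b)° x -> partials s f x = G x
    & forall x, box a b x ->
      (`|face_devs (rev s) f x|%:E <= (2 ^- size s)%:E * side_ints (rev s) (fun y => `|G y|%:E) x)%E].
Proof.
elim/last_ind: s f => [|s j IH] f.
  move=> _ /Ck_continuous cf; exists (f \o clamp); split.
  - exact: bmeas_clamp.
  - by move=> x /interior_subset bx; rewrite /= clamp_id.
  - by move=> x bx; rewrite expr0 invr1 mul1e /= clamp_id.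
rewrite rcons_uniq => /andP[js us]; rewrite size_rcons => Cf.
have cf := Ck_continuous Cf.
case: Cf => _ /(_ j)[g [Cg fg]].
have cg := Ck_continuous Cg.
have [G [bG GE GQ]] := IH _ us Cg.
exists G; split => //.
- move=> x xi; rewrite -cats1 /partials foldr_cat /= -[RHS]GE//.
  apply: partials_eq_open xi; first exact: open_interior.
  by move=> y yi; rewrite /partial; have [_ ->] := fg y yi.
- move=> x bx; rewrite rev_rcons /=.
  pose f0 := f \o clamp; pose g0 := g \o clamp.
  have bg0 : bmeas g0 by exact: bmeas_clamp.
  have P0 : primitive_along j (face_devs (rev s) f0) (face_devs (rev s) g0).
    by apply: primitive_face_devs => //; [rewrite mem_rev|exact: primitive_of_derive].
  have ff0 y : box a b y -> f y = f0 y by move=> ?; rewrite /f0/= clamp_id.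
  have gg0 y : box a b y -> g y = g0 y by move=> ?; rewrite /g0/= clamp_id.
  have -> : face_dev a b j (face_devs (rev s) f) x = face_dev a b j (face_devs (rev s) f0) x.
    exact: (face_devs_eq_box (j :: rev s) ff0 bx).
  have bQ := bmeas_face_devs a b (rev s) bg0.
  apply: (le_trans (le_face_dev ab P0 bQ bx)).
  have J0 y : (0 <= side_ints (rev s) (fun y => `|G y|%:E) y)%E by apply: side_ints_ge0.
  have mJ : measurable_fun [set: 'rV[R]_d] (side_ints (rev s) (fun y => `|G y|%:E)).
    by apply: measurable_side_ints => //; apply: bmeas_EFin; exact: bmeas_abs.
  have mup F : measurable_fun [set: 'rV[R]_d] F ->
      measurable_fun (side j) (fun t => F (upd x j t) : \bar R).
    by move=> mF; apply: measurable_funTS; exact: (measurableT_comp mF (measurable_upd x j)).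
  rewrite exprS invfM EFinM -muleA; apply: lee_wpmul2l; first by rewrite lee_fin invr_ge0.
  rewrite /side_int -ge0_integralZl//.
  + apply: ge0_le_integral => //.
    * exact: measurable_side.
    * by apply: (mup (fun y => `|face_devs (rev s) g0 y|%:E)); apply: bmeas_EFin; exact: bmeas_abs.
    * by apply: measurable_funeM; exact: mup.
    * move=> t st; rewrite -(face_devs_eq_box _ gg0 (upd_box bx st)).
      exact: (GQ _ (upd_box bx st)).
  + exact: measurable_side.
  + exact: mup.
Qed.

(** Splitting the coordinates into J and its complement, H depends on the latter
    only, and the inner integral of |g| is almost everywhere at most the mixed
    envelope. The product of the lengths of the sides is what the coordinates of
    J contribute to the integral of H. *)
Lemma int_glue_bound (J : {set 'I_d}) g (H : 'rV[R]_d -> \bar R) :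
  bmeas g -> measurable_fun [set: 'rV[R]_d] H -> (forall x, 0 <= H x)%E ->
  (forall x y : 'rV[R]_d, (forall j, j \notin J -> x 0 j = y 0 j) -> H x = H y) ->
  ((\prod_(i in J) (b 0 i - a 0 i))%:E *
     \int[leb R d]_(x in box a b) (`|g x|%:E * H x) <=
   Lambda_mix a b J g * \int[leb R d]_(x in box a b) H x)%E.
Proof.
move=> bg mH H0 HJ.
have mg : measurable_fun [set: 'rV[R]_d] (fun x => `|g x|%:E : \bar R).
  by apply: bmeas_EFin; exact: bmeas_abs.
pose V := (\prod_(i in J) (b 0 i - a 0 i)).
have V0 : 0 < V by apply: prodr_gt0 => i _; exact: side_gt0.
set S := box (coords (~: J)%SET a) (coords (~: J)%SET b).
pose K (s : 'rV[R]_#|(~: J)%SET|) := (\int[leb R #|J|]_(t in box (coords J a) (coords J b))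
                `|g (glue_coords s t)|%:E)%E.
have K0 s : (0 <= K s)%E by apply: integral_ge0.
have mK : measurable_fun [set: 'rV[R]_#|(~: J)%SET|] K by apply: (@measurable_glue_int R d a b J _ mg).
have mHe : measurable_fun [set: 'rV[R]_#|(~: J)%SET|] (fun s => H (embed s)).
  exact: (measurableT_comp mH (@measurable_embed R d _)).
have HE (s : 'rV[R]_#|(~: J)%SET|) (t : 'rV[R]_#|J|) : H (glue_coords s t) = H (embed s).
  by apply: HJ => j jJ; rewrite /glue_coords mxE [embed t 0 j]embed_notin ?addr0//.
have E1 : (\int[leb R d]_(x in box a b) (`|g x|%:E * H x) =
    \int[leb R _]_(s in S) (H (embed s) * K s))%E.
  rewrite (int_box_glue a b J); last 2 first.
  - exact: emeasurable_funM.
  - by move=> x; rewrite mule_ge0.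
  apply: eq_integral => w _; rewrite -ge0_integralZl//.
  - by apply: eq_integral => u _; rewrite HE muleC.
  - exact: measurable_box.
  - apply: measurable_funTS; exact: (measurableT_comp mg (@measurable_glue1 R d J w)).
have E2 : (\int[leb R d]_(x in box a b) H x =
    V%:E * \int[leb R _]_(s in S) H (embed s))%E.
  rewrite (int_box_glue a b J mH H0) -ge0_integralZl//.
  - apply: eq_integral => w _.
    rewrite (eq_integral (cst (H (embed w)))); last by move=> u _; rewrite HE.
    rewrite integral_cst; last exact: measurable_box.
    rewrite muleC; congr (_ * _)%E.
    apply: etrans (leb_box _) _; first by move=> k; rewrite !mxE.
    congr EFin; rewrite /V (big_enum_val (fun i => b 0 i - a 0 i)).
    by apply: eq_bigr => k _; rewrite !mxE.
  - exact: measurable_box.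
  - exact: measurable_funTS.
  - by rewrite lee_fin ltW.
rewrite E1 E2 muleCA; apply: lee_wpmul2l; first by rewrite lee_fin ltW.
have L0 : (0 <= Lambda_mix a b J g)%E.
  rewrite /Lambda_mix -/K.
  have pos : (0 < lebS (coords (~: J)%SET a) (coords (~: J)%SET b) setT)%E.
    by apply: lebS_gt0 => k; rewrite !mxE.
  by rewrite -(ess_sup_cst (0%E : \bar R) pos); apply: le_ess_sup; apply: aeW.
rewrite -ge0_integralZl//; last 2 first.
- exact: measurable_box.
- exact: measurable_funTS.
apply: ae_ge0_le_integral => //.
- exact: measurable_box.
- by move=> s _; rewrite mule_ge0.
- by apply: measurable_funTS; exact: emeasurable_funM.
- by move=> s _; rewrite mule_ge0.
- by apply: measurable_funeM; exact: measurable_funTS.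
- have /ae_lebS := ess_sup_ge (lebS (coords (~: J)%SET a) (coords (~: J)%SET b)) K.
  apply: filterS => s Hs bs; rewrite muleC; apply: lee_wpmul2r => //; exact: Hs.
Qed.

(** The face deviations of f are bounded by an iterated integral of the mixed
    derivative, which depends on the coordinates outside I only; its integral
    over the box is that of the mixed derivative times the volume in the
    directions of I. *)
Lemma centered_mixed_bound (I : {set 'I_d}) g f : bmeas g -> Ck a b #|I| f ->
  (forall i, i \in I -> forall x, avg a b i g x = 0) ->
  (`| \int[leb R d]_(x in box a b) (g x * f x)%:E | <=
   (2 ^- #|I|)%:E * Lambda_mix a b I g * mixed_variation a b I f)%E.
Proof.
move=> bg Cf gc; pose s := enum I.
have sI : size s = #|I| by rewrite -cardE.
have us : uniq s by exact: enum_uniq.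
have cf := Ck_continuous Cf.
have [G [bG GE GQ]] : exists G, [/\ bmeas G, forall x, (box a b)° x -> partials s f x = G x
    & forall x, box a b x ->
      (`|face_devs (rev s) f x|%:E <= (2 ^- size s)%:E * side_ints (rev s) (fun y => `|G y|%:E) x)%E].
  by apply: Ck_face_devs => //; rewrite sI.
pose f0 := f \o clamp; have bf0 : bmeas f0 by exact: bmeas_clamp.
have ff0 y : box a b y -> f y = f0 y by move=> ?; rewrite /f0/= clamp_id.
set H := side_ints (rev s) (fun y => `|G y|%:E).
have mG : measurable_fun [set: 'rV[R]_d] (fun y => `|G y|%:E : \bar R).
  by apply: bmeas_EFin; exact: bmeas_abs.
have mg : measurable_fun [set: 'rV[R]_d] (fun x => `|g x|%:E : \bar R).
  by apply: bmeas_EFin; exact: bmeas_abs.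
have mH : measurable_fun [set: 'rV[R]_d] H by exact: measurable_side_ints.
have H0 y : (0 <= H y)%E by exact: side_ints_ge0.
have -> : mixed_variation a b I f = (\int[leb R d]_(x in box a b) `|G x|%:E)%E.
  transitivity (\int[leb R d]_(x in (box a b)°) `|G x|%:E)%E.
    by apply: eq_integral => x /set_mem xi; rewrite GE.
  have [N [mN N0 subN]] := ae_interior ab.
  rewrite (ge0_negligible_integral _ _ _ _ N0)//; last 2 first.
  - exact: measurable_interior_box.
  - exact: measurable_funTS.
  rewrite [RHS](ge0_negligible_integral _ _ _ _ N0)//; last 2 first.
  - exact: measurable_box.
  - exact: measurable_funTS.
  congr (integral _ _ _); apply/seteqP; split=> x [bx nN]; split=> //.
    exact: interior_subset bx.
  by apply: contrapT => xi; apply: nN; apply: subN => /= /(_ bx).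
have -> : (\int[leb R d]_(x in box a b) (g x * f x)%:E =
    (box_Rint a b (fun x => g x * f0 x))%:E)%E.
  rewrite EFin_box_Rint//; last exact: bmeasM.
  by apply: eq_integral => x /set_mem bx; rewrite ff0.
apply: le_trans (le_box_Rint_face_devs ab bg bf0 (s := rev s) _) _.
  by move=> i; rewrite mem_rev mem_enum; exact: gc.
have B1 : (\int[leb R d]_(x in box a b) (`|g x|%:E * `|face_devs (rev s) f0 x|%:E) <=
    (2 ^- #|I|)%:E * \int[leb R d]_(x in box a b) (`|g x|%:E * H x))%E.
  have p0 : (0 <= (2 ^- #|I|)%:E :> \bar R)%E by rewrite lee_fin invr_ge0 exprn_ge0.
  have mgH : measurable_fun (box a b) (fun x => `|g x|%:E * H x)%E.
    by apply: measurable_funTS; exact: emeasurable_funM.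
  rewrite -ge0_integralZl//; last 2 first.
  - exact: measurable_box.
  - by move=> x _; rewrite mule_ge0.
  apply: ge0_le_integral => //.
  - exact: measurable_box.
  - apply: measurable_funTS; apply: emeasurable_funM => //.
    by apply: bmeas_EFin; apply: bmeas_abs; exact: bmeas_face_devs.
  - exact: measurable_funeM.
  - move=> x bx; rewrite muleCA; apply: lee_wpmul2l => //.
    by rewrite -(face_devs_eq_box _ ff0 bx) -sI; exact: GQ.
apply: (le_trans B1); rewrite -muleA; apply: lee_wpmul2l.
  by rewrite lee_fin invr_ge0 exprn_ge0.
have V0 : 0 < \prod_(i in I) (b 0 i - a 0 i).
  by apply: prodr_gt0 => i _; exact: side_gt0.
have HA (x y : 'rV[R]_d) : (forall j, j \notin I -> x 0 j = y 0 j) -> H x = H y.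
  by move=> xy; apply: side_ints_agree => j; rewrite mem_rev mem_enum; exact: xy.
have := int_glue_bound bg mH H0 HA.
rewrite int_side_ints//.
have -> : \prod_(i <- rev s) (b 0 i - a 0 i) = \prod_(i in I) (b 0 i - a 0 i).
  by rewrite (perm_big s) ?perm_rev// big_enum.
by rewrite muleCA lee_pmul2l// lte_fin.
Qed.

End mixed.

(** * Smooth cut-offs of one variable *)

Section flat.
Variable R : realType.
Implicit Types (p : {poly R}) (x z t : R).

(** The constant p = 1 gives the usual smooth function that is flat at 0; a
    general p makes the family stable under differentiation. *)
Definition flat p z : R := if 0 < z then p.[z^-1] * expR (- z^-1) else 0.

Lemma flat_le0 p z : z <= 0 -> flat p z = 0.
Proof. by rewrite /flat leNgt => /negbTE ->. Qed.

Lemma poly_expR_bounded p : exists2 C, 0 <= C &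
  forall y, 0 <= y -> `|p.[y] * expR (- y)| <= C.
Proof.
exists (\sum_(i < size p) `|p`_i| * i`!%:R) => [|y y0].
  by apply: sumr_ge0 => i _; rewrite mulr_ge0.
rewrite horner_coef mulr_suml; apply: (le_trans (ler_norm_sum _ _ _)).
apply: ler_sum => i _; rewrite -mulrA normrM ler_wpM2l//.
rewrite ger0_norm; last by rewrite mulr_ge0 ?exprn_ge0// expR_ge0.
rewrite expRN ler_pdivrMr ?expR_gt0//.
case: (i : nat) => [|n].
  by rewrite expr0 fact0 mul1r (le_trans _ (expR_ge1Dx y))// lerDl.
have := expR_ge1Dxn n y0; have f0 : (0 : R) < n.+1`!%:R by rewrite ltr0n fact_gt0.
move=> H; rewrite mulrC -ler_pdivrMr// (le_trans _ H)// lerDr.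
by [].
Qed.

Lemma flat_bounded p : exists2 C, 0 <= C & forall z, `|flat p z| <= C.
Proof.
have [C C0 HC] := poly_expR_bounded p; exists C => // z; rewrite /flat.
by case: ifPn => [z0|_]; [apply: HC; rewrite invr_ge0 ltW|rewrite normr0].
Qed.

(** Used at 0, where it shows that the function and its difference quotient tend
    to 0. *)
Lemma flat_mulX p z : flat p z = z * flat (p * 'X) z.
Proof.
rewrite /flat; case: ifPn => [z0|_]; last by rewrite mulr0.
by rewrite hornerMX mulrCA mulrA mulfVK ?gt_eqF.
Qed.

Definition dflat p : {poly R} := (p - p^`()) * 'X^2.

Lemma is_derive_flat p x : is_derive x 1 (flat p) (flat (dflat p) x).
Proof.
have [x0|x0|x0] := ltgtP 0 x.
- have D : is_derive x 1 (fun z => p.[z^-1] * expR (- z^-1)) (flat (dflat p) x).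
    have xn0 : x != 0 by rewrite gt_eqF.
    have Dinv : is_derive x 1 (fun z : R => z^-1) (- x ^- 2).
      have := @is_deriveV R id x 1 1 xn0 (is_derive_id _ _).
      by rewrite /GRing.scale /= mulr1.
    have D1 := is_derive1_comp (is_derive_poly p x^-1) Dinv.
    have D2 := @is_derive1_comp R expR (fun z => - z^-1) x _ _ (is_derive_expR _) (is_deriveN Dinv).
    have D3 : is_derive x 1 (fun z => p.[z^-1] * expR (- z^-1)) _ := is_deriveM D1 D2.
    apply: (is_derive_eq D3); rewrite /GRing.scale /= /flat x0 /dflat.
    rewrite hornerM hornerD hornerN hornerXn exprVn; ring.
  apply: near_eq_is_derive D.
  have : nbhs x `]0, +oo[%classic.
    by apply: open_nbhs_nbhs; split; [exact: interval_open|rewrite /= in_itv/= x0].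
  by apply: filterS => z; rewrite /= in_itv/= andbT /flat => ->.
- rewrite flat_le0 ?ltW//.
  apply: near_eq_is_derive (is_derive_cst (0 : R) x 1).
  have : nbhs x `]-oo, 0[%classic.
    by apply: open_nbhs_nbhs; split; [exact: interval_open|rewrite /= in_itv/= x0].
  by apply: filterS => z; rewrite /= in_itv/= => z0; rewrite flat_le0// ltW.
- rewrite -x0 flat_le0//.
  have [C C0 HC] := flat_bounded (p * 'X * 'X).
  (* The difference quotient at 0 is h times the value at h of the bounded
     function with polynomial p X^2. *)
  have L : (fun h : R => h^-1 *: ((flat p \o shift 0) (h *: 1) - flat p 0)) @ 0^' --> (0 : R).
    apply/cvgrPdist_le => e e0; near=> h.
    have hn0 : h != 0 by near: h; exact: nbhs_dnbhs_neq.
    rewrite /= /GRing.scale/= mulr1 addr0 (flat_le0 p (lexx 0)) subr0 sub0r normrN.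
    rewrite flat_mulX mulKf// flat_mulX normrM.
    have he : `|h| <= e / (C + 1).
      near: h; apply: nbhs_dnbhs; apply/nbhs_normP; exists (e / (C + 1)) => /=.
        by rewrite divr_gt0// ltr_wpDl.
      by move=> z /=; rewrite sub0r normrN; exact: ltW.
    apply: (le_trans (ler_pM (normr_ge0 _) (normr_ge0 _) he (HC h))).
    rewrite -mulrA ler_piMr ?(ltW e0)// mulrC ler_pdivrMr ?ltr_wpDl//.
    by rewrite mul1r lerDl.
  split; first by apply/cvg_ex; exists 0; exact: L.
  by rewrite /derive; apply/cvg_lim => //; exact: Rhausdorff.
Unshelve. all: by end_near. Qed.

(** A class of functions of one variable that contains the cut-offs used below
    and the derivative of each of its members, so that all its members are
    smooth. *)
Inductive smooth1 : (R -> R) -> Prop :=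
| smooth1_aff al be : smooth1 (fun x => al * x + be)
| smooth1_flat p al be : smooth1 (fun x => flat p (al * x + be))
| smooth1_add u v : smooth1 u -> smooth1 v -> smooth1 (fun x => u x + v x)
| smooth1_mul u v : smooth1 u -> smooth1 v -> smooth1 (fun x => u x * v x).

Lemma smooth1_cst c : smooth1 (fun=> c).
Proof.
have := smooth1_aff 0 c; rewrite (_ : (fun x => 0 * x + c) = fun=> c)//.
by apply/funext => x; rewrite mul0r add0r.
Qed.

Lemma is_derive_aff al be x : is_derive x 1 (fun x : R => al * x + be) al.
Proof.
have D1 : is_derive x 1 (fun x : R => al * x) al.
  have := is_deriveZ al (@is_derive_id R R x 1).
  by rewrite /GRing.scale/= mulr1.
have := is_deriveD D1 (is_derive_cst be x 1); by rewrite addr0.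
Qed.

Lemma smooth1_derive u : smooth1 u ->
  exists2 v, smooth1 v & forall x, is_derive x 1 u (v x).
Proof.
elim=> {u}.
- move=> al be; exists (fun=> al); first exact: smooth1_cst.
  by move=> x; exact: is_derive_aff.
- move=> p al be; exists (fun x => flat (dflat p) (al * x + be) * al).
    by apply: smooth1_mul; [exact: smooth1_flat|exact: smooth1_cst].
  move=> x; exact: (@is_derive1_comp R (flat p) (fun x => al * x + be) x _ _
    (is_derive_flat p _) (is_derive_aff al be x)).
- move=> u v su [u' su' uu'] sv [v' sv' vv'].
  exists (fun x => u' x + v' x); first exact: smooth1_add.
  by move=> x; exact: (is_deriveD (uu' x) (vv' x)).
- move=> u v su [u' su' uu'] sv [v' sv' vv'].
  exists (fun x => u x * v' x + v x * u' x).
    by apply: smooth1_add; exact: smooth1_mul.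
  by move=> x; exact: (is_deriveM (uu' x) (vv' x)).
Qed.

Lemma smooth1_continuous u : smooth1 u -> continuous u.
Proof.
move=> /smooth1_derive[v _ uv] x; apply: differentiable_continuous.
by apply/derivable1_diffP; have [] := uv x.
Qed.

End flat.

Section bumps.
Variable R : realType.
Implicit Types (p q t x : R) (n : nat).

(** A smooth step that vanishes for t <= p + 1 / (n + 1) and tends to 1 for t >
    p when r = 1; [rstep] is its mirror image at q. The affine arguments are
    expanded so as to be instances of [smooth1_flat]. *)
Definition lstep (r : {poly R}) p n t : R := flat r (n.+1%:R * t + (- (n.+1%:R * p) - 1)).
Definition rstep (r : {poly R}) q n t : R := flat r (- n.+1%:R * t + (n.+1%:R * q - 1)).
Definition plateau p q n t : R := lstep 1 p n t * rstep 1 q n t.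
(** A smooth approximation of the product of the positive parts of t - p and q -
    t, with support inside the open interval. *)
Definition quad p q n t : R := (t - p) * (q - t) * plateau p q n t.
(** The derivative of a step is a multiple of n + 1. The factor t - p, which is
    (z + 1) / (n + 1) in the variable z of the step, absorbs it, and this
    polynomial is what remains of the derivative. *)
Definition dflat_cofactor : {poly R} := 'X + 'X^2.
(** The terms are grouped so that boundedness, uniform in n, can be read off. *)
Definition dquad p q n t : R :=
  (p + q - 2 * t) * plateau p q n t
  + (q - t) * (lstep dflat_cofactor p n t * rstep 1 q n t)
  - (t - p) * (lstep 1 p n t * rstep dflat_cofactor q n t).

Lemma lstepE r p n t : lstep r p n t = flat r (n.+1%:R * (t - p) - 1).
Proof. by rewrite /lstep mulrBr addrA. Qed.

Lemma rstepE r q n t : rstep r q n t = flat r (n.+1%:R * (q - t) - 1).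
Proof. by rewrite /rstep mulrBr mulNr addrA (addrC (- _)). Qed.

Lemma flat1_ge0 z : 0 <= flat (1 : {poly R}) z.
Proof. by rewrite /flat; case: ifP => // _; rewrite hornerE mul1r expR_ge0. Qed.

Lemma flat1_le1 z : flat (1 : {poly R}) z <= 1.
Proof.
rewrite /flat; case: ifP => // z0; rewrite hornerE mul1r expR_le1 oppr_le0.
by rewrite invr_ge0 ltW.
Qed.

Lemma norm_flat1 z : `|flat (1 : {poly R}) z| <= 1.
Proof. by rewrite ger0_norm ?flat1_ge0 ?flat1_le1. Qed.

Lemma smooth1_plateau p q n : smooth1 (plateau p q n).
Proof. by apply: smooth1_mul; exact: smooth1_flat. Qed.

Lemma smooth1_quad p q n : smooth1 (quad p q n).
Proof.
apply: smooth1_mul; last exact: smooth1_plateau.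
apply: smooth1_mul.
  have := smooth1_aff 1 (- p); congr smooth1; apply/funext => t; by rewrite mul1r.
have := smooth1_aff (-1) q; congr smooth1; apply/funext => t; by rewrite mulN1r addrC.
Qed.

Lemma flat_dflat_cofactor z : (z + 1) * flat 'X^2 z = flat dflat_cofactor z.
Proof.
rewrite /flat; case: ifPn => [z0|_]; last by rewrite mulr0.
rewrite /dflat_cofactor hornerD hornerX !hornerXn mulrA; congr (_ * _).
by field; rewrite gt_eqF.
Qed.

Lemma is_derive_quad p q n t : is_derive t 1 (quad p q n) (dquad p q n t).
Proof.
have D1 := is_derive_aff 1 (- p) t.
have D2 := is_derive_aff (-1) q t.
have d1 : dflat (1 : {poly R}) = 'X^2 by rewrite /dflat derivC subr0 mul1r.
have E1 := @is_derive1_comp R (flat 1) (fun x => n.+1%:R * x + (- (n.+1%:R * p) - 1)) t _ _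
    (is_derive_flat 1 _) (is_derive_aff _ _ t).
have E2 := @is_derive1_comp R (flat 1) (fun x => - n.+1%:R * x + (n.+1%:R * q - 1)) t _ _
    (is_derive_flat 1 _) (is_derive_aff _ _ t).
have F : quad p q n = (fun x => (1 * x - p) * (-1 * x + q) * plateau p q n x).
  by apply/funext => x; rewrite /quad mul1r mulN1r (addrC (- x)).
have D : is_derive t 1 (fun x => (1 * x - p) * (-1 * x + q) * plateau p q n x) _ :=
  is_deriveM (is_deriveM D1 D2) (is_deriveM E1 E2).
rewrite F; apply: (is_derive_eq D); rewrite /GRing.scale /= d1 /dquad /lstep /rstep -!flat_dflat_cofactor.
rewrite /plateau /lstep /rstep !fctE /=.
set z1 := n.+1%:R * t + _; set z2 := - n.+1%:R * t + _.
have z1E : z1 + 1 = n.+1%:R * (t - p) by rewrite /z1; ring.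
have z2E : z2 + 1 = n.+1%:R * (q - t) by rewrite /z2; ring.
rewrite z1E z2E; ring.
Qed.

Lemma plateau_support p q n t : plateau p q n t != 0 ->
  p + n.+1%:R^-1 <= t <= q - n.+1%:R^-1.
Proof.
have n0 : (0 : R) < n.+1%:R by rewrite ltr0n.
rewrite /plateau mulf_eq0 negb_or lstepE rstepE => /andP[h1 h2].
have K z : flat (1 : {poly R}) z != 0 -> 0 < z.
  by rewrite ltNge; apply: contra => /flat_le0 ->.
move/K: h1; move/K: h2; rewrite !subr_gt0 => h2 h1.
have G x : 1 < n.+1%:R * x -> n.+1%:R^-1 < x.
  by move=> h; rewrite -[_^-1]mul1r ltr_pdivrMr// mulrC.
move: (G _ h1) (G _ h2); move: (n.+1%:R^-1 : R) => m h3 h4.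
by apply/andP; split; lra.
Qed.

Lemma plateau_bound p q n t : `|plateau p q n t| <= 1.
Proof.
rewrite /plateau normrM -[leRHS]mulr1 ler_pM//; exact: norm_flat1.
Qed.

Lemma quad_bound p q n t (c e : R) : c <= p <= e -> c <= q <= e -> c <= t <= e ->
  `|quad p q n t| <= (e - c) * (e - c).
Proof.
move=> /andP[? ?] /andP[? ?] /andP[? ?]; rewrite /quad normrM [X in X * _]normrM.
have h1 : `|t - p| <= e - c by apply/ler_normlP; split; lra.
have h2 : `|q - t| <= e - c by apply/ler_normlP; split; lra.
have ec0 : 0 <= e - c by lra.
rewrite -[leRHS]mulr1; apply: ler_pM; [by rewrite mulr_ge0|by []|by apply: ler_pM|exact: plateau_bound].
Qed.

Lemma dquad_bound (c e : R) : exists M, forall p q n t,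
  c <= p <= e -> c <= q <= e -> c <= t <= e -> `|dquad p q n t| <= M.
Proof.
have [C C0 HC] := flat_bounded dflat_cofactor.
exists (2 * (e - c) + (e - c) * C + (e - c) * C) => p q n t.
move=> /andP[? ?] /andP[? ?] /andP[? ?].
have h1 : `|t - p| <= e - c by apply/ler_normlP; split; lra.
have h2 : `|q - t| <= e - c by apply/ler_normlP; split; lra.
have h3 : `|p + q - 2 * t| <= 2 * (e - c) by apply/ler_normlP; split; lra.
rewrite /dquad; apply: (le_trans (ler_normB _ _)); apply: lerD.
  apply: (le_trans (ler_normD _ _)); apply: lerD.
    by rewrite normrM -[leRHS]mulr1 ler_pM//; exact: plateau_bound.
  rewrite normrM ler_pM// normrM -[leRHS]mulr1 ler_pM//; [exact: HC|exact: norm_flat1].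
rewrite normrM ler_pM// normrM -[leRHS]mul1r ler_pM//; [exact: norm_flat1|exact: HC].
Qed.

(** The argument tends to infinity when x > 0, so its inverse tends to 0. *)
Lemma flat_cvg (r : {poly R}) x :
  flat r (n.+1%:R * x - 1) @[n --> \oo] --> (if 0 < x then r.[0] else 0).
Proof.
case: ifPn => [x0|]; last first.
  rewrite -leNgt => x0; apply: cvg_near_cst; apply: nearW => n.
  by rewrite flat_le0// subr_le0 (le_trans _ ler01)// mulr_ge0_le0.
have zoo : (n.+1%:R * x - 1) @[n --> \oo] --> +oo.
  apply/cvgryPge => A; near=> n.
  rewrite lerBrDr -ler_pdivrMr//.
  have : (A + 1) / x <= n%:R by near: n; exact: nbhs_infty_ger.
  by move=> /le_trans; apply; rewrite ler_nat.
have zpos : \forall n \near \oo, 0 < n.+1%:R * x - 1 by move/cvgryPgt : zoo; exact.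
have y0 : (n.+1%:R * x - 1)^-1 @[n --> \oo] --> (0 : R).
  by rewrite (gtr0_cvgV0 zpos).
pose g (y : R) := r.[y] * expR (- y).
have cg : {for 0, continuous g}.
  have DN : is_derive (0 : R) (1 : R) (fun z : R => - z) (- 1) by exact: is_deriveNid.
  have DE := @is_derive1_comp R expR (fun z => - z) 0 _ _ (is_derive_expR _) DN.
  have D : is_derive (0 : R) (1 : R) g _ := is_deriveM (is_derive_poly r 0) DE.
  by apply: differentiable_continuous; apply/derivable1_diffP; case: D.
have H : g ((n.+1%:R * x - 1)^-1) @[n --> \oo] --> g 0 by exact: (cvg_comp _ _ y0 cg).
have g0 : g 0 = r.[0] by rewrite /g oppr0 expR0 mulr1.
rewrite g0 in H; apply: cvg_trans H; apply: near_eq_cvg.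
near=> n; rewrite /flat /g ifT//.
by near: n.
Unshelve. all: by end_near. Qed.

Lemma lstep_cvg r p t : lstep r p n t @[n --> \oo] --> (if p < t then r.[0] else 0).
Proof.
rewrite -subr_gt0; under eq_fun do rewrite lstepE; exact: flat_cvg.
Qed.

Lemma rstep_cvg r q t : rstep r q n t @[n --> \oo] --> (if t < q then r.[0] else 0).
Proof.
rewrite -subr_gt0; under eq_fun do rewrite rstepE; exact: flat_cvg.
Qed.

Lemma plateau_cvg p q t : plateau p q n t @[n --> \oo] --> ((p < t < q)%R%:R : R).
Proof.
have -> : ((p < t < q)%R%:R : R) = (if p < t then (1 : {poly R}).[0] else 0) *
    (if t < q then (1 : {poly R}).[0] else 0).
  by rewrite hornerE; case: (p < t); case: (t < q); rewrite ?mulr1 ?mulr0.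
by apply: cvgM; [exact: lstep_cvg|exact: rstep_cvg].
Qed.

Lemma quad_cvg p q t :
  quad p q n t @[n --> \oo] --> (t - p) * (q - t) * (p < t < q)%R%:R.
Proof. by apply: cvgM; [exact: cvg_cst|exact: plateau_cvg]. Qed.

Lemma dquad_cvg p q t :
  dquad p q n t @[n --> \oo] --> (p + q - 2 * t) * (p < t < q)%R%:R.
Proof.
have k0 : dflat_cofactor.[0] = 0 by rewrite /dflat_cofactor hornerD hornerX hornerXn expr0n addr0.
have L : lstep dflat_cofactor p n t @[n --> \oo] --> (0 : R).
  by have := @lstep_cvg dflat_cofactor p t; rewrite k0 if_same.
have Rr : rstep dflat_cofactor q n t @[n --> \oo] --> (0 : R).
  by have := @rstep_cvg dflat_cofactor q t; rewrite k0 if_same.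
have -> : (p + q - 2 * t) * (p < t < q)%R%:R = (p + q - 2 * t) * (p < t < q)%R%:R
    + (q - t) * (0 * (if t < q then (1 : {poly R}).[0] else 0))
    - (t - p) * ((if p < t then (1 : {poly R}).[0] else 0) * 0).
  by rewrite mul0r !mulr0 addr0 subr0.
apply: cvgB.
  apply: cvgD.
    by apply: cvgM; [exact: cvg_cst|exact: plateau_cvg].
  by apply: cvgM; [exact: cvg_cst|apply: cvgM; [exact: L|exact: rstep_cvg]].
by apply: cvgM; [exact: cvg_cst|apply: cvgM; [exact: lstep_cvg|exact: Rr]].
Qed.

End bumps.

(** * Product test functions *)

Section test.
Variables (R : realType) (d : nat).
Implicit Types (u v : 'I_d -> R -> R) (x : 'rV[R]_d).

Definition prodf u (x : 'rV[R]_d) : R := \prod_j u j (x 0 j).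

(** Along the i-th axis a product function is a multiple of its i-th factor. *)
Lemma is_derive_prodf u i l x : is_derive (x 0 i) 1 (u i) l ->
  is_derive x (delta_mx 0 i) (prodf u) ((\prod_(j | j != i) u j (x 0 j)) * l).
Proof.
move=> uil; pose c := \prod_(j | j != i) u j (x 0 j).
have [D0 D1] : is_derive (x 0 i) 1 (fun t => c * u i t) (c * l).
  exact: (is_deriveZ c uil).
have E : (fun h : R => h^-1 *: ((prodf u \o shift x) (h *: delta_mx 0 i) - prodf u x)) =
    (fun h : R => h^-1 *: (((fun t => c * u i t) \o shift (x 0 i)) (h *: 1) - c * u i (x 0 i))).
  apply/funext => h; congr (_ *: (_ - _)).
    rewrite /= /prodf (bigD1 i)//= mulrC !mxE !eqxx mulr1 /GRing.scale/= mulr1.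
    congr (_ * _); apply: eq_bigr => j ji; rewrite !mxE eqxx /= (negbTE ji).
    by rewrite mulr0 add0r.
  by rewrite /prodf (bigD1 i)//= mulrC.
by split; [move: D0; rewrite /derivable E|rewrite -D1 /derive E].
Qed.

Lemma prodf_partial u i : (forall j, smooth1 (u j)) ->
  exists2 v, (forall j, smooth1 (v j)) &
    forall x, is_derive x (delta_mx 0 i) (prodf u) (prodf v x).
Proof.
move=> su; have [ui' sui' Hui'] := smooth1_derive (su i).
exists (fun j => if j == i then ui' else u j).
  by move=> j; case: ifP.
move=> x; have := is_derive_prodf (Hui' (x 0 i)); congr is_derive.
rewrite /prodf [RHS](bigD1 i)//= eqxx mulrC; congr (_ * _).
by apply: eq_bigr => j /negbTE ->.
Qed.

Lemma partial_prodf u i : (forall j, smooth1 (u j)) ->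
  exists2 v, (forall j, smooth1 (v j)) & partial i (prodf u) = prodf v.
Proof.
move=> su; have [v sv uv] := prodf_partial i su; exists v => //.
by apply/funext => x; have [_ <-] := uv x.
Qed.

Lemma partials_prodf s u : (forall j, smooth1 (u j)) ->
  exists2 v, (forall j, smooth1 (v j)) & partials s (prodf u) = prodf v.
Proof.
move=> su; elim: s => [|i s [v sv vE]]; first by exists u.
rewrite /partials /= -/(partials s (prodf u)) vE.
exact: partial_prodf.
Qed.

Lemma continuous_prodf u : (forall j, smooth1 (u j)) -> continuous (prodf u).
Proof.
move=> su; rewrite /prodf.
suff H r : continuous (fun x : 'rV[R]_d => \prod_(j <- r) u j (x 0 j)) by exact: H.
elim: r => [|j r IH].
  have -> : (fun x : 'rV[R]_d => \prod_(j <- [::]) u j (x 0 j)) = cst 1.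
    by apply/funext => x; rewrite big_nil.
  exact: cst_continuous.
have -> : (fun x : 'rV[R]_d => \prod_(k <- j :: r) u k (x 0 k)) =
    (fun x : 'rV[R]_d => u j (x 0 j) * \prod_(k <- r) u k (x 0 k)).
  by apply/funext => x; rewrite big_cons.
move=> x; have C : {for x, continuous (u j \o (fun y : 'rV[R]_d => y 0 j))}.
  apply: continuous_comp; first exact: coord_continuous.
  by apply: smooth1_continuous.
exact: (cvgM C (IH x)).
Qed.

Variables (a b : 'rV[R]_d).

Lemma test_prodf u (l r : 'rV[R]_d) : (forall j, smooth1 (u j)) ->
  (forall j, a 0 j < l 0 j) -> (forall j, r 0 j < b 0 j) ->
  (forall j t, u j t != 0 -> l 0 j <= t <= r 0 j) ->
  test_function (box a b)° (prodf u).
Proof.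
move=> su al rb ul.
have sub : closure [set x | prodf u x != 0] `<=` box l r.
  have cb : closed (box l r).
    by apply: compact_closed; [exact: norm_hausdorff|exact: compact_box].
  rewrite [X in _ `<=` X](_ : _ = closure (box l r)); last exact: ((closure_id _).1 cb).
  apply: closure_subset => x /=; move=> /prodf_neq0 H j.
  by apply: ul; exact: H.
split.
- by move=> s; have [v sv ->] := partials_prodf s su; exact: continuous_prodf.
- move=> s i x; have [v sv ->] := partials_prodf s su.
  by have [w _ vw] := prodf_partial i sv; have [] := vw x.
- apply: (subclosed_compact _ (@compact_box _ _ l r)) sub; exact: closed_closure.
- move=> x /sub; rewrite interior_box => H i /=; have /andP[h1 h2] := H i.
  by rewrite (lt_le_trans (al i))// (le_lt_trans h2).
Qed.

End test.

(** * Integration by parts against the derivative measure *)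

Section weak_pair.
Variables (R : realType) (d : nat) (a b : 'rV[R]_d).
Hypothesis ab : forall i, a 0 i < b 0 i.
Notation S := ((box a b)°).
Notation clamp := (clamp a b).
Variables (f : 'rV[R]_d -> R).
Hypothesis fi : (leb R d).-integrable (box a b) (EFin \o f).
Variable (i : 'I_d) (nu : {charge set 'rV[R]_d -> \bar R}).
Hypothesis fnu : is_Dmeasure a b f i nu.
Implicit Types (p q : 'rV[R]_d -> R).

(** Up to sign, the two sides of the formula of integration by parts that
    defines the derivative measure of f, as functions of an arbitrary bounded
    measurable integrand. *)
Definition density_int p : R := \int[leb R d]_(x in S) (f x * p x).
Definition charge_Rint q : R := \int[jordan_pos (hahn nu)]_(x in S) q x
                     - \int[jordan_neg (hahn nu)]_(x in S) q x.
(** The formula of integration by parts holds for q, with p in the role of its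
    i-th derivative. Keeping p and q as separate arguments lets the formula pass
    to limits in which q is no longer differentiable. *)
Definition weak_pair p q := density_int p = - charge_Rint q.

Let mS : measurable S := measurable_interior_box a b.

Let fiS : (leb R d).-integrable S (EFin \o f).
Proof.
by apply: integrableS fi => //; [exact: measurable_box|exact: interior_subset].
Qed.

Lemma mulf_integrable p : bmeas p -> (leb R d).-integrable S (EFin \o (fun x => f x * p x)).
Proof.
move=> bp; have := bmeas_mul_integrable mS bp fiS.
by apply: eq_integrable => // x _; rewrite /= mulrC.
Qed.

Lemma jp_integrable q : bmeas q -> (jordan_pos (hahn nu)).-integrable S (EFin \o q).
Proof.
move=> bq; apply: bmeas_integrable => //; rewrite -ge0_fin_numE//.
exact: fin_num_measure.
Qed.

Lemma jn_integrable q : bmeas q -> (jordan_neg (hahn nu)).-integrable S (EFin \o q).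
Proof.
move=> bq; apply: bmeas_integrable => //; rewrite -ge0_fin_numE//.
exact: fin_num_measure.
Qed.

Lemma weak_pair_eq p q p' q' : (forall x, S x -> p x = p' x) -> (forall x, S x -> q x = q' x) ->
  weak_pair p q -> weak_pair p' q'.
Proof.
move=> pp qq; rewrite /weak_pair => H.
have -> : density_int p' = density_int p by apply: eq_Rintegral => x /set_mem Sx; rewrite pp.
have -> // : charge_Rint q' = charge_Rint q.
by congr (_ - _); apply: eq_Rintegral => x /set_mem Sx; rewrite qq.
Qed.

Lemma weak_pair_test u (l r : 'rV[R]_d) : (forall j, smooth1 (u j)) ->
  (forall j, a 0 j < l 0 j) -> (forall j, r 0 j < b 0 j) ->
  (forall j t, u j t != 0 -> l 0 j <= t <= r 0 j) ->
  weak_pair (partial i (prodf u) \o clamp) (prodf u \o clamp).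
Proof.
move=> su al rb ul; have tu := test_prodf su al rb ul.
have [v sv vE] := partial_prodf i su.
have bp : bmeas (partial i (prodf u) \o clamp).
  by rewrite vE; apply: bmeas_clamp => //; apply: continuous_subspaceT; exact: continuous_prodf.
have bq : bmeas (prodf u \o clamp).
  by apply: bmeas_clamp => //; apply: continuous_subspaceT; exact: continuous_prodf.
have := fnu tu; rewrite /charge_integral.
have cl x : S x -> clamp x = x by move=> /interior_subset /clamp_id.
rewrite (eq_integral (fun x => (f x * (partial i (prodf u) \o clamp) x)%:E)); last first.
  by move=> x /set_mem Sx; rewrite /= cl.
rewrite (eq_integral (EFin \o (prodf u \o clamp)) (EFin \o prodf u)); last first.
  by move=> x /set_mem Sx; rewrite /= cl.
rewrite (eq_integral (EFin \o (prodf u \o clamp)) (EFin \o prodf u)); last first.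
  by move=> x /set_mem Sx; rewrite /= cl.
move=> H; rewrite /weak_pair /density_int /charge_Rint /Rintegral H fineN fineB//.
  by apply: integrable_fin_num => //; exact: jp_integrable.
by apply: integrable_fin_num => //; exact: jn_integrable.
Qed.

Lemma density_intD p q : bmeas p -> bmeas q -> density_int (fun x => p x + q x) = density_int p + density_int q.
Proof.
move=> bp bq; rewrite /density_int; under eq_Rintegral do rewrite mulrDr.
by apply: RintegralD => //; exact: mulf_integrable.
Qed.

Lemma density_intZ c p : bmeas p -> density_int (fun x => c * p x) = c * density_int p.
Proof.
move=> bp; rewrite /density_int; under eq_Rintegral do rewrite mulrCA.
by apply: RintegralZl => //; exact: mulf_integrable.
Qed.

Lemma charge_RintD p q : bmeas p -> bmeas q -> charge_Rint (fun x => p x + q x) = charge_Rint p + charge_Rint q.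
Proof.
move=> bp bq; rewrite /charge_Rint !RintegralD//; try exact: jp_integrable; try exact: jn_integrable.
ring.
Qed.

Lemma charge_RintZ c p : bmeas p -> charge_Rint (fun x => c * p x) = c * charge_Rint p.
Proof.
move=> bp; rewrite /charge_Rint !RintegralZl//; try exact: jp_integrable; try exact: jn_integrable.
ring.
Qed.

Lemma weak_pair_lin c p q p' q' : bmeas p -> bmeas q -> bmeas p' -> bmeas q' ->
  weak_pair p q -> weak_pair p' q' -> weak_pair (fun x => c * p x + p' x) (fun x => c * q x + q' x).
Proof.
rewrite /weak_pair => bp bq bp' bq' H H'.
have bc : bmeas (fun _ : 'rV[R]_d => c) by exact: bmeas_cst.
rewrite (@density_intD (fun x => c * p x)) ?(@charge_RintD (fun x => c * q x))//; try exact: bmeasM.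
rewrite density_intZ// charge_RintZ// H H'; ring.
Qed.

Lemma W0 : weak_pair (fun=> 0) (fun=> 0).
Proof.
rewrite /weak_pair /density_int /charge_Rint; under eq_Rintegral do rewrite mulr0.
by rewrite !Rintegral_cst// !mul0r subrr oppr0.
Qed.

(** Dominated convergence on both sides. The convergence of the derivatives p
    may fail on a Lebesgue null set, but that of the antiderivatives q is
    required everywhere, because the derivative measure may charge null sets. *)
Lemma weak_pair_lim (p_ q_ : nat -> 'rV[R]_d -> R) p q M :
  (forall n, bmeas (p_ n)) -> (forall n, bmeas (q_ n)) -> bmeas p -> bmeas q ->
  (forall n x, S x -> `|p_ n x| <= M) -> (forall n x, S x -> `|q_ n x| <= M) ->
  {ae leb R d, forall x, S x -> p_ n x @[n --> \oo] --> p x} ->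
  (forall x, S x -> q_ n x @[n --> \oo] --> q x) ->
  (forall n, weak_pair (p_ n) (q_ n)) -> weak_pair p q.
Proof.
move=> bp_ bq_ bp bq pM qM pc qc HW.
have mfS : measurable_fun S f by apply/measurable_EFinP; exact: (measurable_int _ fiS).
have mT g : bmeas g -> measurable_fun S g by move=> [mg _]; exact: measurable_funTS.
have L : density_int (p_ n) @[n --> \oo] --> density_int p.
  apply: (@dominated_convergence_Rint _ _ _ _ _ _ _ (fun x => `|f x| * M)) => //.
  - by move=> n; apply: measurable_funM => //; exact: mT.
  - by apply: measurable_funM => //; exact: mT.
  - have := integrableZr mS M (integrable_abse fiS).
    by apply: eq_integrable.
  - by move=> n x Sx; rewrite normrM ler_wpM2l// pM.
  - by apply: filterS pc => x H Sx; apply: cvgM; [exact: cvg_cst|exact: H].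
have MM : charge_Rint (q_ n) @[n --> \oo] --> charge_Rint q.
  apply: cvgB; apply: (bounded_convergence_Rint (M := M)) => //.
  - by rewrite -ge0_fin_numE//; exact: fin_num_measure.
  - by move=> n; exact: mT.
  - exact: mT.
  - exact: aeW.
  - by rewrite -ge0_fin_numE//; exact: fin_num_measure.
  - by move=> n; exact: mT.
  - exact: mT.
  - exact: aeW.
rewrite /weak_pair; apply: (cvg_unique _ L); first exact: Rhausdorff.
have -> : (fun n => density_int (p_ n)) = (fun n => - charge_Rint (q_ n)) by apply/funext => n; exact: HW.
exact: cvgN.
Qed.

Lemma charge_Rint_bound q c : bmeas q -> (forall x, S x -> `|q x| <= c) ->
  (`|charge_Rint q|%:E <= c%:E * charge_tv nu S)%E.
Proof.
move=> bq qc.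
have fp : jordan_pos (hahn nu) S \is a fin_num by exact: fin_num_measure.
have fn : jordan_neg (hahn nu) S \is a fin_num by exact: fin_num_measure.
rewrite /charge_tv /charge_variation /=.
rewrite -[X in (_ <= _ * (X + _))%E](fineK fp) -[X in (_ <= _ * (_ + X))%E](fineK fn).
rewrite -EFinD -EFinM lee_fin /charge_Rint mulrDr.
have K (m : {measure set 'rV[R]_d -> \bar R}) : m.-integrable S (EFin \o q) ->
    m S \is a fin_num -> `|\int[m]_(x in S) q x| <= c * fine (m S).
  move=> mq mfin; apply: (le_trans (le_normr_Rintegral mS mq)).
  rewrite -Rintegral_cst//; apply: le_Rintegral => //.
    by have := integrable_abse mq; apply: eq_integrable.
  apply: bmeas_integrable => //; last exact: bmeas_cst.
  by rewrite -ge0_fin_numE.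
apply: (le_trans (ler_normB _ _)); apply: lerD; apply: K => //.
  exact: jp_integrable.
exact: jn_integrable.
Qed.

End weak_pair.

(** * The functional monotone class theorem and the lower orthants *)

(** Counting the integers k + 1 below y recovers y up to 1: the staircase
    approximation of a function by the indicators of its superlevel sets. *)
Lemma sum_ltn_truncn (R : realType) (K : nat) (y : R) : 0 <= y -> y <= K%:R ->
  `|\sum_(k < K) (k.+1%:R <= y)%R%:R - y| <= 1.
Proof.
move=> y0 yK.
have H n : \sum_(k < n) (k.+1%:R <= y)%R%:R = (minn n (Num.truncn y))%:R :> R.
  elim: n => [|n IH]; first by rewrite big_ord0 min0n.
  rewrite big_ord_recr /= IH -truncn_ge_nat//.
  case: (leqP n.+1 (Num.truncn y)) => h.
    by rewrite (minn_idPl (ltnW h)) natr1.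
  by rewrite (minn_idPr _) ?addr0.
rewrite H (minn_idPr _); last by rewrite -(ler_nat R) (le_trans _ yK)// truncn_le.
have h1 : (Num.truncn y)%:R <= y by rewrite truncn_le.
have h2 := truncnS_gt y.
rewrite -natr1 in h2; rewrite ler_norml; apply/andP; split; lra.
Qed.

Section monotone_class.
Context (R : realType) (dT : measure_display) (T : measurableType dT).
Variables (G : set (set T)) (H : (T -> R) -> Prop).
Hypothesis mG : @measurable _ T = <<s G >>.
Hypothesis GI : setI_closed G.
Hypothesis H1 : H (fun=> 1).
Hypothesis HG : forall A, G A -> H (\1_A).
Hypothesis Hlin : forall c h h', H h -> H h' -> H (fun x => c * h x + h' x).
Hypothesis Hlim : forall (h_ : nat -> T -> R) (h : T -> R) M, (forall n, H (h_ n)) ->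
  measurable_fun [set: T] h ->
  (forall n x, `|h_ n x| <= M) -> (forall x, h_ n x @[n --> \oo] --> h x) -> H h.

Let H0 : H (fun=> 0).
Proof.
have := Hlin (-1) H1 H1; congr H; by apply/funext => x; rewrite mulr1 addNr.
Qed.

Let Hsum (I : Type) (r : seq I) (F : I -> T -> R) : (forall i, H (F i)) ->
  H (fun x => \sum_(i <- r) F i x).
Proof.
move=> HF; elim: r => [|i r IH].
  by move: H0; congr H; apply/funext => x; rewrite big_nil.
have := Hlin 1 (HF i) IH; congr H; apply/funext => x.
by rewrite mul1r big_cons.
Qed.

Let Hind A : measurable A -> H (\1_A).
Proof.
move=> mA; move: (mA); rewrite mG; move: A {mA}.
apply: (@dynkin_induction _ T G (fun A => H (\1_A)) mG GI) => //.
- by move: H1; congr H; apply/funext => x; rewrite indicE in_setT.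
- move=> S mS HS; have := Hlin (-1) HS H1; congr H; apply/funext => x.
  by rewrite !indicE in_setC; case: (x \in S) => /=; rewrite ?mulr1 ?mulr0 ?addNr ?add0r.
- move=> F mF tF HF.
  have E n x : \sum_(k < n) \1_(F k) x = \1_(\bigcup_(k in `I_n) F k) x :> R.
    elim: n => [|n IH]; first by rewrite big_ord0 II0 bigcup_set0 indicE in_set0.
    rewrite big_ord_recr /= IH !indicE IIS bigcup_setU bigcup_set1 in_setU.
    case: (boolP (x \in F n)) => [/set_mem xn|_]; last by rewrite orbF addr0.
    rewrite memNset; first by rewrite add0r.
    move=> [k /= kn Fk]; have := @tF k n I I; rewrite -[_ = _]/(_ = _).
    by move=> /(_ (ex_intro _ x (conj Fk xn))) kE; move: kn; rewrite kE ltnn.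
  apply: (@Hlim (fun n x => \sum_(k < n) \1_(F k) x) _ 1).
  + by move=> n; apply: Hsum => k; exact: HF.
  + by apply: measurable_indic; exact: bigcupT_measurable.
  + by move=> n x; rewrite E indicE; case: (_ \in _); rewrite ?normr1 ?normr0.
  + move=> x; under eq_fun do rewrite E.
    have [[k _ Fk]|nF] := pselect ((\bigcup_k F k) x).
      apply: cvg_near_cst; exists k.+1 => // n /= kn.
      rewrite !indicE !mem_set//; first by exists k.
      by exists k => //; exact: kn.
    apply: cvg_near_cst; apply: nearW => n.
    rewrite !indicE !memNset// => -[k _ Fk]; apply: nF; by exists k.
Qed.

(** Dynkin's theorem puts the indicators of all measurable sets into H, and a
    bounded function is a uniform limit of combinations of indicators of its
    superlevel sets. *)
Lemma monotone_class_bounded g : bmeas g -> H g.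
Proof.
move=> [mg [M gM]].
(* The shifted function h is nonnegative, and h_ n is its staircase with steps
   of height 1 / (n + 1). *)
pose M1 := Num.max M 0; pose h x := g x + M1.
have M10 : 0 <= M1 by rewrite le_max lexx orbT.
have gM1 x : `|g x| <= M1 by rewrite (le_trans (gM x))// le_max lexx.
have h0 x : 0 <= h x by rewrite /h -lerBlDr sub0r; have := gM1 x; rewrite ler_norml => /andP[].
have hM x : h x <= 2 * M1 by rewrite /h mulr2n mulrDl mul1r lerD2r; have := gM1 x; rewrite ler_norml => /andP[].
have mh : measurable_fun [set: T] h by exact: measurable_funD.
pose K n := (Num.truncn (n.+1%:R * (2 * M1))).+1.
pose A n k : set T := [set x | k.+1%:R <= n.+1%:R * h x].
have mA n k : measurable (A n k).
  have mm : measurable_fun [set: T] (fun x => n.+1%:R * h x) by exact: measurable_funM.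
  have -> : A n k = setT `&` (fun x => n.+1%:R * h x) @^-1` `[k.+1%:R, +oo[%classic.
    by rewrite setTI; apply/seteqP; split=> x; rewrite /= in_itv/= andbT.
  exact: mm.
pose h_ (n : nat) (x : T) : R := n.+1%:R^-1 * \sum_(k < K n) \1_(A n k) x.
have hE n x : `|h_ n x - h x| <= n.+1%:R^-1.
  have n0 : (0 : R) < n.+1%:R by rewrite ltr0n.
  rewrite /h_ -[h x](mulKf (lt0r_neq0 n0)) -mulrBr normrM ger0_norm ?invr_ge0//.
  rewrite -[leRHS]mulr1 ler_wpM2l ?invr_ge0//.
  have -> : \sum_(k < K n) \1_(A n k) x = \sum_(k < K n) (k.+1%:R <= n.+1%:R * h x)%R%:R :> R.
    apply: eq_bigr => k _; rewrite indicE; congr (_%:R : R).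
    by congr (nat_of_bool _); apply/idP/idP; rewrite inE.
  apply: sum_ltn_truncn; first by rewrite mulr_ge0// ltW.
  apply: (le_trans _ (ltW (truncnS_gt _))).
  by rewrite ler_wpM2l// ltW.
have Hh : H h.
  apply: (@Hlim h_ h (2 * M1 + 1)) => //.
  - move=> n; have := Hlin (n.+1%:R^-1) (Hsum (index_enum _) (fun k : 'I_(K n) => Hind (mA n k))) H0.
    by congr H; apply/funext => x; rewrite addr0.
  - move=> n x; rewrite -[h_ n x](subrK (h x)) (le_trans (ler_normD _ _))// addrC lerD//.
      by rewrite ger0_norm.
    by rewrite (le_trans (hE n x))// invf_le1 ?ltr0n// ler1n.
  - move=> x; apply/cvgrPdist_le => e e0; near=> n.
    rewrite distrC (le_trans (hE n x))//.
    near: n; have := near_infty_natSinv_lt (PosNum e0).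
    by apply: filterS => n /ltW.
have := Hlin (- M1) H1 Hh; congr H; apply/funext => x.
by rewrite /h mulr1 addrCA addNr addr0.
Unshelve. all: by end_near. Qed.

End monotone_class.

Definition orthant (R : realType) (d : nat) (m : 'rV[R]_d) : set 'rV[R]_d :=
  [set x | forall j, x 0 j < m 0 j].

Lemma measurable_orthant (R : realType) (d : nat) (m : 'rV[R]_d) : measurable (orthant m).
Proof.
have -> : orthant m = rect (fun j => `]-oo, m 0 j[%classic).
  by apply/seteqP; split=> x h j; have := h j; rewrite /= in_itv.
by apply: measurable_rect => j; exact: measurable_itv.
Qed.

(** Half-spaces are countable unions of orthants, whose other bounds go to
    infinity. *)
Lemma measurable_orthantE (R : realType) (d : nat) :
  @measurable _ 'rV[R]_d = <<s range (@orthant R d) >>.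
Proof.
apply/seteqP; split; last first.
  apply: smallest_sub; first exact: sigma_algebra_measurable.
  by move=> _ [m _ <-]; exact: measurable_orthant.
apply: smallest_sub; first exact: smallest_sigma_algebra.
move=> B; rewrite -bigcup_seq => -[i _ [C mC <-]].
pose GT := g_sigma_algebraType (range (@orthant R d)).
have mi : measurable_fun [set: GT] (fun x : GT => (x : 'rV[R]_d) 0 i).
  apply: (measurability _ (RGenInftyO.measurableE R)).
    move=> _ [_ [y ->] <-]; rewrite setTI.
  have -> : (fun x : GT => (x : 'rV[R]_d) 0 i) @^-1` `]-oo, y[%classic =
      \bigcup_k orthant (\row_j (if j == i then y else k%:R)).
    apply/seteqP; split=> x /=; rewrite ?in_itv /=.
      move=> xy; exists (\max_j Num.truncn `|(x : 'rV[R]_d) 0%R j|).+1 => // j.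
      rewrite mxE; case: eqP => [->//|_].
      apply: (le_lt_trans (ler_norm _)); apply: (lt_le_trans (truncnS_gt _)).
      by rewrite ler_nat ltnS (leq_bigmax j).
    by move=> [k _ /(_ i)]; rewrite mxE eqxx.
  apply: (@bigcupT_measurable _ GT) => k; apply: sub_sigma_algebra.
  by exists (\row_j (if j == i then y else k%:R)).
by have := mi measurableT C mC; rewrite !setTI.
Qed.

Lemma orthantI (R : realType) (d : nat) : setI_closed (range (@orthant R d)).
Proof.
move=> _ _ [m _ <-] [m' _ <-]; exists (\row_j Num.min (m 0 j) (m' 0 j)) => //.
apply/seteqP; split=> x /=.
  by move=> H; split=> j; have := H j; rewrite mxE lt_min => /andP[].
by move=> [H1 H2] j; rewrite mxE lt_min H1 H2.
Qed.

(** * Deviations from the average and their antiderivatives *)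

Lemma cvg_prodr (R : realType) (I : Type) (r : seq I) (P : pred I)
    (h_ : nat -> I -> R) (h : I -> R) :
  (forall i, P i -> h_ n i @[n --> \oo] --> h i) ->
  \prod_(i <- r | P i) h_ n i @[n --> \oo] --> \prod_(i <- r | P i) h i.
Proof.
move=> H; elim: r => [|i r IH].
  under eq_fun do rewrite big_nil; rewrite big_nil; exact: cvg_cst.
under eq_fun do rewrite big_cons; rewrite big_cons; case: ifPn => // Pi.
by apply: cvgM => //; exact: H.
Qed.

Lemma norm_prod_le1 (R : realType) (I : Type) (r : seq I) (P : pred I) (h : I -> R) :
  (forall i, P i -> `|h i| <= 1) -> `|\prod_(i <- r | P i) h i| <= 1.
Proof.
move=> H; elim: r => [|i r IH]; first by rewrite big_nil normr1.
rewrite big_cons; case: ifPn => // Pi.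
by rewrite normrM -[leRHS]mulr1 ler_pM// H.
Qed.

Section ops.
Variables (R : realType) (d : nat) (a b : 'rV[R]_d).
Hypothesis ab : forall i, a 0 i < b 0 i.
Notation S := ((box a b)°).
Notation clamp := (clamp a b).
Notation side := (side a b).
Notation side_Rint := (side_Rint a b).
Variable (i : 'I_d).
Implicit Types (g h : 'rV[R]_d -> R).

Definition below (x : 'rV[R]_d) (t : R) : R := (t <= x 0 i)%R%:R.

Lemma below_bound x t : `|below x t| <= 1.
Proof. by rewrite /below ger0_norm ?ler0n// lern1 leq_b1. Qed.

Lemma measurable_below2 :
  measurable_fun [set: 'rV[R]_d * R] (fun p => below p.1 p.2).
Proof.
pose e (p : 'rV[R]_d * R) := p.1 0 i - p.2.
have me : measurable_fun [set: 'rV[R]_d * R] e.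
  apply: measurable_funB; last exact: measurable_snd.
  exact: (measurableT_comp (measurable_coord i) measurable_fst).
have mE : measurable [set p : 'rV[R]_d * R | 0 <= e p].
  have -> : [set p : 'rV[R]_d * R | 0 <= e p] = setT `&` e @^-1` `[0, +oo[%classic.
    by rewrite setTI; apply/seteqP; split=> p; rewrite /= in_itv/= andbT.
  exact: me.
have -> : (fun p => below p.1 p.2) = \1_[set p : 'rV[R]_d * R | 0 <= e p] :> ('rV[R]_d * R -> R).
  apply/funext => p; rewrite /below indicE; congr (_%:R); congr nat_of_bool.
  by apply/idP/idP; rewrite inE /= /e subr_ge0.
exact: measurable_indic.
Qed.

Lemma measurable_below x : measurable_fun [set: R] (below x).
Proof. exact: (measurableT_comp measurable_below2 (measurable_pair1 x)). Qed.

Lemma bmeas_below x g : bmeas g -> bmeas (fun t => below x t * g (upd x i t)).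
Proof.
move=> bg; apply: bmeasM.
  by split; [exact: measurable_below|exists 1 => t; exact: below_bound].
by apply: bmeas_comp bg; exact: measurable_upd.
Qed.

(** [dev_antideriv] is the antiderivative of the deviation of g from its
    average; it vanishes on both faces, as a limit of test functions has to do.
    The clamp keeps it bounded outside of the box. *)
Definition antideriv g x : R := \int[lebesgue_measure]_(t in side i) (below x t * g (upd x i t)).
Definition deviation g x : R := g x - avg a b i g x.
Definition dev_antideriv g x : R := antideriv g x - (clamp x 0 i - a 0 i) * avg a b i g x.

Lemma below_integrable x g : bmeas g ->
  lebesgue_measure.-integrable (side i) (EFin \o (fun t => below x t * g (upd x i t))).
Proof.
move=> bg; apply: bmeas_integrable; first exact: measurable_side.
  exact: leb_side_lty.
exact: bmeas_below.
Qed.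

(** The point enters the integrand also through the upper end of the
    integration, so measurability comes from joint measurability in the point
    and t. *)
Lemma measurable_antideriv g : measurable_fun [set: 'rV[R]_d] g ->
  measurable_fun [set: 'rV[R]_d] (antideriv g).
Proof.
move=> mg; apply: (@measurable_Rint_section _ _ _ _ R lebesgue_measure (side i)
  (fun p => below p.1 p.2 * g (upd p.1 i p.2))); first exact: measurable_side.
apply: measurable_funM; first exact: measurable_below2.
exact: (measurableT_comp mg (@measurable_upd2 R d i)).
Qed.

Lemma antideriv_bound g M x : bmeas g -> (forall x, `|g x| <= M) ->
  `|antideriv g x| <= M * (b 0 i - a 0 i).
Proof.
move=> bg gM; apply: (side_integral_bound ab); first exact: below_integrable.
move=> t; rewrite normrM -[leRHS]mul1r ler_pM//; exact: below_bound.
Qed.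

Lemma bmeas_antideriv g : bmeas g -> bmeas (antideriv g).
Proof.
move=> bg; have [mg [M gM]] := bg; split; first exact: measurable_antideriv.
by exists (M * (b 0 i - a 0 i)) => x; exact: antideriv_bound.
Qed.

Lemma clamp_side x : 0 <= clamp x 0 i - a 0 i <= b 0 i - a 0 i.
Proof. by have /andP[h1 h2] := clamp_box ab x i; rewrite subr_ge0 lerD2r h1. Qed.

Lemma bmeas_clamp_coord : bmeas (fun x => clamp x 0 i - a 0 i).
Proof.
split; last first.
  exists (b 0 i - a 0 i) => x; have /andP[h1 h2] := clamp_side x.
  by rewrite ger0_norm.
apply: measurable_funB; last exact: measurable_cst.
apply: continuous_measurable_rV => x.
have C : {for x, continuous ((fun y : 'rV[R]_d => y 0 i) \o clamp)}.
  by apply: continuous_comp; [exact: continuous_clamp|exact: coord_continuous].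
exact: C.
Qed.

Lemma bmeas_deviation g : bmeas g -> bmeas (deviation g).
Proof. by move=> bg; apply: bmeasB => //; exact: bmeas_avg. Qed.

Lemma bmeas_dev_antideriv g : bmeas g -> bmeas (dev_antideriv g).
Proof.
move=> bg; apply: bmeasB; first exact: bmeas_antideriv.
by apply: bmeasM; [exact: bmeas_clamp_coord|exact: bmeas_avg].
Qed.

Lemma avg_lin c g h x : bmeas g -> bmeas h ->
  avg a b i (fun x => c * g x + h x) x = c * avg a b i g x + avg a b i h x.
Proof.
move=> bg bh; have bc : bmeas (fun _ : 'rV[R]_d => c) by exact: bmeas_cst.
rewrite (avgE a b i (fun x => c * g x + h x)) side_RintD//; last exact: bmeasM.
rewrite (@side_RintM _ _ _ _ ab i g (fun=> c))// mulrDr mulrCA.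
by rewrite -(avgE a b i g) -(avgE a b i h).
Qed.

Lemma antideriv_lin c g h x : bmeas g -> bmeas h ->
  antideriv (fun x => c * g x + h x) x = c * antideriv g x + antideriv h x.
Proof.
move=> bg bh; have ms := measurable_side a b i.
rewrite /antideriv -RintegralZl//; last exact: below_integrable.
rewrite -RintegralD//; last 2 first.
- have H : lebesgue_measure.-integrable (side i)
      (fun t => c%:E * (below x t * g (upd x i t))%R%:E)%E.
    by apply: integrableZl; [exact: measurable_side|exact: below_integrable].
  exact: H.
- exact: below_integrable.
by apply: eq_Rintegral => t _; ring.
Qed.

Lemma deviation_lin c g h : bmeas g -> bmeas h ->
  deviation (fun x => c * g x + h x) = fun x => c * deviation g x + deviation h x.
Proof. by move=> bg bh; apply/funext => x; rewrite /deviation avg_lin//; ring. Qed.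

Lemma dev_antideriv_lin c g h : bmeas g -> bmeas h ->
  dev_antideriv (fun x => c * g x + h x) = fun x => c * dev_antideriv g x + dev_antideriv h x.
Proof. by move=> bg bh; apply/funext => x; rewrite /dev_antideriv avg_lin// antideriv_lin//; ring. Qed.

Section lim.
Variables (g_ : nat -> 'rV[R]_d -> R) (g : 'rV[R]_d -> R) (M : R).
Hypotheses (bg_ : forall n, bmeas (g_ n)) (bg : bmeas g).
Hypotheses (gM : forall n x, `|g_ n x| <= M) (gg : forall x, g_ n x @[n --> \oo] --> g x).

Lemma avg_cvg x : avg a b i (g_ n) x @[n --> \oo] --> avg a b i g x.
Proof.
apply: cvgM; first exact: cvg_cst.
apply: (bounded_convergence_Rint (M := M)).
- exact: measurable_side.
- exact: leb_side_lty.
- move=> n; apply: measurable_funTS.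
  exact: (measurableT_comp (bg_ n).1 (measurable_upd x i)).
- apply: measurable_funTS; exact: (measurableT_comp bg.1 (measurable_upd x i)).
- by move=> n t _; exact: gM.
- by apply: aeW => t _; exact: gg.
Qed.

Lemma antideriv_cvg x : antideriv (g_ n) x @[n --> \oo] --> antideriv g x.
Proof.
apply: (bounded_convergence_Rint (M := M)).
- exact: measurable_side.
- exact: leb_side_lty.
- by move=> n; apply: measurable_funTS; have [] := bmeas_below x (bg_ n).
- by apply: measurable_funTS; have [] := bmeas_below x bg.
- move=> n t _; rewrite normrM -[leRHS]mul1r ler_pM//; exact: below_bound.
- by apply: aeW => t _; apply: cvgM; [exact: cvg_cst|exact: gg].
Qed.

Lemma deviation_cvg x : deviation (g_ n) x @[n --> \oo] --> deviation g x.
Proof. by apply: cvgB; [exact: gg|exact: avg_cvg]. Qed.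

Lemma dev_antideriv_cvg x : dev_antideriv (g_ n) x @[n --> \oo] --> dev_antideriv g x.
Proof.
apply: cvgB; first exact: antideriv_cvg.
by apply: cvgM; [exact: cvg_cst|exact: avg_cvg].
Qed.

End lim.

Lemma avg_bound g M x : bmeas g -> (forall x, `|g x| <= M) -> `|avg a b i g x| <= M.
Proof.
move=> bg gM; rewrite avgE normrM ger0_norm; last by rewrite invr_ge0 ltW// side_gt0.
rewrite mulrC ler_pdivrMr ?side_gt0//; exact: side_Rint_bound.
Qed.

Lemma deviation_bound g M x : bmeas g -> (forall x, `|g x| <= M) -> `|deviation g x| <= M + M.
Proof.
by move=> bg gM; rewrite (le_trans (ler_normB _ _))// lerD// avg_bound.
Qed.

Lemma dev_antideriv_bound g M x : bmeas g -> (forall x, `|g x| <= M) ->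
  `|dev_antideriv g x| <= M * (b 0 i - a 0 i) + (b 0 i - a 0 i) * M.
Proof.
move=> bg gM; rewrite (le_trans (ler_normB _ _))// lerD//; first exact: antideriv_bound.
have /andP[h1 h2] := clamp_side x.
by rewrite normrM ler_pM// ?avg_bound// ger0_norm.
Qed.

(** The predicate holds below c and fails above it, and is left unspecified at
    c; it is either t < c or t <= c in the uses. *)
Lemma int_side_init (P : pred R) c : a 0 i <= c <= b 0 i ->
  measurable [set t | P t] ->
  (forall t, side i t -> t < c -> P t) -> (forall t, side i t -> c < t -> ~~ P t) ->
  \int[lebesgue_measure]_(t in side i) (P t)%:R = c - a 0 i.
Proof.
move=> /andP[ac cb] mP Plt Pgt.
have msP : measurable (side i `&` [set t | P t]).
  by apply: measurableI => //; exact: measurable_side.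
have -> : \int[lebesgue_measure]_(t in side i) (P t)%:R =
    fine (lebesgue_measure (side i `&` [set t | P t])).
  rewrite /Rintegral; congr fine.
  transitivity (\int[lebesgue_measure]_(t in side i) (\1_[set t | P t] t)%:E)%E.
    apply: eq_integral => t _; rewrite indicE; congr (_%:R%:E); congr nat_of_bool.
    by apply/idP/idP; rewrite inE.
  by rewrite integral_indic; [rewrite setIC|exact: measurable_side|exact: mP].
suff -> : lebesgue_measure (side i `&` [set t | P t]) = (c - a 0 i)%:E by [].
have E1 : lebesgue_measure `]a 0 i, c[%classic = (c - a 0 i)%:E.
  by rewrite lebesgue_measure_itv/= lte_fin; case: ltgtP ac => // -> _; rewrite subrr.
have E2 : lebesgue_measure `[a 0 i, c]%classic = (c - a 0 i)%:E.
  by rewrite lebesgue_measure_itv/= lte_fin; case: ltgtP ac => // -> _; rewrite subrr.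
(* The set lies between the intervals with and without their end point c. *)
apply/eqP; rewrite eq_le -{1}E2 -{1}E1; apply/andP; split; apply: le_measure;
  rewrite ?inE; try exact: measurable_itv; try exact: msP.
- move=> t [st Pt]; rewrite /= in_itv/=; move: (st); rewrite sideE => /andP[-> _] /=.
  by rewrite leNgt; apply/negP => ct; have := Pgt t st ct; rewrite Pt.
- move=> t; rewrite /= in_itv/= => /andP[at_ tc].
  have st : side i t by rewrite sideE (ltW at_) (le_trans (ltW tc)).
  by split => //; exact: Plt.
Qed.

(** The level m brought back into the side, so that the interval from the lower
    end to it is the trace of t < m on the side up to an end point. *)
Definition cutoff (m : R) j : R := Num.max (a 0 j) (Num.min (b 0 j) m).

Lemma cut_side m j : a 0 j <= cutoff m j <= b 0 j.
Proof. by rewrite /cutoff le_max lexx/= ge_max ge_min lexx /= andbT ltW. Qed.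

Lemma lt_cut m j t : a 0 j < t < b 0 j -> (t < cutoff m j) = (t < m).
Proof.
by move=> /andP[ta tb]; rewrite /cutoff lt_max lt_min tb ltNge (ltW ta).
Qed.

Lemma lt_cut_side m j t : side j t -> t < cutoff m j -> t < m.
Proof.
rewrite sideE => /andP[ta tb]; rewrite /cutoff lt_max lt_min.
by rewrite ltNge ta /= => /andP[].
Qed.

Lemma gt_cut_side m j t : side j t -> cutoff m j < t -> ~~ (t < m).
Proof.
rewrite sideE => /andP[ta tb]; rewrite /cutoff gt_max gt_min.
by rewrite (ltNge (b 0 j)) tb /= -leNgt => /andP[_ /ltW].
Qed.

Section orthant.
Variable m : 'rV[R]_d.
Notation mu := (cutoff (m 0 i) i).
Definition orthant_rest (x : 'rV[R]_d) : R := \prod_(j | j != i) (x 0 j < m 0 j)%R%:R.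

Lemma orthant_prod x : \1_(orthant m) x = orthant_rest x * (x 0 i < m 0 i)%R%:R :> R.
Proof.
rewrite indicE mulrC /orthant_rest -(bigD1 (P := predT) i (F := fun j => (x 0 j < m 0 j)%R%:R : R))//=.
case: (boolP (x \in orthant m)) => [/set_mem H|].
  by rewrite big1// => j _; rewrite H.
rewrite notin_setE => H; have [j Hj] : exists j, ~~ (x 0 j < m 0 j).
  by apply/existsP; rewrite -negb_forall; apply/negP => /forallP.
by rewrite (bigD1 j)//= (negbTE Hj) mul0r.
Qed.

Lemma orthant_rest_upd x t : orthant_rest (upd x i t) = orthant_rest x.
Proof. by apply: eq_bigr => j /negbTE ji; rewrite mxE ji. Qed.

Lemma int_lt : \int[lebesgue_measure]_(t in side i) (t < m 0 i)%R%:R = mu - a 0 i.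
Proof.
apply: (@int_side_init (fun t => t < m 0 i)).
- exact: cut_side.
- rewrite (_ : [set t | _] = `]-oo, m 0 i[%classic); first exact: measurable_itv.
  by apply/seteqP; split => t; rewrite /= !in_itv.
- by move=> t st; exact: lt_cut_side.
- by move=> t st; exact: gt_cut_side.
Qed.

Lemma bmeas_lt : bmeas (fun y : 'rV[R]_d => (y 0 i < m 0 i)%R%:R : R).
Proof.
have -> : (fun y : 'rV[R]_d => (y 0 i < m 0 i)%R%:R : R) =
    \1_(setT `&` (fun y : 'rV[R]_d => y 0 i) @^-1` `]-oo, m 0 i[%classic).
  apply/funext => y; rewrite indicE; congr (_%:R); congr nat_of_bool.
  by apply/idP/idP; rewrite setTI inE /= in_itv.
by apply: bmeas_indic; exact: (measurable_coord i).
Qed.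

Lemma avg_orthant x : avg a b i (\1_(orthant m)) x =
  orthant_rest x * ((mu - a 0 i) / (b 0 i - a 0 i)).
Proof.
rewrite avgE.
have -> : side_Rint i (\1_(orthant m)) x = orthant_rest x * (mu - a 0 i).
  have -> : side_Rint i (\1_(orthant m)) x = side_Rint i (fun y => orthant_rest y * (y 0 i < m 0 i)%R%:R) x.
    by apply: eq_Rintegral => t _; rewrite orthant_prod.
  rewrite side_RintM => [|//||t]; last exact: orthant_rest_upd.
    congr (_ * _); rewrite -int_lt; apply: eq_Rintegral => t _; by rewrite mxE eqxx.
  exact: bmeas_lt.
by rewrite mulrCA (mulrC (_^-1)).
Qed.

Lemma antideriv_orthant x : S x -> antideriv (\1_(orthant m)) x =
  orthant_rest x * (Num.min (x 0 i) mu - a 0 i).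
Proof.
move=> xS; rewrite /antideriv.
have xi : a 0 i < x 0 i < b 0 i by move: xS; rewrite interior_box; exact.
have -> : Num.min (x 0 i) mu - a 0 i =
    \int[lebesgue_measure]_(t in side i) ((t <= x 0 i) && (t < m 0 i))%R%:R.
  have /andP[mu1 mu2] := cut_side (m 0 i) i; have /andP[x1 x2] := xi.
  rewrite (@int_side_init (fun t => (t <= x 0 i) && (t < m 0 i)) (Num.min (x 0 i) mu))//.
  - by rewrite le_min ge_min (ltW x1) (ltW x2) mu1.
  - rewrite (_ : [set t | _] = `]-oo, x 0 i]%classic `&` `]-oo, m 0 i[%classic).
      by apply: measurableI; exact: measurable_itv.
    by apply/seteqP; split => t; rewrite /= !in_itv/= => /andP.
  - move=> t st; rewrite lt_min => /andP[/ltW -> /=]; exact: lt_cut_side.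
  - move=> t st; rewrite gt_min negb_and => /orP[|h].
      by rewrite -ltNge => ->.
    by rewrite (gt_cut_side st h) orbT.
rewrite -RintegralZl; last 2 first.
- exact: measurable_side.
- have Eq : (fun t => ((t <= x 0 i) && (t < m 0 i))%R%:R : R) =
      (fun t => below x t * ((upd x i t) 0 i < m 0 i)%R%:R).
    by apply/funext => t; rewrite /below mxE eqxx -natrM mulnb.
  by rewrite Eq; exact: (below_integrable x bmeas_lt).
apply: eq_Rintegral => t _; rewrite orthant_prod orthant_rest_upd mxE eqxx /below.
by rewrite mulrCA -natrM mulnb.
Qed.

End orthant.

End ops.

(** * The formula of integration by parts for deviations *)

Section BV.
Variables (R : realType) (d : nat) (a b : 'rV[R]_d).
Hypothesis ab : forall i, a 0 i < b 0 i.
Notation S := ((box a b)°).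
Notation clamp := (clamp a b).
Notation side := (side a b).
Notation side_Rint := (side_Rint a b).
Variables (f : 'rV[R]_d -> R).
Hypothesis fi : (leb R d).-integrable (box a b) (EFin \o f).
Variable (i : 'I_d) (nu : {charge set 'rV[R]_d -> \bar R}).
Hypothesis fnu : is_Dmeasure a b f i nu.
Implicit Types (g p q : 'rV[R]_d -> R).
Notation weak_pair := (weak_pair a b f nu).

Section orthant.
Variable m : 'rV[R]_d.
Notation mu j := (cutoff a b (m 0 j) j).

(** A combination of the smooth bumps that tends to the tent function with
    vertex at mu i and zeros at both ends of the side. Indeed (t - a)(b - t) -
    (t - a)(mu - t) = (t - a)(b - mu) on the left of mu, and symmetrically on
    its right, so the quotient by b - a is piecewise affine. [dtent] is the
    derivative. *)
Definition tent n t : R := (b 0 i - a 0 i)^-1 *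
  (quad (a 0 i) (b 0 i) n t - quad (a 0 i) (mu i) n t - quad (mu i) (b 0 i) n t).
Definition dtent n t : R := (b 0 i - a 0 i)^-1 *
  (dquad (a 0 i) (b 0 i) n t - dquad (a 0 i) (mu i) n t - dquad (mu i) (b 0 i) n t).
(** The factors of a product test function: the i-th one approximates the
    antiderivative of the deviation of the indicator of the orthant, the others
    that indicator itself. *)
Definition factor n j : R -> R := if j == i then tent n else plateau (a 0 j) (mu j) n.

Lemma smooth1_sub (u v : R -> R) : smooth1 u -> smooth1 v -> smooth1 (fun t => u t - v t).
Proof.
move=> su sv; have := smooth1_add su (smooth1_mul (smooth1_cst (-1)) sv).
by congr smooth1; apply/funext => t; rewrite mulN1r.
Qed.

Lemma smooth1_tent n : smooth1 (tent n).
Proof.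
apply: smooth1_mul; first exact: smooth1_cst.
by apply: smooth1_sub; [apply: smooth1_sub|]; exact: smooth1_quad.
Qed.

Lemma smooth1_factor n j : smooth1 (factor n j).
Proof. by rewrite /factor; case: ifP => _; [exact: smooth1_tent|exact: smooth1_plateau]. Qed.

Lemma is_derive_tent n (t : R) : is_derive t 1 (tent n) (dtent n t).
Proof.
have D := is_deriveB (is_deriveB (is_derive_quad (a 0 i) (b 0 i) n t)
  (is_derive_quad (a 0 i) (mu i) n t)) (is_derive_quad (mu i) (b 0 i) n t).
exact: (is_deriveZ (b 0 i - a 0 i)^-1 D).
Qed.

Lemma factor_support n j t : factor n j t != 0 ->
  a 0 j + n.+1%:R^-1 <= t <= b 0 j - n.+1%:R^-1.
Proof.
have n0 : (0 : R) < n.+1%:R^-1 by rewrite invr_gt0 ltr0n.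
have H (u v : R) := @plateau_support R u v n t.
move: (n.+1%:R^-1 : R) H n0 => e H e0.
have K (p q : R) : a 0 j <= p -> q <= b 0 j -> plateau p q n t != 0 -> a 0 j + e <= t <= b 0 j - e.
  by move=> ap qb /H /andP[h1 h2]; apply/andP; split; lra.
have /andP[m1 m2] := cut_side ab (m 0 j) j.
rewrite /factor; case: (eqVneq j i) => [ji|_]; last first.
  by apply: K.
rewrite /tent -ji; apply: contraNT => Ht.
have Kq (p q : R) : a 0 j <= p -> q <= b 0 j -> quad p q n t = 0.
  move=> ap qb; rewrite /quad; case: (eqVneq (plateau p q n t) 0) => [->|e1].
    by rewrite mulr0.
  by move: Ht; rewrite (K p q ap qb e1).
by rewrite !Kq// !subr0 mulr0.
Qed.

Lemma tent_bound : exists M, forall n t, a 0 i <= t <= b 0 i ->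
  `|tent n t| <= M /\ `|dtent n t| <= M.
Proof.
have [D HD] := dquad_bound (a 0 i) (b 0 i).
set c := (b 0 i - a 0 i).
have c0 : 0 < c by exact: side_gt0.
exists (c^-1 * (c * c + c * c + c * c) + c^-1 * (D + D + D)) => n t tab.
have aa : a 0 i <= a 0 i <= b 0 i by rewrite lexx ltW.
have bb : a 0 i <= b 0 i <= b 0 i by rewrite lexx ltW.
have mm := cut_side ab (m 0 i) i.
have D0 : 0 <= D by apply: le_trans (HD _ _ n t aa bb tab).
have B3 (x y z M : R) : `|x| <= M -> `|y| <= M -> `|z| <= M -> `|x - y - z| <= M + M + M.
  move=> h1 h2 h3; rewrite (le_trans (ler_normB _ _))// lerD//.
  by rewrite (le_trans (ler_normB _ _))// lerD.
have ci : 0 <= c^-1 by rewrite invr_ge0 ltW.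
split; rewrite normrM (ger0_norm ci).
  apply: ler_wpDr; first by rewrite mulr_ge0// !addr_ge0.
  by rewrite ler_wpM2l//; apply: B3; apply: quad_bound.
apply: ler_wpDl; first by rewrite mulr_ge0// !addr_ge0// mulr_ge0// ltW.
by rewrite ler_wpM2l//; apply: B3; apply: HD.
Qed.

Lemma tent_cvg (t : R) : a 0 i < t < b 0 i ->
  tent n t @[n --> \oo] --> Num.min t (mu i) - a 0 i - (t - a 0 i) * ((mu i - a 0 i) / (b 0 i - a 0 i)).
Proof.
move=> tab; have c0 : b 0 i - a 0 i != 0 by rewrite gt_eqF// side_gt0.
have L : tent n t @[n --> \oo] --> (b 0 i - a 0 i)^-1 *
    ((t - a 0 i) * (b 0 i - t) * (a 0 i < t < b 0 i)%R%:R
     - (t - a 0 i) * (mu i - t) * (a 0 i < t < mu i)%R%:R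
     - (t - mu i) * (b 0 i - t) * (mu i < t < b 0 i)%R%:R).
  apply: cvgM; first exact: cvg_cst.
  by apply: cvgB; [apply: cvgB|]; exact: quad_cvg.
suff <- : (b 0 i - a 0 i)^-1 *
    ((t - a 0 i) * (b 0 i - t) * (a 0 i < t < b 0 i)%R%:R
     - (t - a 0 i) * (mu i - t) * (a 0 i < t < mu i)%R%:R
     - (t - mu i) * (b 0 i - t) * (mu i < t < b 0 i)%R%:R) =
  Num.min t (mu i) - a 0 i - (t - a 0 i) * ((mu i - a 0 i) / (b 0 i - a 0 i)) by exact: L.
have /andP[ta tb] := tab; rewrite tab ta tb /=.
case: (ltgtP t (mu i)) => h; rewrite ?mulr1 ?mulr0.
- by field.
- by field.
- by rewrite -h; field.
Qed.

Lemma dtent_cvg (t : R) : a 0 i < t < b 0 i -> t != mu i ->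
  dtent n t @[n --> \oo] --> (t < mu i)%R%:R - (mu i - a 0 i) / (b 0 i - a 0 i).
Proof.
move=> tab tm; have c0 : b 0 i - a 0 i != 0 by rewrite gt_eqF// side_gt0.
have L : dtent n t @[n --> \oo] --> (b 0 i - a 0 i)^-1 *
    ((a 0 i + b 0 i - 2 * t) * (a 0 i < t < b 0 i)%R%:R
     - (a 0 i + mu i - 2 * t) * (a 0 i < t < mu i)%R%:R
     - (mu i + b 0 i - 2 * t) * (mu i < t < b 0 i)%R%:R).
  apply: cvgM; first exact: cvg_cst.
  by apply: cvgB; [apply: cvgB|]; exact: dquad_cvg.
suff <- : (b 0 i - a 0 i)^-1 *
    ((a 0 i + b 0 i - 2 * t) * (a 0 i < t < b 0 i)%R%:R
     - (a 0 i + mu i - 2 * t) * (a 0 i < t < mu i)%R%:R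
     - (mu i + b 0 i - 2 * t) * (mu i < t < b 0 i)%R%:R) =
    (t < mu i)%R%:R - (mu i - a 0 i) / (b 0 i - a 0 i) by exact: L.
have /andP[ta tb] := tab; rewrite tab ta tb /=.
case: (ltgtP t (mu i)) => h; rewrite ?mulr1 ?mulr0 ?mulr1n ?mulr0n.
- by field.
- by field.
- by move: tm; rewrite h eqxx.
Qed.

Lemma hyperplane_null (c : R) : leb R d [set x : 'rV[R]_d | x 0 i = c] = 0%E.
Proof.
have E : [set x : 'rV[R]_d | x 0 i = c] = rect (fun j => if j == i then [set c] else setT).
  apply/seteqP; split=> x /=; first by move=> xc j; case: eqP => // ->.
  by move=> /(_ i); rewrite eqxx.
transitivity (leb R d (rect (fun j => if j == i then [set c] else setT))).
  by congr (leb R d _).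
rewrite leb_rect; last by move=> j; case: ifP => // _; exact: measurable_set1.
by rewrite (bigD1 i)//= eqxx lebesgue_measure_set1 mul0e.
Qed.

Lemma orthant_restE x : S x -> \prod_(j | j != i) (a 0 j < x 0 j < mu j)%R%:R = orthant_rest i m x.
Proof.
rewrite interior_box /= => xS; apply: eq_bigr => j _.
by have /andP[h1 h2] := xS j; rewrite h1 (lt_cut _ (xS j)).
Qed.

(** For the indicator of an orthant, the antiderivative of the deviation is a
    product of indicators in the other coordinates with a tent function of the
    i-th one, and so a bounded limit of test functions. The derivatives converge
    off the hyperplane through the vertex of the tent. *)
Lemma weak_pair_orthant : weak_pair (deviation a b i (\1_(orthant m))) (dev_antideriv a b i (\1_(orthant m))).
Proof.
have bo : bmeas (\1_(orthant m) : 'rV[R]_d -> R) by apply: bmeas_indic; exact: measurable_orthant.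
pose p_ n := partial i (prodf (factor n)) \o clamp.
pose q_ n := prodf (factor n) \o clamp.
have pE n y : partial i (prodf (factor n)) y =
    (\prod_(j | j != i) plateau (a 0 j) (mu j) n (y 0 j)) * dtent n (y 0 i).
  have D : is_derive (y 0 i) 1 (factor n i) (dtent n (y 0 i)).
    by rewrite /factor eqxx; exact: is_derive_tent.
  rewrite /partial; have [_ ->] := is_derive_prodf D; congr (_ * _).
  by apply: eq_bigr => j ji; rewrite /factor (negbTE ji).
have qE n y : prodf (factor n) y =
    (\prod_(j | j != i) plateau (a 0 j) (mu j) n (y 0 j)) * tent n (y 0 i).
  rewrite /prodf (bigD1 i)//= mulrC /factor eqxx; congr (_ * _).
  by apply: eq_bigr => j ji; rewrite (negbTE ji).
have [M HM] := tent_bound.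
have cl x : S x -> clamp x = x by move=> /interior_subset /clamp_id.
have e1 n (y : 'rV[R]_d) : `|\prod_(j | j != i) plateau (a 0 j) (mu j) n (y 0 j)| <= 1.
  by apply: norm_prod_le1 => j _; exact: plateau_bound.
have cv x : S x -> \prod_(j | j != i) plateau (a 0 j) (mu j) n (x 0 j) @[n --> \oo] --> orthant_rest i m x.
  by move=> xS; rewrite -(orthant_restE xS); apply: cvg_prodr => j _; exact: plateau_cvg.
have xab x : S x -> a 0 i < x 0 i < b 0 i by rewrite interior_box.
have bpq n : bmeas (p_ n) /\ bmeas (q_ n).
  split; apply: bmeas_clamp => //; apply: continuous_subspaceT.
    have [v sv ->] := partial_prodf i (smooth1_factor n); exact: continuous_prodf.
  exact: continuous_prodf (smooth1_factor n).
apply: (weak_pair_lim fi (p_ := p_) (q_ := q_) (M := M)).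
- by move=> n; have [] := bpq n.
- by move=> n; have [] := bpq n.
- exact: bmeas_deviation.
- exact: bmeas_dev_antideriv.
- move=> n x xS; rewrite /p_ /= pE normrM -[leRHS]mul1r ler_pM//.
  by have [] := HM n _ (clamp_box ab x i).
- move=> n x xS; rewrite /q_ /= qE normrM -[leRHS]mul1r ler_pM//.
  by have [] := HM n _ (clamp_box ab x i).
- exists [set x : 'rV[R]_d | x 0 i = mu i]; split; last 2 first.
  + exact: hyperplane_null.
  + move=> x /= /not_implyP[xS H]; apply: contrapT => xm; apply: H.
    rewrite /p_ /= cl//; under eq_fun do rewrite pE.
    rewrite /deviation avg_orthant// (orthant_prod i) -mulrBr.
    apply: cvgM; first exact: cv.
    rewrite -(lt_cut (m 0 i) (xab _ xS)).
    by apply: dtent_cvg; [exact: xab|exact/eqP].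
  + have -> : [set x : 'rV[R]_d | x 0 i = mu i] =
        setT `&` (fun x : 'rV[R]_d => x 0 i) @^-1` [set mu i] by rewrite setTI.
    by apply: (measurable_coord i) => //; exact: measurable_set1.
- move=> x xS; rewrite /q_ /= cl//; under eq_fun do rewrite qE.
  rewrite /dev_antideriv (antideriv_orthant ab)// avg_orthant// cl// mulrCA -mulrBr.
  by apply: cvgM; [exact: cv|exact: tent_cvg (xab _ xS)].
- move=> n; apply: (weak_pair_test ab fnu (l := \row_j (a 0 j + n.+1%:R^-1))
    (r := \row_j (b 0 j - n.+1%:R^-1))).
  + exact: smooth1_factor.
  + by move=> j; rewrite mxE ltrDl invr_gt0 ltr0n.
  + by move=> j; rewrite mxE gtrBl invr_gt0 ltr0n.
  + by move=> j t; rewrite !mxE; exact: factor_support.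
Qed.

End orthant.

(** By the monotone class theorem, the orthants suffice. The constant 1 has
    deviation and antiderivative 0. *)
Lemma weak_pair_ops g : bmeas g -> weak_pair (deviation a b i g) (dev_antideriv a b i g).
Proof.
move=> bg; suff [] : bmeas g /\ weak_pair (deviation a b i g) (dev_antideriv a b i g) by [].
apply: (monotone_class_bounded (@measurable_orthantE R d) (@orthantI R d)
  (H := fun g => bmeas g /\ weak_pair (deviation a b i g) (dev_antideriv a b i g)) _ _ _ _ bg).
- split; first exact: bmeas_cst.
  apply: (weak_pair_eq _ _ (W0 a b f nu)) => x xS.
    by rewrite /deviation (avg_indep ab (h := fun=> 1))// subrr.
  rewrite /dev_antideriv (avg_indep ab (h := fun=> 1))// mulr1 (clamp_id (interior_subset xS)).
  have xi : a 0 i < x 0 i < b 0 i by move: xS; rewrite interior_box; exact.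
  have -> : antideriv a b i (fun=> 1) x = \int[lebesgue_measure]_(t in side i) (t <= x 0 i)%R%:R.
    by apply: eq_Rintegral => t _; rewrite mulr1.
  have /andP[x1 x2] := xi.
  rewrite (@int_side_init _ _ a b i (fun t => t <= x 0 i) (x 0 i)) ?subrr//.
  + by rewrite !ltW.
  + rewrite (_ : [set t | _] = `]-oo, x 0 i]%classic); first exact: measurable_itv.
    by apply/seteqP; split => t; rewrite /= !in_itv.
  + by move=> t _ /ltW.
  + by move=> t _; rewrite -ltNge.
- move=> _ [m _ <-]; split; last exact: weak_pair_orthant.
  by apply: bmeas_indic; exact: measurable_orthant.
- move=> c h h' [bh Wh] [bh' Wh'].
  have bc : bmeas (fun _ : 'rV[R]_d => c) by exact: bmeas_cst.
  split; first by apply: bmeasD => //; exact: bmeasM.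
  rewrite (deviation_lin ab i c bh bh') (dev_antideriv_lin ab i c bh bh').
  exact: (weak_pair_lin fi c (bmeas_deviation ab i bh) (bmeas_dev_antideriv ab i bh) (bmeas_deviation ab i bh') (bmeas_dev_antideriv ab i bh')).
- move=> h_ h M Hh mh hM hh.
  have bh : bmeas h.
    split=> //; exists M => x.
    apply: (cvgr_to_le (cvg_norm (hh x))).
    by apply: nearW => n; exact: hM.
  have bh_ n : bmeas (h_ n) by have [] := Hh n.
  split=> //.
  pose M2 := M + M + (M * (b 0 i - a 0 i) + (b 0 i - a 0 i) * M).
  have M0 : 0 <= M by exact: le_trans (hM 0%N 0).
  have c0 : 0 <= b 0 i - a 0 i by rewrite ltW// side_gt0.
  apply: (weak_pair_lim fi (p_ := fun n => deviation a b i (h_ n)) (q_ := fun n => dev_antideriv a b i (h_ n)) (M := M2)).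
  + by move=> n; exact: bmeas_deviation.
  + by move=> n; exact: bmeas_dev_antideriv.
  + exact: bmeas_deviation.
  + exact: bmeas_dev_antideriv.
  + move=> n x _; apply: (le_trans (deviation_bound ab i x (bh_ n) (hM n))).
    by rewrite lerDl addr_ge0// mulr_ge0.
  + move=> n x _; apply: (le_trans (dev_antideriv_bound ab i x (bh_ n) (hM n))).
    by rewrite lerDr addr_ge0.
  + by apply: aeW => x _; exact: (deviation_cvg ab bh_ bh hM hh).
  + by move=> x _; exact: (dev_antideriv_cvg ab bh_ bh hM hh).
  + by move=> n; have [] := Hh n.
Qed.

End BV.

(** * The bound by the variation in one direction *)

Section coreBV.
Variables (R : realType) (d : nat) (a b : 'rV[R]_d).
Hypothesis ab : forall i, a 0 i < b 0 i.
Notation S := ((box a b)°).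
Notation side := (side a b).
Notation side_Rint := (side_Rint a b).
Variable (i : 'I_d).
Implicit Types (g : 'rV[R]_d -> R).

Lemma avg0_side_Rint g x : avg a b i g x = 0 -> side_Rint i g x = 0.
Proof.
rewrite avgE => /eqP; rewrite mulf_eq0 invr_eq0 gt_eqF ?side_gt0//= => /eqP; exact.
Qed.

(** The integral of g along the whole line being 0, half of it may be
    subtracted, and the weight of |g| becomes 1/2 at every point of the line. *)
Lemma antideriv_centered g x : bmeas g -> avg a b i g x = 0 ->
  `|antideriv a b i g x| <= 2^-1 * side_Rint i (fun y => `|g y|) x.
Proof.
move=> bg gx; have ms := measurable_side a b i.
have bbg := below_integrable ab i x bg.
have ig := section_integrable ab i x bg.
have bag := bmeas_abs bg.
have bhg : bmeas (fun y => 2^-1 * g y) by apply: bmeasM => //; exact: bmeas_cst.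
have ihg := section_integrable ab i x bhg.
have -> : antideriv a b i g x =
    \int[lebesgue_measure]_(t in side i) (below i x t * g (upd x i t) - 2^-1 * g (upd x i t)).
  rewrite RintegralB//.
  rewrite RintegralZl//.
  have -> : \int[lebesgue_measure]_(t in side i) g (upd x i t) = 0 by exact: avg0_side_Rint.
  by rewrite mulr0 subr0.
have ih : lebesgue_measure.-integrable (side i)
    (EFin \o (fun t => below i x t * g (upd x i t) - 2^-1 * g (upd x i t))).
  apply: bmeas_integrable; first exact: measurable_side.
    exact: leb_side_lty.
  apply: bmeasB; first exact: bmeas_below.
  exact: (bmeas_comp (measurable_upd x i) bhg).
have le1 : `|\int[lebesgue_measure]_(t in side i)
      (below i x t * g (upd x i t) - 2^-1 * g (upd x i t))| <=
    \int[lebesgue_measure]_(t in side i)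
      `|below i x t * g (upd x i t) - 2^-1 * g (upd x i t)|.
  by apply: le_normr_Rintegral; [exact: ms|exact: ih].
apply: (le_trans le1).
have -> : 2^-1 * side_Rint i (fun y => `|g y|) x =
    \int[lebesgue_measure]_(t in side i) (2^-1 * `|g (upd x i t)|).
  by rewrite RintegralZl//; exact: (section_integrable ab i x bag).
rewrite le_eqVlt; apply/orP; left; apply/eqP; apply: eq_Rintegral => t _.
rewrite -mulrBl normrM; congr (_ * _); rewrite /below.
by case: (t <= x 0 i); rewrite /= ?mulr1n ?mulr0n ?sub0r ?normrN ger0_norm//; lra.
Qed.

Variable f : 'rV[R]_d -> R.
Hypothesis fi : (leb R d).-integrable (box a b) (EFin \o f).
Variable nu : {charge set 'rV[R]_d -> \bar R}.
Hypothesis fnu : is_Dmeasure a b f i nu.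

(** A centered function is its own deviation, and its antiderivative is at most
    r / 2. *)
Lemma density_int_bound g r : bmeas g -> (forall x, avg a b i g x = 0) ->
  (forall x, side_Rint i (fun y => `|g y|) x <= r) ->
  (`|density_int a b f g|%:E <= (2^-1 * r)%:E * charge_tv nu S)%E.
Proof.
move=> bg gc gr.
have -> : density_int a b f g = - charge_Rint a b nu (dev_antideriv a b i g).
  rewrite -(weak_pair_ops ab fi fnu bg) /density_int; apply: eq_Rintegral => x _.
  by rewrite /deviation gc subr0.
rewrite normrN; apply: charge_Rint_bound => //; first exact: bmeas_dev_antideriv.
move=> x _; rewrite /dev_antideriv gc mulr0 subr0.
by rewrite (le_trans (antideriv_centered bg (gc x)))// ler_wpM2l.
Qed.

Notation a' := (coords (~: [set i])%SET a).
Notation b' := (coords (~: [set i])%SET b).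

(** The envelope bounds the integrals of |g| along almost all lines only, while
    the derivative measure may charge the exceptional ones. Replacing g by 0 on
    those lines does not change the integral against f and keeps g centered. *)
Lemma centered_slice_bound g : bmeas g -> (forall x, avg a b i g x = 0) ->
  (`|\int[leb R d]_(x in box a b) (g x * f x)%:E| <=
   (2^-1)%:E * ess_sup (lebS a' b')
      (fun s => \int[lebesgue_measure]_(t in side i) `|g (upd (embed s) i t)|%:E)
     * charge_tv nu S)%E.
Proof.
move=> bg gc; have [mg [M gM]] := bg; have bag := bmeas_abs bg.
set K := (fun s => \int[_]_(t in _) _)%E.
have KE s : K s = (side_Rint i (fun y => `|g y|) (embed s))%:E by rewrite -(side_int_side_Rint ab i _ bag).
have pos : (0 < lebS a' b' setT)%E by apply: lebS_gt0 => k; rewrite !mxE.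
have K0 s : (0 <= K s)%E by apply: integral_ge0.
have KM s : (K s <= (M * (b 0 i - a 0 i))%:E)%E.
  rewrite KE lee_fin; apply: (le_trans (ler_norm _)); apply: side_Rint_bound => // x.
  by rewrite normr_id.
have [r rE] : exists r, ess_sup (lebS a' b') K = r%:E.
  have h0 : (0 <= ess_sup (lebS a' b') K)%E by apply: ess_sup_gee => //; exact: aeW.
  have h1 : (ess_sup (lebS a' b') K <= (M * (b 0 i - a 0 i))%:E)%E.
    by apply/ess_supP; exact: aeW.
  move: h0 h1; case: (ess_sup _ _) => [r|//|//] _ _; by exists r.
have r0 : 0 <= r by rewrite -lee_fin -rE; apply: ess_sup_gee => //; exact: aeW.
(* The union of the lines along which the integral of |g| is at most the
   envelope. *)
pose B := [set x | side_Rint i (fun y => `|g y|) x <= r].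
have mB : measurable B.
  have mr : measurable_fun [set: 'rV[R]_d] (side_Rint i (fun y => `|g y|)) by have [] := bmeas_side_Rint ab i bag.
  have -> : B = setT `&` (side_Rint i (fun y => `|g y|)) @^-1` `]-oo, r]%classic.
    by rewrite setTI; apply/seteqP; split=> x; rewrite /= in_itv.
  exact: mr.
have bB : bmeas (\1_B : 'rV[R]_d -> R) by exact: bmeas_indic.
have BI x t : \1_B (upd x i t) = \1_B x :> R.
  have E : (upd x i t \in B) = (x \in B).
    by apply/idP/idP => /set_mem H; apply/mem_set; move: H; rewrite /B /= side_Rint_upd.
  by rewrite !indicE E.
pose g' x := \1_B x * g x.
have bg' : bmeas g' by exact: bmeasM.
have gc' x : avg a b i g' x = 0.
  by rewrite avgE (side_RintM ab bg (h := \1_B))// (avg0_side_Rint (gc x)) !mulr0.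
have gr' x : side_Rint i (fun y => `|g' y|) x <= r.
  have -> : (fun y => `|g' y|) = (fun y => \1_B y * `|g y|).
    by apply/funext => y; rewrite /g' normrM indicE ger0_norm.
  rewrite (side_RintM ab bag (h := \1_B))// indicE; case: (boolP (x \in B)) => [/set_mem Bx|_].
    by rewrite mul1r.
  by rewrite mul0r.
have gg' : {ae leb R d, forall x, box a b x -> g x = g' x}.
  have mBc : measurable (~` B) by exact: measurableC.
  have p1 x : (0 <= (\1_(~` B) x)%:E :> \bar R)%E by rewrite lee_fin.
  exists (~` B `&` box a b); split.
  - by apply: measurableI => //; exact: measurable_box.
  - transitivity (\int[leb R d]_(x in box a b) (\1_(~` B) x)%:E)%E.
      by rewrite integral_indic//; exact: measurable_box.
    rewrite (int_box_upd a b i); last 2 first.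
    + exact: measurable_EFin_indic.
    + exact: p1.
    have /ae_lebS HK := ess_sup_ge (lebS a' b') K.
    rewrite (ae_eq_integral (cst 0%E)) ?integral0//.
    + exact: measurable_box.
    + apply: measurable_funTS; exact: (measurableT_comp (measurable_side_int a b i (measurable_EFin_indic mBc) p1)
        (@measurable_embed R d _)).
    + apply: filterS HK => s Hs bs /=.
      rewrite (eq_integral (cst 0%E)) ?integral0// => t _.
      have : B (upd (embed s) i t).
        by rewrite /B /= side_Rint_upd -lee_fin -KE -rE; exact: Hs.
      by move=> Bs; rewrite indicE in_setC mem_set.
  - move=> x /= /not_implyP[bx ne]; split => // Bx; apply: ne.
    by rewrite /g' indicE mem_set// mul1r.
have -> : (\int[leb R d]_(x in box a b) (g x * f x)%:E = (density_int a b f g')%:E)%E.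
  have mS : measurable S by exact: measurable_interior_box.
  have mf : measurable_fun (box a b) f by apply/measurable_EFinP; exact: (measurable_int _ fi).
  have ifg : (leb R d).-integrable (box a b) (EFin \o (fun x => f x * g' x)).
    have := bmeas_mul_integrable (measurable_box a b) bg' fi.
    by apply: eq_integrable => [|x _]; [exact: measurable_box|rewrite /= mulrC].
  have ifgS := mulf_integrable fi bg'.
  rewrite /density_int /Rintegral fineK; last by apply: integrable_fin_num.
  have [N [mN N0 subN]] := ae_interior ab.
  transitivity (\int[leb R d]_(x in box a b) (f x * g' x)%:E)%E.
    apply: ae_eq_integral; first exact: measurable_box.
    - apply/measurable_EFinP; apply: measurable_funM => //; exact: measurable_funTS.
    - exact: (measurable_int _ ifg).
    - by apply: filterS gg' => x Hx bx /=; rewrite Hx// mulrC.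
  rewrite (negligible_integral mN (measurable_box a b) ifg N0) (negligible_integral mN mS ifgS N0).
  congr (integral _ _ _); apply/seteqP; split=> x [bx nN]; split=> //; last first.
    exact: interior_subset bx.
  by apply: contrapT => xi; apply: nN; apply: subN => /= /(_ bx).
rewrite rE -EFinM abse_EFin; exact: density_int_bound.
Qed.
End coreBV.

(** * Envelopes of functions equal almost everywhere *)

Section transfer.
Variables (R : realType) (d : nat) (a b : 'rV[R]_d).
Hypothesis ab : forall i, a 0 i < b 0 i.
Implicit Types (g h phi psi f : 'rV[R]_d -> R) (I : {set 'I_d}).

Lemma box_restrict phi : measurable_fun (box a b) phi ->
  exists2 phi0, measurable_fun [set: 'rV[R]_d] phi0 & {in box a b, phi =1 phi0}.
Proof.
move=> mphi; exists (phi \_ (box a b)).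
  by apply/(measurable_restrictT _ _).1 => //; exact: measurable_box.
by move=> x bx; rewrite patchE bx.
Qed.

Lemma measurable_calPs_box s phi : measurable_fun (box a b) phi ->
  measurable_fun (box a b) (calPs a b s phi).
Proof.
move=> /box_restrict[phi0 m0 e0].
apply: (eq_measurable_fun (calPs a b s phi0)).
  by move=> x bx; rewrite (calPs_eq_box s e0).
exact: measurable_funTS (measurable_calPs a b s m0).
Qed.

Lemma ae_eq_avg_box i g h : measurable_fun (box a b) g -> measurable_fun (box a b) h ->
  ae_eq (leb R d) (box a b) g h ->
  ae_eq (leb R d) (box a b) (avg a b i g) (avg a b i h).
Proof.
move=> /box_restrict[g0 mg0 gg0] /box_restrict[h0 mh0 hh0] gh.
have gh0 : ae_eq (leb R d) (box a b) g0 h0.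
  by apply: filterS gh => x H bx; rewrite -gg0 ?inE// -hh0 ?inE//; exact: H.
have := ae_eq_avg ab i mg0 mh0 gh0; apply: filterS => x H bx.
by rewrite (avg_eq_box i gg0) ?inE// (avg_eq_box i hh0) ?inE//; exact: H.
Qed.

(** Almost every slice of a null set is null. The same holds for the slices
    along one coordinate. *)
Lemma eq_Lambda_mix I g h : measurable_fun (box a b) g -> measurable_fun (box a b) h ->
  ae_eq (leb R d) (box a b) g h -> Lambda_mix a b I g = Lambda_mix a b I h.
Proof.
move=> mg mh gh; apply: eq_ess_sup; apply/ae_lebS.
have := ae_glue I gh; apply: filterS => s Hs bs.
have mk (k : 'rV[R]_d -> R) : measurable_fun (box a b) k ->
    measurable_fun (box (coords I a) (coords I b)) (fun t => `|k (glue_coords s t)|%:E).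
  move=> mk; apply/measurable_EFinP; apply: measurableT_comp => //.
  apply: (measurable_comp (measurable_box a b) _ mk).
    by move=> _ [t bt <-]; exact: (box_glue a b s t).2.
  exact: measurable_funTS (measurable_glue1 s).
apply: ae_eq_integral; [exact: measurable_box|exact: mk|exact: mk|].
by apply: filterS (Hs bs) => t Ht bt; rewrite Ht.
Qed.

Lemma eq_Lambda_sl I g h : measurable_fun (box a b) g -> measurable_fun (box a b) h ->
  ae_eq (leb R d) (box a b) g h -> Lambda_sl a b I g = Lambda_sl a b I h.
Proof.
move=> mg mh gh; apply: eq_bigr => i _; apply: eq_ess_sup; apply/ae_lebS.
have := ae_upd_split i gh; apply: filterS => s Hs bs.
have mk (k : 'rV[R]_d -> R) : measurable_fun (box a b) k ->
    measurable_fun (side a b i) (fun t => `|k (upd (embed s) i t)|%:E).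
  move=> mk; apply/measurable_EFinP; apply: measurableT_comp => //.
  apply: (measurable_comp (measurable_box a b) _ mk).
    by move=> _ [t bt <-]; exact: (box_embed_upd a b s t).2.
  exact: measurable_funTS (measurable_upd (embed s) i).
apply: ae_eq_integral; [exact: measurable_side|exact: mk|exact: mk|].
have [N [mN N0 subN]] := Hs bs; exists N; split => //; apply: subset_trans subN => t /=.
by apply: contra_not => Ht bt; rewrite Ht.
Qed.

Lemma Lambda_sl_ge i I g : i \in I ->
  (ess_sup (lebS (coords (~: [set i])%SET a) (coords (~: [set i])%SET b))
      (fun s => \int[lebesgue_measure]_(t in `[a 0%R i, b 0%R i])
                  `|g (upd (embed s) i t)|%:E) <= Lambda_sl a b I g)%E.
Proof.
by move=> iI; rewrite /Lambda_sl (bigD1 i)//= le_max lexx.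
Qed.

Lemma Lambda_sl_ge0 i I g : i \in I -> (0 <= Lambda_sl a b I g)%E.
Proof.
move=> iI; apply: (le_trans _ (Lambda_sl_ge g iI)); apply: ess_sup_gee.
  by apply: lebS_gt0 => k; rewrite !mxE.
by apply: aeW => s; exact: integral_ge0.
Qed.

(** If the remainder vanishes then phi is almost everywhere a function that is
    centered at every point; conversely each projector removes an average that
    is 0 almost everywhere. *)
Lemma calR_zero_iff_centered I phi : Linfty a b phi ->
  ae_eq (leb R d) (box a b) (calR a b I phi) (cst 0) <-> centered a b I phi.
Proof.
move=> Lphi; have [mphi _] := Lphi; have [psi bpsi ps] := Linfty_bmeas ab Lphi.
have mP s : measurable_fun (box a b) (calPs a b s phi) by exact: measurable_calPs_box.
split=> [R0 i iI|cphi].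
  pose g := calPs a b (enum I) psi.
  have bg : bmeas g by exact: bmeas_calPs.
  have mg : measurable_fun (box a b) g by apply: measurable_funTS; case: bg.
  have phig : ae_eq (leb R d) (box a b) phi g.
    move: (R0) (ps (enum I)); apply: filterS2 => x H1 H2 bx.
    by rewrite /g -H2//; move/eqP: (H1 bx); rewrite /calR/= subr_eq0 => /eqP.
  have := ae_eq_avg_box i mphi mg phig; apply: filterS => x H bx.
  by rewrite H// /g avg_calPs// mem_enum.
have H s : {subset s <= I} -> ae_eq (leb R d) (box a b) (calPs a b s phi) phi.
  elim: s => [_|i s IH sI]; first exact: aeW.
  have {}IH : ae_eq (leb R d) (box a b) (calPs a b s phi) phi.
    by apply: IH => j js; apply: sI; rewrite inE js orbT.
  have iI : i \in I by apply: sI; rewrite mem_head.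
  have A := ae_eq_avg_box i (mP s) mphi IH.
  have C := cphi i iI.
  apply: filterS3 IH A C => x H1 H2 H3 bx.
  by rewrite /= H1// H2// H3// subr0.
have sI : {subset enum I <= I} by move=> i; rewrite mem_enum.
have := H _ sI.
by apply: filterS => x Hx bx; rewrite /calR /= [calP _ _ _ _ _]Hx// subrr.
Qed.

End transfer.

(** * The remainder and the three bounds *)

Section bounds.
Variables (R : realType) (d : nat) (a b : 'rV[R]_d).
Hypothesis ab : forall i, a 0 i < b 0 i.
Implicit Types (g h phi psi f : 'rV[R]_d -> R) (I : {set 'I_d}).

Lemma pdensity_bound f h N : pdensity a b f -> bmeas h ->
  {ae leb R d, forall x, box a b x -> (`|h x|%:E <= N)%E} -> (0 <= N)%E ->
  (`| \int[leb R d]_(x in box a b) (h x * f x)%:E | <= N)%E.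
Proof.
move=> [fi f0 f1] bh hN; case: N hN => [N hN N0|_ _|//]; last by rewrite leey.
have mB := measurable_box a b.
have ihf := bmeas_mul_integrable mB bh fi.
apply: le_trans (le_abse_integral _ mB (measurable_int _ ihf)) _.
have -> : N%:E = (\int[leb R d]_(x in box a b) (N%:E * (f x)%:E))%E.
  by rewrite integralZl// f1 mule1.
have mf := measurable_int _ fi.
have -> : (\int[leb R d]_(x in box a b) (N%:E * (f x)%:E) =
    \int[leb R d]_(x in box a b) (N%:E * `|(f x)%:E|))%E.
  apply: ae_eq_integral.
  - exact: mB.
  - exact: measurable_funeM.
  - by apply: measurable_funeM; exact: measurableT_comp.
  - by apply: filterS f0 => x H bx; rewrite gee0_abs// lee_fin; exact: H.
apply: ae_ge0_le_integral => //.
- by apply: measurableT_comp => //; exact: (measurable_int _ ihf).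
- by move=> x _; rewrite mule_ge0.
- by apply: measurable_funeM; exact: measurableT_comp.
- apply: filterS hN => x H bx; rewrite /= normrM EFinM lee_wpmul2r//.
  exact: H.
Qed.

(** A probability density integrates the remainder to at most its essential
    supremum; what is left is the integral against f of a function that is
    centered at every point. *)
Lemma expect_le_centered I phi psi f : pdensity a b f -> measurable_fun (box a b) phi ->
  bmeas psi ->
  (forall s, ae_eq (leb R d) (box a b) (calPs a b s phi) (calPs a b s psi)) ->
  (`| expect a b f phi | <=
   `| \int[leb R d]_(x in box a b) (calPs a b (enum I) psi x * f x)%:E |
   + 'N[lebS a b]_+oo[EFin \o calR a b I phi])%E.
Proof.
move=> pf mphi bpsi ps; have [fi _ _] := pf.
set g := calPs a b (enum I) psi.
have bg : bmeas g by exact: bmeas_calPs.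
have mB := measurable_box a b.
have mf : measurable_fun (box a b) f by apply/measurable_EFinP; exact: (measurable_int _ fi).
have bpg : bmeas (fun x => psi x - g x) by exact: bmeasB.
have ig := bmeas_mul_integrable mB bg fi.
have ipg := bmeas_mul_integrable mB bpg fi.
have -> : expect a b f phi = (\int[leb R d]_(x in box a b) (g x * f x)%:E +
    \int[leb R d]_(x in box a b) ((psi x - g x) * f x)%:E)%E.
  rewrite -integralD//; apply: ae_eq_integral => //.
  - by apply/measurable_EFinP; exact: measurable_funM.
  - by apply: emeasurable_funD; [exact: (measurable_int _ ig)|exact: (measurable_int _ ipg)].
  - have := ps [::]; apply: filterS => x Hx bx; have /= -> := Hx bx.
    by rewrite -EFinD -mulrDl addrC subrK.
apply: (le_trans (lee_abs_add _ _)); apply: leeD => //.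
apply: (pdensity_bound pf bpg); last exact: Lnorm_ge0.
rewrite unlock (lebS_gt0 ab).
have /ae_lebS := ess_sup_ge (lebS a b) (abse \o (EFin \o calR a b I phi)).
move: (ps [::]) (ps (enum I)); apply: filterS3 => x H1 H2 H3 bx.
have /= e1 := H1 bx; have := H3 bx.
by rewrite /= /calR /= [calP _ _ _ _ _](H2 bx) e1.
Qed.

Lemma DmeasureP f i : (exists nu, is_Dmeasure a b f i nu) ->
  is_Dmeasure a b f i (Dmeasure a b f i).
Proof.
by move=> H; rewrite /Dmeasure; case: pselect => // e; exact: projT2 (cid e).
Qed.

(** The bound by the variation in a single direction i holds for each i in I; it
    is averaged over I. *)
Lemma centered_TV_bound I g f : I != finset.set0 -> bmeas g ->
  (forall i, i \in I -> forall x, avg a b i g x = 0) -> BV a b f ->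
  (`| \int[leb R d]_(x in box a b) (g x * f x)%:E | <=
   ((2 * #|I|)%:R^-1)%:E * Lambda_sl a b I g * TV a b I f)%E.
Proof.
move=> I0 bg gc [fi fD]; have mB := measurable_box a b.
have [i0 i0I] : exists i, i \in I by apply/finset.set0Pn.
have L0 := Lambda_sl_ge0 ab g i0I.
have T0 i : (0 <= charge_tv (Dmeasure a b f i) (box a b)°)%E by exact: adde_ge0.
set A := (`| _ |)%E.
have kp : 0 < #|I|%:R :> R by rewrite ltr0n; apply/card_gt0P; exists i0.
have Ai i : i \in I ->
    (A <= (2^-1)%:E * Lambda_sl a b I g * charge_tv (Dmeasure a b f i) (box a b)°)%E.
  move=> iI; apply: (le_trans (centered_slice_bound ab fi (DmeasureP (fD i)) bg (gc i iI))).
  by apply: lee_wpmul2r => //; apply: lee_wpmul2l; [rewrite lee_fin|exact: Lambda_sl_ge].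
have -> : ((2 * #|I|)%:R^-1)%:E = ((#|I|%:R^-1)%:E * (2^-1)%:E)%E :> \bar R.
  by rewrite -EFinM natrM invfM mulrC.
rewrite -!muleA lee_pdivlMl// /TV ge0_sume_distrr// ge0_sume_distrr; last first.
  by move=> i _; rewrite mule_ge0.
have -> : (#|I|%:R%:E * A = \sum_(i in I) A)%E.
  have : A \is a fin_num.
    by rewrite abse_fin_num; apply: integrable_fin_num; [exact: mB|exact: bmeas_mul_integrable].
  by move=> /fineK <-; rewrite sumEFin sumr_const -EFinM mulr_natl.
by apply: lee_sum => i iI; rewrite muleA; exact: Ai.
Qed.

(** The function is arbitrary outside of the box, so the proof relies on the
    monotonicity of the integral of a nonnegative function as a supremum over
    simple functions. *)
Lemma integral_lebS_ge h : (\int[leb R d]_(x in box a b) `|h x|%:E <=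
  'N[lebS a b]_1[EFin \o h])%E.
Proof.
rewrite Lnorm1.
have -> : (\int[leb R d]_(x in box a b) `|h x|%:E = \int[lebS a b]_(x in box a b) `|h x|%:E)%E.
  apply: eq_measure_integral => A mA Ab.
  by change (leb R d A = leb R d (A `&` box a b)); rewrite setIidl.
rewrite [leLHS]integral_mkcond !ge0_integralTE//; last by move=> x; rewrite patchE; case: ifP.
apply: ereal_sup_le => _ [k kh <-]; exists k => // x.
apply: (le_trans (kh x)); rewrite patchE.
by case: ifP => // _; exact: abse_ge0.
Qed.

(** The Vitali variation evaluates the function at vertices of boxes inside of S
    only. *)
Lemma vitali_clamp f : vitali a b (f \o clamp a b) = vitali a b f.
Proof.
have E m (q : 'I_m -> 'rV[R]_d * 'rV[R]_d) : box_partition a b q ->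
    (\sum_j `|increment (f \o clamp a b) (q j)|) = \sum_j `|increment f (q j)|.
  move=> [lt12 _ U]; apply: eq_bigr => j _; congr `| _ |.
  apply: eq_bigr => v _; congr (_ * _) => /=; congr f; apply: clamp_id.
  rewrite -U; exists j => // i; rewrite !mxE.
  have l12 := ltW (lt12 j i).
  by case: (v i); rewrite ?mul1r ?mul0r ?addr0 ?lexx ?l12//= addrC subrK lexx.
congr ereal_sup; apply/seteqP; split=> _ [m [q [pq ->]]]; exists m, q; split=> //;
  by rewrite E.
Qed.

Lemma vitali_ge0 f : (0 <= vitali a b f)%E.
Proof.
have P1 : box_partition a b (fun _ : 'I_1 => (a, b)).
  split=> //; last by apply/seteqP; split=> x; [case|exists ord0].
  by apply/trivIsetP => j k _ _; rewrite !ord1 eqxx.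
apply: (@le_trans _ _ (\sum_(j < 1) `|increment f (a, b)|)%:E).
  by rewrite lee_fin; exact: sumr_ge0.
by apply: ereal_sup_ubound; exists 1%N, (fun _ => (a, b)).
Qed.

End bounds.

Unset Implicit Arguments.

Theorem theorem2p15 (R : realType) (d : nat) (d1 : (1 <= d)%N)
    (a b : 'rV[R]_d) (ab : forall i, a 0 i < b 0 i)
    (I : {set 'I_d}) (I0 : I != finset.set0)
    (phi : 'rV[R]_d -> R) (phioo : Linfty a b phi) :
  [/\ forall f, pdensity a b f -> BV a b f ->
        (`|expect a b f phi| <=
         ((2 * #|I|)%:R^-1)%:E * Lambda_sl a b I (calP a b I phi) * TV a b I f
         + 'N[lebS a b]_+oo[EFin \o calR a b I phi])%E,
      forall f, pdensity a b f -> Ck a b #|I| f ->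
        (`|expect a b f phi| <=
         (2 ^- #|I|)%:E * Lambda_mix a b I (calP a b I phi)
           * mixed_variation a b I f
         + 'N[lebS a b]_+oo[EFin \o calR a b I phi])%E,
      ae_eq (leb R d) (box a b) (calR a b I phi) (cst 0) <->
        centered a b I phi,
      centered a b I phi ->
        (forall f, pdensity a b f -> BV a b f ->
          (`|expect a b f phi| <=
           ((2 * #|I|)%:R^-1)%:E * Lambda_sl a b I phi * TV a b I f)%E) /\
        (forall f, pdensity a b f -> Ck a b #|I| f ->
          (`|expect a b f phi| <=
           (2 ^- #|I|)%:E * Lambda_mix a b I phi * mixed_variation a b I f)%E)
    & forall f, pdensity a b f -> Ck a b d f ->
        (`|expect a b f phi| <=
         (2 ^- d)%:E * 'N[lebS a b]_1[EFin \o calP a b [set: 'I_d]%SET phi]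
           * vitali a b f
         + 'N[lebS a b]_+oo[EFin \o calR a b [set: 'I_d]%SET phi])%E].
Proof.
have [mphi _] := phioo; have [psi bpsi ps] := Linfty_bmeas ab phioo.
have bP s : bmeas (calPs a b s psi) by exact: bmeas_calPs.
have mP s : measurable_fun (box a b) (calPs a b s psi).
  by apply: measurable_funTS; case: (bP s).
have mphiP J : measurable_fun (box a b) (calP a b J phi) by exact: measurable_calPs_box.
have cP (J : {set 'I_d}) i : i \in J -> forall x, avg a b i (calPs a b (enum J) psi) x = 0.
  by move=> iJ x; apply: avg_calPs => //; rewrite mem_enum.
have to_centered f (pf : pdensity a b f) := expect_le_centered ab I pf mphi bpsi ps.
have zero_iff := calR_zero_iff_centered ab I phioo.
have sl_eq h (mh : measurable_fun (box a b) h) := eq_Lambda_sl I mh (mP (enum I)).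
have mix_eq h (mh : measurable_fun (box a b) h) := eq_Lambda_mix I mh (mP (enum I)).
split=> //.
- move=> f pf Bf; apply: (le_trans (to_centered f pf)); apply: leeD => //.
  by rewrite (sl_eq _ (mphiP I) (ps _))//; apply: centered_TV_bound => //; exact: cP.
- move=> f pf Cf; apply: (le_trans (to_centered f pf)); apply: leeD => //.
  by rewrite (mix_eq _ (mphiP I) (ps _))//; apply: centered_mixed_bound => //; exact: cP.
- move=> /zero_iff R0.
  have phig : ae_eq (leb R d) (box a b) phi (calPs a b (enum I) psi).
    move: R0 (ps (enum I)); apply: filterS2 => x H1 H2 bx.
    by rewrite -H2//; move/eqP: (H1 bx); rewrite /calR/= subr_eq0 => /eqP.
  have N0 : 'N[lebS a b]_+oo[EFin \o calR a b I phi]%E = 0%E.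
    rewrite unlock (lebS_gt0 ab); apply: abs_ess_sup_eq0; first exact: lebS_gt0.
    have /ae_lebS : {ae leb R d, forall x, box a b x -> calR a b I phi x = 0} by exact: R0.
    by apply: filterS => x /= -> _.
  split=> f pf Hf; apply: (le_trans (to_centered f pf)); rewrite N0 adde0.
    by rewrite (sl_eq _ mphi phig)//; apply: centered_TV_bound => //; exact: cP.
  by rewrite (mix_eq _ mphi phig)//; apply: centered_mixed_bound => //; exact: cP.
- move=> f pf Cf; apply: (le_trans (expect_le_centered ab [set: 'I_d] pf mphi bpsi ps)).
  apply: leeD => //.
  set g := calPs a b _ psi.
  have bg : bmeas g by exact: bP.
  have bf : bmeas (f \o clamp a b) by apply: bmeas_clamp => //; exact: Ck_continuous Cf.
  have -> : (\int[leb R d]_(x in box a b) (g x * f x)%:E =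
      (box_Rint a b (fun x => g x * (f \o clamp a b) x)%R)%:E)%E.
    rewrite EFin_box_Rint//; last exact: bmeasM.
    by apply: eq_integral => x /set_mem bx; rewrite /= clamp_id.
  rewrite abse_EFin; apply: (le_trans (centered_vitali_bound ab bg bf _)).
    by move=> i; apply: cP; rewrite inE.
  rewrite vitali_clamp// lee_wpmul2r//.
    exact: vitali_ge0.
  rewrite lee_wpmul2l// ?lee_fin ?invr_ge0 ?exprn_ge0//.
  apply: le_trans (integral_lebS_ge a b _).
  rewrite le_eqVlt; apply/orP; left; apply/eqP.
  have mabs (k : 'rV[R]_d -> R) : measurable_fun (box a b) k -> measurable_fun (box a b) (fun x => `|k x|%:E : \bar R).
    by move=> mk; apply/measurable_EFinP; exact: measurableT_comp.
  apply: ae_eq_integral; [exact: measurable_box|exact: mabs (mP _)|exact: mabs (mphiP _)|].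
  apply: filterS (ps (enum [set: 'I_d]%SET)) => x H bx.
  have e : calP a b [set: 'I_d]%SET phi x = g x by exact: (H bx).
  by rewrite e.
Qed.
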